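(* Let $T,\sigma,\gamma>0$, $l\in(0,\frac{1}{2T\sigma^2\gamma})$ and $B$ a standard Brownian motion. For $g\in\mathcal{X}_l$ and $z\in\mathbb{R}$ denote $$G_g(z)=\frac{1}{\sqrt{2\pi\sigma^2T}}\int_{\mathbb{R}}e^{\frac{z^2}{2\sigma^2T}+\gamma\tilde g(z+y)-\frac{1}{2\sigma^2T}y^2}dy=\mathbb{E}\left[e^{\frac{z^2}{2\sigma^2T}+\gamma\tilde g(z+\sigma B_T)}\right].$$ Then, extending the domain of $\chi^{\tilde g}(0,0)$ and $\Gamma^{\tilde g}(0,0)$ (as functions of $\tilde g$) from $\{g:\tilde g\in C_{l,\alpha}\}$ to all $g\in\mathcal{X}_l$, one has for all $g\in\mathcal{X}_l$ $$\chi^{\tilde g}(0,0)=\operatorname*{arg\,min}_{z\in\mathbb{R}}G_g(z),\qquad \Gamma^{\tilde g}(0,0)=\min_{z\in\mathbb{R}}\frac{\ln G_g(z)}{\gamma}-\frac{(\chi^{\tilde g}(0,0))^2}{2\sigma^2\gamma T}.$$ (That is: for every $g\in\mathcal{X}_l$ the function $G_g$ has a unique minimizer, and the right-hand sides coincide with the PDE-defined quantities $\chi^{\tilde g}(0,0)$, $\Gamma^{\tilde g}(0,0)$ whenever $\tilde g\in C_{l,\alpha}$; for other $g$ they define the extension.) Additionally, $\chi^{\tilde g}(0,0)$ and $\Gamma^{\tilde g}(0,0)$ are bounded by a constant that only depends on $(g(0),\gamma,\sigma,T)$, and if $g^n\in\mathcal{X}_l$ $(n\ge 0)$ satisfy $g^n\to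 g^0$ uniformly on compact sets, then $$(\chi^{\tilde g^n}(0,0),\Gamma^{\tilde g^n}(0,0))\to(\chi^{\tilde g^0}(0,0),\Gamma^{\tilde g^0}(0,0)).$$
   Context: $\mathcal{X}_l=\{g:\mathbb{R}\to\mathbb{R}\text{ Lipschitz}: 0\le g'\le l\text{ a.e.}\}$. For $g\in\mathcal{X}_l$, $\tilde g$ denotes the antiderivative of $g$ with $\tilde g(0)=0$. Fix $\alpha\in(0,1)$; $C_{l,\alpha}$ is the set of $\phi:\mathbb{R}\to\mathbb{R}$ in $C^{4+\alpha}_{loc}$ with $0\le\partial_{\xi\xi}\phi\le l$ and $\phi(0)=0$. For $\phi\in C_{l,\alpha}$, $P^\phi$ is the unique $C^{1,2}([0,T]\times\mathbb{R})$ solution of $\partial_tP+\frac{\sigma^2\partial_{\xi\xi}P}{2(1-\gamma\sigma^2(T-t)\partial_\xi P)^2}=0$, $P(T,\cdot)=\partial_\xi\phi$ (it is $l$-Lipschitz and nondecreasing in $\xi$), and $$\chi^\phi(t,\xi)=\xi-\gamma\sigma^2(T-t)P^\phi(t,\xi),$$ $$\Gamma^\phi(t,\xi)=\int_t^T\frac{\sigma^2\partial_\xi P^\phi(s,0)}{2(1-\gamma\sigma^2(T-s)\partial_\xi P^\phi(s,0))}ds+\int_0^\xi P^\phi(t,r)dr-\frac{\gamma\sigma^2(T-t)}{2}(P^\phi(t,\xi))^2.$$ *)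

(* Defs.v *)
From HB Require Import structures.
From mathcomp Require Import all_boot all_order all_algebra.
From mathcomp Require Import all_classical all_reals all_analysis.

Set Implicit Arguments.
Unset Strict Implicit.
Unset Printing Implicit Defensive.

Import Order.TTheory GRing.Theory Num.Theory.
Import numFieldNormedType.Exports.

Local Open Scope classical_set_scope.
Local Open Scope ring_scope.

Definition oriented_integral {R : realType} (f : R -> R) (a b : R) : R :=
  if a <= b then \int[lebesgue_measure]_(x in `[a, b]) f x
  else - \int[lebesgue_measure]_(x in `[b, a]) f x.

Definition antiderivative {R : realType} (g : R -> R) (x : R) : R :=
  oriented_integral g 0 x.

Lemma antiderivative0 {R : realType} (g : R -> R) : antiderivative g 0 = 0.
Proof.
by rewrite /antiderivative /oriented_integral lexx set_itv1 Rintegral_set1.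
Qed.

Lemma is_derive_antiderivative {R : realType} (g : R -> R) (x : R) :
  continuous g -> is_derive x 1 (antiderivative g) (g x).
Proof.
move=> gc.
have gi a b : lebesgue_measure.-integrable `[a, b] (EFin \o g).
  apply: continuous_compact_integrable; first exact: segment_compact.
  exact: continuous_subspaceT.
have [c [cx c0]] : exists c : R, c < x /\ c < 0.
  by exists (Num.min x 0 - 1); rewrite !ltrBlDr; split;
    rewrite gt_min ?ltrDl ltr01 ?orbT.
have xx1 : x < x + 1 by rewrite ltrDl ltr01.
have [dF F'] := @continuous_FTC1_closed R g c x (x + 1) xx1 (gi _ _) cx (gc x).
set F := (fun y => Rintegral _ _ _) in dF F'.
have split_at (a b : R) : c < a -> a <= b ->
    F b - F a = \int[lebesgue_measure]_(t in `[a, b]) g t.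
  move=> ca ab; rewrite Rintegral_itvB ?bnd_simp ?(ltW ca)//.
  by rewrite Rintegral_itv_obnd_cbnd//; apply: integrableS (gi a b) => //;
    exact: subset_itv_oc_cc.
have E y : c < y -> F y - F 0 = antiderivative g y.
  move=> cy; rewrite /antiderivative /oriented_integral.
  case: ifPn => [y0|]; first by rewrite split_at.
  by rewrite -ltNge => /ltW y0; rewrite -split_at// opprB.
apply: (@near_eq_is_derive _ _ _ (fun y => F y - F 0)).
  by near=> y; apply: E; near: y; exact: lt_nbhsr.
apply: is_derive_eq; last exact: subr0.
apply: is_deriveB.
by apply: DeriveDef => //; rewrite -derive1E.
Unshelve. all: by end_near. Qed.

Definition X_l {R : realType} (l : R) : set (R -> R) :=
  [set g : R -> R | lipschitz g /\
    {ae lebesgue_measure, forall x, derivable g x 1 /\ 0 <= derive1 g x <= l}].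

(* The local Hoelder bound makes the fourth derivative continuous, so no
   separate continuity clause is needed. *)
Definition C4alpha_loc {R : realType} (alpha : R) : set (R -> R) :=
  [set phi : R -> R | (forall k x, (k < 4)%N -> derivable (derive1n k phi) x 1) /\
    forall r : R, exists c : R, forall x y : R, `|x| <= r -> `|y| <= r ->
      `|derive1n 4 phi x - derive1n 4 phi y| <= c * `|x - y| `^ alpha].

Definition C_l_alpha {R : realType} (l alpha : R) : set (R -> R) :=
  [set phi : R -> R | [/\ C4alpha_loc alpha phi,
    forall xi, 0 <= derive1n 2 phi xi <= l & phi 0 = 0]].

Definition dt_quotient {R : realType} (P : R -> R -> R) (t xi s : R) : R :=
  (P s xi - P t xi) / (s - t).

(* The limit is taken within [0, T], hence one-sided at t = 0 and t = T. *)
Definition dt {R : realType} (T : R) (P : R -> R -> R) (t xi : R) : R :=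
  lim (dt_quotient P t xi s @[s --> within `[0, T] t^']).

Definition C12 {R : realType} (T : R) : set (R -> R -> R) :=
  [set P : R -> R -> R |
    (forall t xi : R, 0 <= t <= T ->
      [/\ cvg (dt_quotient P t xi s @[s --> within `[0, T] t^']),
          derivable (P t) xi 1 & derivable (derive1 (P t)) xi 1]) /\
    let strip : set (R * R) := `[0, T] `*` [set: R] in
    [/\ {within strip, continuous (fun p : R * R => P p.1 p.2)},
        {within strip, continuous (fun p : R * R => dt T P p.1 p.2)},
        {within strip, continuous (fun p : R * R => derive1 (P p.1) p.2)} &
        {within strip, continuous (fun p : R * R => derive1n 2 (P p.1) p.2)}]].

(* The function P^phi. The second clause records that P^phi is l-Lipschitz and
   nondecreasing in xi; with l < 1 / (2 T sigma^2 gamma) it keeps the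
   denominator of the equation away from 0. *)
Definition is_P {R : realType} (T sigma gamma l : R) (phi : R -> R)
    (P : R -> R -> R) : Prop :=
  [/\ C12 T P,
      forall t : R, 0 <= t <= T ->
        l.-lipschitz (P t) /\ {homo P t : x y / x <= y},
      forall t xi : R, 0 <= t <= T ->
        dt T P t xi + sigma ^+ 2 * derive1n 2 (P t) xi /
          (2 * (1 - gamma * sigma ^+ 2 * (T - t) * derive1 (P t) xi) ^+ 2) = 0 &
      forall xi, P T xi = derive1 phi xi].

Definition chi {R : realType} (T sigma gamma : R) (P : R -> R -> R)
    (t xi : R) : R :=
  xi - gamma * sigma ^+ 2 * (T - t) * P t xi.

Definition Gam {R : realType} (T sigma gamma : R) (P : R -> R -> R)
    (t xi : R) : R :=
  oriented_integral (fun s => sigma ^+ 2 * derive1 (P s) 0 /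
    (2 * (1 - gamma * sigma ^+ 2 * (T - s) * derive1 (P s) 0))) t T
  + oriented_integral (P t) 0 xi
  - gamma * sigma ^+ 2 * (T - t) / 2 * P t xi ^+ 2.

Definition G_integrand {R : realType} (T sigma gamma : R) (g : R -> R)
    (z y : R) : R :=
  expR (z ^+ 2 / (2 * sigma ^+ 2 * T) + gamma * antiderivative g (z + y)
        - y ^+ 2 / (2 * sigma ^+ 2 * T)).

Definition G {R : realType} (T sigma gamma : R) (g : R -> R) (z : R) : R :=
  (Num.sqrt (2 * pi * sigma ^+ 2 * T))^-1 *
  \int[lebesgue_measure]_y G_integrand T sigma gamma g z y.

Definition argmin {R : realType} (f : R -> R) : set R :=
  [set z | forall y, f z <= f y].

Definition is_minimum {R : realType} (f : R -> R) (m : R) : Prop :=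
  (exists z, f z = m) /\ forall z, m <= f z.

(* Standard Brownian motion, indexed by the t >= 0; B t is unconstrained for
   t < 0. *)
Definition brownian_motion {R : realType} {d : measure_display}
    {Omega : measurableType d} (Pr : probability Omega R)
    (B : R -> {RV Pr >-> R}) : Prop :=
  [/\ {ae Pr, forall w, B 0 w = 0},
      (forall (n : nat) (t : nat -> R) (A : nat -> set R),
        0 <= t 0%N -> (forall i, t i <= t i.+1) ->
        (forall i, measurable (A i)) ->
        Pr [set w | forall i, (i < n)%N -> A i (B (t i.+1) w - B (t i) w)] =
        (\prod_(i < n) Pr [set w | A i (B (t i.+1) w - B (t i) w)%R])%E),
      (forall (s t : R) (A : set R), 0 <= s -> s < t -> measurable A ->
        Pr [set w | A (B t w - B s w)] = normal_prob 0 (Num.sqrt (t - s)) A) &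
      {ae Pr, forall w,
        {within [set t : R | 0 <= t], continuous (fun t => B t w)}}].

(* Main.v *)
Require Import Defs.
From HB Require Import structures.
From mathcomp Require Import all_boot all_order all_algebra.
From mathcomp Require Import all_classical all_reals all_analysis.
From mathcomp Require Import measurable_realfun ring lra.

(** The equation for P is the heat equation in disguise. Write
    a = gamma sigma^2 (T - t) and let M be the potential with M_xi = P,
    M(T, .) = antiderivative g and M_t = - sigma^2 P_xi / (2 (1 - a P_xi)).
    Put V = M - a P^2 / 2 and z = chi(t, xi) = xi - a P. At fixed t the
    differential of V in xi is P dz, so that V, seen as a function of (t, z),
    has gradient P and solves V_t + sigma^2 / 2 (V_zz + gamma V_z^2) = 0. By the
    Hopf-Cole transformation exp (gamma V) solves the backward heat equation in
    (t, z), with terminal value exp (gamma M(T, .)). Therefore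
<<
      exp (gamma V(0, xi)) = heat f (sigma^2 T) (chi(0, xi)),
      f = exp (gamma antiderivative g),
>>
    which is [hodograph_heat]. Instead of inverting chi, its proof compares the
    two sides as functions of (t, xi): the difference satisfies a maximum
    principle, once a multiple of a supersolution that outgrows both sides is
    subtracted ([hodograph_comparison]). Both sides grow at most like
    exp (C |z| + z^2 / (2 sigma^2 (t + T))); this is where
    2 T sigma^2 gamma l < 1 is used.

    With s = sigma^2 T, G(z) is exp (z^2 / (2 s)) times the same heat integral
    at z, up to the scale of the integration variable ([G_heat]).
    Hence ln G(chi(0, xi)) = chi(0, xi)^2 / (2 s) + gamma V(0, xi), whose
    derivative in xi is (1 - a P_xi) xi / s. It has the sign of xi, and chi(0, .)
    is onto, so the minimum of G is attained at chi(0, 0); since V(0, 0) is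
    Gamma(0, 0), the value of the minimum identifies Gamma(0, 0) as well
    ([is_P_argmin]).

    For an arbitrary g, G is a Laplace transform of a positive weight, hence
    strictly convex ([G_laplace], [G_strictly_convex]), and it is bounded below
    by the exponential of a quadratic polynomial ([G_lower]). So the minimizer
    exists and is unique, and comparing the lower bound with an upper bound for
    G(0) bounds it explicitly. Dominated convergence makes G continuous in
    (g, z); minimizers of strictly convex functions follow pointwise
    convergence, which gives the continuity of the extension
    ([G_argmin_cvg]). *)

Set Implicit Arguments.
Unset Strict Implicit.
Unset Printing Implicit Defensive.

Import Order.TTheory GRing.Theory Num.Theory.
Import numFieldNormedType.Exports.

Local Open Scope classical_set_scope.
Local Open Scope ring_scope.

(** * Derivatives and limits of explicit expressions *)

(** The rules below restate differentiation rules for functions given by an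
    explicit body, the form in which [differentiate] meets them. *)
Lemma is_derive_addE (R : realType) (f g : R -> R) (x a b : R) :
  is_derive x 1 f a -> is_derive x 1 g b ->
  is_derive x 1 (fun y => f y + g y) (a + b).
Proof. exact: is_deriveD. Qed.

Lemma is_derive_oppE (R : realType) (f : R -> R) (x a : R) :
  is_derive x 1 f a -> is_derive x 1 (fun y => - f y) (- a).
Proof. exact: is_deriveN. Qed.

Lemma is_derive_mulE (R : realType) (f g : R -> R) (x a b : R) :
  is_derive x 1 f a -> is_derive x 1 g b ->
  is_derive x 1 (fun y => f y * g y) (f x * b + g x * a).
Proof. exact: is_deriveM. Qed.

Lemma is_derive_sqrE (R : realType) (f : R -> R) (x a : R) :
  is_derive x 1 f a -> is_derive x 1 (fun y => f y ^+ 2) (2 * f x * a).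
Proof.
by move=> fa; rewrite (_ : 2 * f x * a = f x * a + f x * a) ?mulrDl -?mulrA;
  [exact: is_deriveM|ring].
Qed.

Lemma is_derive_invE (R : realType) (f : R -> R) (x a : R) :
  f x != 0 -> is_derive x 1 f a ->
  is_derive x 1 (fun y => (f y)^-1) (- a / f x ^+ 2).
Proof.
move=> fx0 fa; apply: (is_derive_eq (is_deriveV fx0 fa)).
by rewrite /GRing.scale/= mulrC mulrN mulNr.
Qed.

Lemma is_derive_compE (R : realType) (g f : R -> R) (x a b : R) :
  is_derive (f x) 1 g b -> is_derive x 1 f a ->
  is_derive x 1 (fun y => g (f y)) (b * a).
Proof. by move=> gb fa; apply: is_derive1_comp. Qed.

Lemma is_derive_expRE (R : realType) (f : R -> R) (x a : R) :
  is_derive x 1 f a -> is_derive x 1 (fun y => expR (f y)) (expR (f x) * a).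
Proof. by apply: is_derive_compE; exact: is_derive_expR. Qed.

Lemma is_derive_lnE (R : realType) (f : R -> R) (x a : R) : 0 < f x ->
  is_derive x 1 f a -> is_derive x 1 (fun y => ln (f y)) (a / f x).
Proof.
by move=> fx0; rewrite mulrC; apply: is_derive_compE; exact: is_derive1_ln.
Qed.

Lemma is_derive_cstE (R : realType) (c x : R) : is_derive x 1 (fun=> c) 0.
Proof. exact: is_derive_cst. Qed.

Lemma is_derive_idE (R : realType) (x : R) : is_derive x 1 (fun y => y) 1.
Proof. exact: is_derive_id. Qed.

(** Differentiates an explicit expression, leaving as goals the derivatives of
    the opaque subterms, the nonvanishing of the denominators, and, last, the
    identity between the computed and the claimed derivative. *)
Ltac differentiate :=
  eapply is_derive_eq;
  [ repeat first
    [ eassumption | eapply is_derive_cstE | eapply is_derive_idE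
    | eapply is_derive_addE | eapply is_derive_oppE | eapply is_derive_sqrE
    | eapply is_derive_invE
    | eapply is_derive_expRE | eapply is_derive_lnE | eapply is_derive_mulE ]
  | cbv beta ].

Lemma cvg_addE (R : realType) (T : Type) (X : filteredType T) (F : X)
    (FF : Filter (nbhs F))
    (f g : T -> R) (a b : R) :
  f x @[x --> F] --> a -> g x @[x --> F] --> b ->
  (f x + g x) @[x --> F] --> a + b.
Proof. exact: cvgD. Qed.

Lemma cvg_oppE (R : realType) (T : Type) (X : filteredType T) (F : X)
    (FF : Filter (nbhs F))
    (f : T -> R) (a : R) :
  f x @[x --> F] --> a -> (- f x) @[x --> F] --> - a.
Proof. exact: cvgN. Qed.

Lemma cvg_mulE (R : realType) (T : Type) (X : filteredType T) (F : X)
    (FF : Filter (nbhs F))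
    (f g : T -> R) (a b : R) :
  f x @[x --> F] --> a -> g x @[x --> F] --> b ->
  (f x * g x) @[x --> F] --> a * b.
Proof. exact: cvgM. Qed.

Lemma cvg_sqrE (R : realType) (T : Type) (X : filteredType T) (F : X)
    (FF : Filter (nbhs F))
    (f : T -> R) (a : R) :
  f x @[x --> F] --> a -> (f x ^+ 2) @[x --> F] --> a ^+ 2.
Proof. by move=> fa; apply: cvgM. Qed.

Lemma cvg_normE (R : realType) (T : Type) (X : filteredType T) (F : X)
    (FF : Filter (nbhs F))
    (f : T -> R) (a : R) :
  f x @[x --> F] --> a -> `|f x| @[x --> F] --> `|a|.
Proof. exact: cvg_norm. Qed.

Lemma cvg_expRE (R : realType) (T : Type) (X : filteredType T) (F : X)
    (FF : Filter (nbhs F))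
    (f : T -> R) (a : R) :
  f x @[x --> F] --> a -> expR (f x) @[x --> F] --> expR a.
Proof. by move=> fa; apply: (cvg_comp _ _ fa (@continuous_expR _ _)). Qed.

Lemma cvg_cstE (R : realType) (T : Type) (X : filteredType T) (F : X)
    (FF : Filter (nbhs F))
    (a : R) : a @[_ --> F] --> a.
Proof. exact: cvg_cst. Qed.

Lemma cvg_idE (R : realType) (a : R) : x @[x --> a] --> a.
Proof. exact: cvg_id. Qed.

(** The same, for limits: the shape of the function selects the rule, and
    hypotheses supply the limits of the opaque subterms. *)
Ltac take_limit_step :=
  lazymatch goal with
  | |- cvg_to (nbhs (fmap ?f _)) _ =>
    lazymatch f with
    | (fun x => x) => eapply cvg_idE
    | (fun _ => ?a) => eapply cvg_cstE
    | (fun x => _ + _) => eapply cvg_addE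
    | (fun x => - _) => eapply cvg_oppE
    | (fun x => _ ^+ 2) => eapply cvg_sqrE
    | (fun x => expR _) => eapply cvg_expRE
    | (fun x => `|_|) => eapply cvg_normE
    | (fun x => _ * _) => eapply cvg_mulE
    end
  end.

Ltac take_limit := rewrite /continuous_at; repeat first
  [ eassumption | take_limit_step | exact: eventually_filter | exact: nbhs_filter ].

(** * Integrals and monotonicity on the line *)

Lemma lebesgue_ae_mono (R : realType) (P Q : R -> Prop) :
  (forall x, P x -> Q x) -> {ae lebesgue_measure, forall x, P x} ->
  {ae lebesgue_measure, forall x, Q x}.
Proof.
move=> PQ; apply: filterS PQ.
exact: (ae_filter_ringOfSetsType lebesgue_measure).
Qed.

Lemma Rintegral_dominated_cvg (R : realType) (D : set R) (F : nat -> R -> R)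
    (f b : R -> R) :
  measurable D -> (forall n, measurable_fun D (F n)) -> measurable_fun D f ->
  {ae lebesgue_measure, forall x, D x -> F n x @[n --> \oo] --> f x} ->
  lebesgue_measure.-integrable D (EFin \o b) ->
  (forall n x, D x -> `|F n x| <= b x) ->
  \int[lebesgue_measure]_(x in D) F n x @[n --> \oo] -->
  \int[lebesgue_measure]_(x in D) f x.
Proof.
move=> mD mF mf Ff ib Fb.
have mFE n := (measurable_EFinP D (F n)).2 (mF n).
have mfE := (measurable_EFinP D f).2 mf.
have cE : {ae lebesgue_measure, forall x, D x ->
    (EFin \o F n) x @[n --> \oo] --> (EFin \o f) x}.
  by apply: lebesgue_ae_mono Ff => x /[apply] h; apply: cvg_EFin => //; exact: nearW.
have dE : {ae lebesgue_measure, forall x n, D x ->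
    (`|(EFin \o F n) x| <= (EFin \o b) x)%E}.
  by apply: aeW => x n Dx; rewrite /= lee_fin Fb.
have [if_ _ H] := @dominated_convergence _ _ _ lebesgue_measure D mD
  (fun n => EFin \o F n) (EFin \o f) (EFin \o b) mFE mfE cE ib dE.
by apply: fine_cvg; rewrite fineK ?integrable_fin_num.
Qed.

Lemma continuous_integrable_itv (R : realType) (f : R -> R) (a b : R) :
  continuous f -> lebesgue_measure.-integrable `[a, b] (EFin \o f).
Proof.
move=> cf; apply: continuous_compact_integrable; first exact: segment_compact.
exact: continuous_subspaceT.
Qed.

Lemma is_derive_continuous (R : realType) (f df : R -> R) :
  (forall x : R, is_derive x 1 f (df x)) -> continuous f.
Proof.
move=> fd x; apply: differentiable_continuous; apply/derivable1_diffP.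
by have [] := fd x.
Qed.

(** The derivative is asked for inside the interval only, since time derivatives
    below are two-sided only at interior times. *)
Lemma Rintegral_FTC2 (R : realType) (F f : R -> R) (a b : R) : a <= b ->
  continuous f -> {within `[a, b], continuous F} ->
  (forall x : R, a < x < b -> is_derive x 1 F (f x)) ->
  \int[lebesgue_measure]_(x in `[a, b]) f x = F b - F a.
Proof.
rewrite le_eqVlt => /predU1P[<-|ab] cf cF dF.
  by rewrite set_itv1 Rintegral_set1 subrr.
have [_ cFa cFb] := (continuous_within_itvP F ab).1 cF.
rewrite /Rintegral (@continuous_FTC2 _ f F a b ab).
- by rewrite -EFinB.
- exact: continuous_subspaceT.
- by split=> // y; rewrite in_itv/= => /dF[].
- by move=> y; rewrite in_itv/= => /dF ?; rewrite derive1E derive_val.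
Qed.

Lemma derivable_nondecreasing (R : realType) (f df : R -> R) (a b : R) :
  (forall x : R, a <= x <= b -> is_derive x 1 f (df x)) ->
  (forall x, a < x < b -> 0 <= df x) -> a <= b -> f a <= f b.
Proof.
move=> dF pos ab.
apply: (@ger0_derive1_ndecr _ f a b) => //.
- by move=> x; rewrite in_itv/= => /andP[? ?]; have [] := dF x _; rewrite ?ltW.
- move=> x; rewrite in_itv/= => /andP[ax xb].
  have dx : is_derive x 1 f (df x) by apply: dF; rewrite !ltW.
  by rewrite derive1E derive_val pos ?ax.
- by apply: derivable_within_continuous => x; rewrite in_itv/= => /dF[].
Qed.

Lemma ge0_min_at_0 (R : realType) (h dh : R -> R) (x : R) :
  (forall y : R, is_derive y 1 h (dh y)) ->
  (forall y, 0 <= y -> 0 <= dh y) -> (forall y, y <= 0 -> dh y <= 0) ->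
  h 0 <= h x.
Proof.
move=> hd pos neg; have [x0|x0] := leP 0 x.
  apply: (@derivable_nondecreasing _ h dh) => // y /andP[y0 _].
  by apply: pos; exact: ltW.
rewrite -lerN2.
apply: (@derivable_nondecreasing _ (fun y => - h y) (fun y => - dh y)) => //.
  by move=> y /andP[_ y0]; rewrite oppr_ge0 neg// ltW.
exact: ltW.
Qed.

Lemma is_derive_comp_addr (R : realType) (f df : R -> R) (h x : R) :
  is_derive (x + h) 1 f (df (x + h)) ->
  is_derive x 1 (fun y => f (y + h)) (df (x + h)).
Proof.
move=> fd; have H : is_derive x 1 (fun y : R => y + h) (1 + 0).
  exact: is_deriveD.
have := @is_derive1_comp _ f (fun y => y + h) x _ _ fd H.
by rewrite addr0 mulr1.
Qed.

(** Derivatives as limits of difference quotients along a sequence, so that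
    dominated convergence, a statement about sequences, applies to them. *)
Lemma diff_quot_cvg (R : realType) (f : R -> R) (x d : R) (h : nat -> R) :
  is_derive x 1 f d -> (forall n, h n != 0) -> h n @[n --> \oo] --> 0 ->
  (f (x + h n) - f x) / h n @[n --> \oo] --> d.
Proof.
move=> fd h0 hc.
have /cvg_ex[/= e E] : derivable f x 1 by [].
have ed : e = d.
  rewrite -(@derive_val _ _ _ _ _ _ _ fd); apply/esym/cvg_lim => //.
rewrite -ed; move/cvgr_dnbhsP : E => /(_ h (conj h0 hc)).
apply: cvg_trans; apply: near_eq_cvg; apply: nearW => n.
by rewrite scaler1 mulrC (addrC (h n)).
Qed.

(** * Lipschitz functions with slopes in an interval *)

(** This replaces the integration of the derivative: the integral over [a, b] of the
    difference quotients of step h is computed exactly from the antiderivative of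
    g and tends to g b - g a, while the negative parts of these quotients are
    bounded by the Lipschitz constant and tend to 0 almost everywhere. *)
Lemma lipschitz_ae_nondecreasing (R : realType) (g : R -> R) (M : R) :
  (forall x y, `|g x - g y| <= M * `|x - y|) ->
  {ae lebesgue_measure, forall x, derivable g x 1 /\ 0 <= derive1 g x} ->
  forall a b, a <= b -> g a <= g b.
Proof.
move=> gM gd a b ab.
have M0 : 0 <= M by have := gM 1 0; rewrite subr0 normr1 mulr1; exact/le_trans.
have gc : continuous g.
  move=> x; apply/cvgrPdist_le => e e0.
  near=> y; rewrite (le_trans (gM x y))//.
  rewrite (@le_trans _ _ ((M + 1) * `|x - y|))// ?ler_wpM2r ?lerDl//.
  rewrite mulrC -ler_pdivlMr ?ltr_wpDl//.
  near: y; apply: cvgr_dist_le; first exact: cvg_id.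
  by rewrite divr_gt0// ltr_wpDl.
pose h n : R := n.+1%:R^-1.
have h0 n : 0 < h n by rewrite invr_gt0.
have hc : h n @[n --> \oo] --> 0 by exact: cvg_harmonic.
pose Q n x := (g (x + h n) - g x) / h n.
have Qc n : continuous (Q n).
  move=> x; apply: cvgM; last exact: cvg_cst.
  apply: cvgB; last exact: gc.
  apply: (@cvg_comp _ _ _ (fun y => y + h n) g _ _ _ _ (gc _)).
  by apply: cvgD; [exact: cvg_id|exact: cvg_cst].
pose A := antiderivative g.
have dA (x : R) : is_derive x 1 A (g x) by exact: is_derive_antiderivative.
have IQ n : \int[lebesgue_measure]_(x in `[a, b]) Q n x =
    (A (b + h n) - A b) / h n - (A (a + h n) - A a) / h n.
  have dAQ (x : R) : is_derive x 1
      (fun x => (h n)^-1 *: (A (x + h n) - A x)) (Q n x).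
    rewrite /Q mulrC; apply: is_deriveZ; apply: is_deriveB.
    exact: is_derive_comp_addr.
  rewrite (@Rintegral_FTC2 _ (fun x => (h n)^-1 *: (A (x + h n) - A x)))//.
    by rewrite /GRing.scale/=; ring.
  exact/continuous_subspaceT/(is_derive_continuous dAQ).
have cI : \int[lebesgue_measure]_(x in `[a, b]) Q n x @[n --> \oo]
    --> g b - g a.
  rewrite (_ : (fun n => _) = (fun n => (A (b + h n) - A b) / h n
    - (A (a + h n) - A a) / h n)); last exact/funext.
  by apply: cvgB; apply: diff_quot_cvg => // n; rewrite gt_eqF.
(* Negative parts of the quotients: bounded by M, with limit 0 almost
   everywhere, and below the quotients. *)
pose N n x := Num.min (Q n x) 0.
have Nc n : continuous (N n).
  by move=> x; apply: continuous_min; [exact: Qc|exact: cvg_cst].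
have mQ n : measurable_fun `[a, b] (N n).
  by apply: measurable_funTS; exact: continuous_measurable_fun.
have cN : \int[lebesgue_measure]_(x in `[a, b]) N n x @[n --> \oo]
    --> \int[lebesgue_measure]_(x in `[a, b]) cst (0 : R) x.
  apply: (@Rintegral_dominated_cvg _ _ N (cst 0) (cst M)) => //.
  - apply: lebesgue_ae_mono gd => x [gx gx0] _.
    rewrite [X in _ --> X](_ : cst 0 x = Num.min (derive1 g x) 0); last first.
      by rewrite /= min_r.
    have dg : is_derive x 1 g (derive1 g x).
      by rewrite derive1E; exact: derivableP.
    have qc : Q n x @[n --> \oo] --> derive1 g x.
      by apply: diff_quot_cvg => // n; rewrite gt_eqF.
    apply: (@cvg_comp _ _ _ (fun n => Q n x) (fun y => Num.min y 0) _ _ _ qc).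
    by apply: (@continuous_min _ _ id (cst 0)); [exact: cvg_id|exact: cvg_cst].
  - by apply: continuous_integrable_itv => x; exact: cvg_cst.
  - move=> n x _ /=.
    have : `|Q n x| <= M.
      rewrite /Q normrM normfV (gtr0_norm (h0 n)) ler_pdivrMr//.
      rewrite (le_trans (gM _ _))// addrC addKr gtr0_norm//.
    by rewrite /N; have [_|_] := leP (Q n x) 0; rewrite ?normr0.
rewrite -subr_ge0.
rewrite Rintegral_cst// mul0r in cN.
apply: (ler_cvg_to cN cI); apply: nearW => n.
apply: le_Rintegral => //.
- exact: continuous_integrable_itv.
- exact: continuous_integrable_itv.
- by move=> x _; rewrite /N ge_min lexx.
Unshelve. all: by end_near. Qed.

(** Apply the monotonicity criterion to g and to x |-> l x - g x. *)
Lemma X_l_bounds (R : realType) (l : R) (g : R -> R) : X_l l g ->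
  forall x y, x <= y -> 0 <= g y - g x <= l * (y - x).
Proof.
move=> [gl gd] x y xy.
have [M M0 gM] : exists2 M, 0 <= M & forall x y, `|g x - g y| <= M * `|x - y|.
  have [M [_ HM]] := gl.
  exists (Num.max M 0 + 1); first by rewrite addr_ge0// le_max lexx orbT.
  move=> a b.
  by apply: (HM (Num.max M 0 + 1) _ (a, b)) => //; rewrite ltr_pwDr// le_max lexx.
apply/andP; split.
  rewrite subr_ge0; apply: (lipschitz_ae_nondecreasing gM) xy.
  by apply: lebesgue_ae_mono gd => z [? /andP[]].
pose f z := l * z - g z.
suff: f x <= f y by rewrite /f; lra.
apply: (@lipschitz_ae_nondecreasing _ _ (`|l| + M)) => //.
  move=> a b; rewrite (_ : f a - f b = l * (a - b) - (g a - g b)); last first.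
    by rewrite /f; ring.
  by rewrite (le_trans (ler_normB _ _))// normrM mulrDl lerD2l.
apply: lebesgue_ae_mono gd => z [dz /andP[z0 zl]].
have dg : is_derive z 1 g (derive1 g z) by rewrite derive1E; exact: derivableP.
have dfz : is_derive z 1 f (l - derive1 g z).
  apply: is_deriveB; rewrite -[X in is_derive _ _ _ X]mulr1.
  exact: is_deriveZ.
split; first exact: ex_derive.
by rewrite derive1E derive_val subr_ge0.
Qed.

Lemma X_l_continuous (R : realType) (l : R) (g : R -> R) :
  X_l l g -> continuous g.
Proof.
move=> /X_l_bounds Hg x; apply/cvgrPdist_le => e e0.
have l0 : 0 <= l.
  by have := Hg 0 1 ler01; rewrite subr0 mulr1 => /andP[h1 h2]; exact: le_trans h2.
near=> y.
have xy : `|x - y| <= e / (l + 1).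
  near: y; apply: cvgr_dist_le; first exact: cvg_id.
  by rewrite divr_gt0// ltr_wpDl.
have h : `|g x - g y| <= l * `|x - y|.
  have [yx|xy'] := leP y x.
    by have /andP[h1 h2] := Hg _ _ yx; rewrite !ger0_norm// subr_ge0.
  have /andP[h1 h2] := Hg _ _ (ltW xy').
  by rewrite distrC (distrC x) !ger0_norm// subr_ge0 ltW.
rewrite (le_trans h)//; move: xy; rewrite ler_pdivlMr ?ltr_wpDl// mulrC mulrDl.
by apply: le_trans; rewrite lerDl mul1r.
Unshelve. all: by end_near. Qed.

(** * A maximum principle on a strip *)

(** One-sided, because a maximum over the strip may be attained at its initial
    time. *)
Lemma is_derive_right_max (R : realType) (f : R -> R) (t d r : R) :
  0 < r -> is_derive t 1 f d -> (forall s, t <= s < t + r -> f s <= f t) ->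
  d <= 0.
Proof.
move=> r0 fd fmax.
pose h n : R := r / n.+2%:R.
have h0 n : 0 < h n by rewrite divr_gt0.
have hc : h n @[n --> \oo] --> 0.
  rewrite -[X in _ --> X](mulr0 r); apply: cvgM; first exact: cvg_cst.
  by have := @cvg_harmonic R; rewrite -(cvg_shiftS (@harmonic R)); exact.
have hc' := @diff_quot_cvg _ f t d h fd (fun n => lt0r_neq0 (h0 n)) hc.
apply: (cvgr_to_le hc'); apply: nearW => n.
rewrite pmulr_lle0 ?invr_gt0// subr_le0; apply: fmax.
rewrite lerDl (ltW (h0 n))/= ltrD2l /h ltr_pdivrMr// ltr_pMr//.
by rewrite ltr1n.
Qed.

Lemma second_derivative_test (R : realType) (f df : R -> R) (x d r : R) :
  0 < r -> (forall y : R, x - r < y < x + r -> is_derive y 1 f (df y)) ->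
  is_derive x 1 df d -> (forall y, x - r < y < x + r -> f y <= f x) ->
  df x = 0 /\ d <= 0.
Proof.
move=> r0 fd dfd fmax.
have xr : x - r < x < x + r by rewrite ltrDl r0 ltrBlDr ltrDl r0.
have df0 : df x = 0.
  have H : is_derive x 1 f 0.
    apply: (@derive1_at_max _ f (x - r) (x + r)).
    - by rewrite ltW// (lt_trans (y := x))//; case/andP: xr.
    - by move=> y; rewrite in_itv/= => /fd[].
    - by rewrite in_itv.
    - by move=> y; rewrite in_itv/= => /fmax.
  have D := fd x xr.
  by rewrite -(@derive_val _ _ _ _ _ _ _ D) (@derive_val _ _ _ _ _ _ _ H).
split=> //; rewrite leNgt; apply/negP => d0.
(* If d > 0, df is positive just to the right of x, and f increases there. *)
have [e e0 He] : exists2 e, 0 < e & forall y, x < y < x + e -> 0 < df y.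
  have /cvg_ex[/= q Q] : derivable df x 1 by [].
  have qd : q = d.
    by rewrite -(@derive_val _ _ _ _ _ _ _ dfd); apply/esym/cvg_lim.
  have := cvgr_gt q Q 0; rewrite qd => /(_ _ d0)[/= e e0 He].
  exists e => // y /andP[xy yx].
  have := He (y - x); rewrite /= sub0r normrN gtr0_norm ?subr_gt0//.
  rewrite ltrBlDr (addrC e) yx gt_eqF ?subr_gt0// => /(_ isT isT).
  by rewrite scaler1 subrK df0 subr0 /GRing.scale/= pmulr_rgt0// invr_gt0 subr_gt0.
pose y := x + Num.min e r / 2.
have er0 : 0 < Num.min e r by rewrite lt_min e0.
have yx : x < y by rewrite ltrDl divr_gt0.
have yer : y < x + Num.min e r by rewrite ltrD2l ltr_pdivrMr// ltr_pMr// ltr1n.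
have ye : y < x + e by rewrite (lt_le_trans yer)// lerD2l ge_min lexx.
have yr : y < x + r by rewrite (lt_le_trans yer)// lerD2l ge_min lexx orbT.
have fd' z : z \in `[x, y] -> is_derive z 1 f (df z).
  rewrite in_itv/= => /andP[xz zy]; apply: fd.
  by rewrite (le_lt_trans zy yr) (lt_le_trans _ xz)// ltrBlDr ltrDl r0.
have cf : {within `[x, y], continuous f}.
  by apply: derivable_within_continuous => z /fd'[].
have fd'' z : z \in `]x, y[ -> is_derive z 1 f (df z).
  by move=> zi; apply: fd'; exact: subset_itv_oo_cc.
have [c] := @MVT _ f df x y yx fd'' cf.
rewrite in_itv/= => /andP[xc cy] E.
have := fmax y; rewrite yr (lt_trans _ yx) ?ltrBlDr ?ltrDl// => /(_ isT).
rewrite -subr_le0 E leNgt mulr_gt0// ?subr_gt0// He// xc/=.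
exact: lt_trans ye.
Qed.

(** Continuity on the closed strip [T0, T1] x R, phrased with sequences, the form
    in which dominated convergence yields it. *)
Definition strip_continuous {R : realType} (T0 T1 : R) (F : R -> R -> R) :=
  forall (tn xn : nat -> R) (t x : R), (forall n, T0 <= tn n <= T1) ->
    T0 <= t <= T1 -> tn n @[n --> \oo] --> t -> xn n @[n --> \oo] --> x ->
    F (tn n) (xn n) @[n --> \oo] --> F t x.

Lemma within_strip_continuous (R : realType) (T0 T1 : R) (F : R -> R -> R) :
  {within `[T0, T1] `*` [set: R], continuous (fun p : R * R => F p.1 p.2)} ->
  strip_continuous T0 T1 F.
Proof.
move=> /subspace_continuousP cF tn xn t x tnT tT tnt xnx.
have S p : T0 <= p.1 <= T1 -> (`[T0, T1] `*` [set: R]) p.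
  by move=> h; split=> //=; rewrite in_itv.
apply: (@cvg_comp _ _ _ (fun n => (tn n, xn n))
  (fun p : R * R => F p.1 p.2) \oo _ _ _ (cF (t, x) (S (t, x) tT))).
have H : (tn n, xn n) @[n --> \oo] --> (t, x).
    exact: (cvg_pair tnt xnx).
move=> U /H [N _ HN]; exists N => // n Nn; apply: (HN n Nn).
exact: (S (tn n, xn n) (tnT n)).
Qed.

Lemma strip_continuous_within (R : realType) (T0 T1 r : R) (F : R -> R -> R) :
  strip_continuous T0 T1 F ->
  {within `[T0, T1] `*` `[- r, r], continuous (fun p : R * R => F p.1 p.2)}.
Proof.
move=> cF; apply/subspace_continuousP => -[t x] [/= tT _].
apply/cvgrPdist_lt => e e0.
apply: contrapT => nH.
(* Otherwise some sequence in the strip violates the sequential definition. *)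
have H n : exists u : R * R, [/\ T0 <= u.1 <= T1,
    `|t - u.1| < n.+1%:R^-1, `|x - u.2| < n.+1%:R^-1 &
    e <= `|F t x - F u.1 u.2|].
  apply: contrapT => nex; apply: nH.
  have n0 : 0 < n.+1%:R^-1 :> R by rewrite invr_gt0.
  exists (ball t n.+1%:R^-1, ball x n.+1%:R^-1) => /=.
    by split; exact: nbhsx_ballx.
  move=> [s y] [/= ts xy] [/= sT _]; rewrite ltNge; apply/negP => eF.
  by apply: nex; exists (s, y); move: sT; rewrite /= in_itv.
have {H}[u Hu] := choice H.
have hc : (n.+1%:R^-1 : R) @[n --> \oo] --> 0 by exact: cvg_harmonic.
have cvg_of (w : nat -> R) y : (forall n, `|y - w n| < n.+1%:R^-1) ->
    w n @[n --> \oo] --> y.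
  move=> wy; apply/cvgrPdist_lt => d d0.
  move/cvgr0_norm_lt : hc => /(_ _ d0); apply: filterS => n.
  by rewrite gtr0_norm ?invr_gt0//; exact: lt_trans.
have c1 : (u n).1 @[n --> \oo] --> t.
  by apply: cvg_of => n; have [] := Hu n.
have c2 : (u n).2 @[n --> \oo] --> x.
  by apply: cvg_of => n; have [] := Hu n.
have uT n : T0 <= (u n).1 <= T1 by have [] := Hu n.
have tT' : T0 <= t <= T1 by move: tT; rewrite /= in_itv.
have := cF _ _ _ _ uT tT' c1 c2.
move=> /cvgrPdist_lt /(_ _ e0) [N _ /(_ N (leqnn N))] /=.
by rewrite ltNge; have [_ _ _ ->] := Hu N.
Qed.

Lemma strip_continuous_bounded (R : realType) (T0 T1 r : R) (F : R -> R -> R) :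
  strip_continuous T0 T1 F ->
  exists2 C, 0 <= C & forall t x, T0 <= t <= T1 -> `|x| <= r -> `|F t x| <= C.
Proof.
move=> cF; pose K : set (R * R) := `[T0, T1] `*` `[- r, r].
have cK : compact K by apply: compact_setX; exact: segment_compact.
have KP s y : T0 <= s <= T1 -> `|y| <= r -> K (s, y).
  by move=> ? ?; split; rewrite /= in_itv//= -ler_norml.
have := continuous_compact (strip_continuous_within (r := r) cF) cK.
move=> /compact_bounded[C [_ HC]].
exists (Num.max C 0 + 1); first by rewrite addr_ge0// le_max lexx orbT.
move=> t x tT xr; apply: (HC (Num.max C 0 + 1)).
  by rewrite ltr_pwDr// le_max lexx.
by exists (t, x) => //; exact: KP.
Qed.

(** At a positive maximum, which is neither at the final time nor on the lateral
    boundary, the space derivative vanishes, the second one is nonpositive and the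
    time derivative is nonpositive; the last hypothesis excludes this. *)
Lemma strict_maximum_principle (R : realType) (T0 T1 r : R)
    (Phi : R -> R -> R) :
  T0 <= T1 -> 0 < r ->
  strip_continuous T0 T1 Phi ->
  (forall x, Phi T1 x <= 0) ->
  (forall t x, T0 <= t <= T1 -> `|x| = r -> Phi t x <= 0) ->
  (forall t x : R, T0 <= t < T1 -> exists (px : R -> R) (pxx pt : R),
    [/\ forall y : R, is_derive y 1 (Phi t) (px y), is_derive x 1 px pxx,
        is_derive t 1 (Phi ^~ x) pt & px x = 0 -> pxx <= 0 -> 0 < pt]) ->
  forall t x, T0 <= t <= T1 -> `|x| <= r -> Phi t x <= 0.
Proof.
move=> T01 r0 cPhi PhiT Phir PhiL t x tT xr.
pose K : set (R * R) := `[T0, T1] `*` `[- r, r].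
have cK : compact K by apply: compact_setX; exact: segment_compact.
have KP s y : K (s, y) <-> T0 <= s <= T1 /\ `|y| <= r.
  by rewrite /K/= !in_itv/= ler_norml.
have cf := strip_continuous_within (r := r) cPhi.
have K0 : K !=set0 by exists (t, x); apply/KP.
have [[s y]] := compact_EVT_max K0 cK cf.
rewrite inE => /KP[sT yr] /= sy_max.
have maxP s' y' : T0 <= s' <= T1 -> `|y'| <= r -> Phi s' y' <= Phi s y.
  by move=> ? ?; apply: (sy_max (s', y')); rewrite inE; apply/KP.
apply: le_trans (maxP t x tT xr) _; rewrite leNgt; apply/negP => Phi0.
have yr' : `|y| < r.
  by rewrite lt_neqAle yr andbT; apply/eqP => yr'; move: Phi0; rewrite ltNge Phir.
have sT1 : s < T1.
  case/andP: sT => _; rewrite le_eqVlt => /predU1P[sT|//].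
  by move: Phi0; rewrite sT ltNge PhiT.
have T0s : T0 <= s by case/andP: sT.
have [|px [pxx [pt [dpx dpxx dpt pos]]]] := PhiL s y; first by rewrite T0s.
have d0 : 0 < r - `|y| by rewrite subr_gt0.
have [px0 pxx0] : px y = 0 /\ pxx <= 0.
  apply: (@second_derivative_test _ (Phi s) px y pxx (r - `|y|)) => // z zy.
  apply: maxP => //; rewrite -[z](subrK y).
  apply: le_trans (ler_normD _ _) _; rewrite -lerBrDr ltW// ltr_norml.
  lra.
have := pos px0 pxx0; rewrite ltNge => /negP; apply.
apply: (@is_derive_right_max _ (Phi ^~ y) s pt (T1 - s)) => //.
  by rewrite subr_gt0.
move=> s'; rewrite subrKC => /andP[ss' s'T]; apply: maxP => //.
by rewrite (le_trans T0s ss') ltW.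
Qed.

(** * Integrals dominated by a Gaussian *)

(** Young's inequality; half of the quadratic decay absorbs the linear term. *)
Lemma gauss_dom_le (R : realType) (A B c x : R) : 0 < c ->
  A + B * `|x| - c * x ^+ 2 <= A + B ^+ 2 / (2 * c) - c / 2 * x ^+ 2.
Proof.
move=> c0; rewrite -subr_ge0.
rewrite (_ : _ - _ = c / 2 * (`|x| - B / c) ^+ 2).
  by rewrite mulr_ge0 ?sqr_ge0// divr_ge0// ltW.
rewrite -[in LHS](real_normK (num_real x)); field.
by rewrite gt_eqF.
Qed.

Lemma continuous_gauss_dom (R : realType) (A B c : R) :
  continuous (fun x : R => expR (A + B * `|x| - c * x ^+ 2)).
Proof. by move=> x; take_limit. Qed.

(** The exponential of a linear function of |x| minus a positive multiple of
    x^2 is the dominating function for the integrals over the line. *)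
Lemma integrable_gauss_dom (R : realType) (A B c : R) : 0 < c ->
  lebesgue_measure.-integrable setT
    (EFin \o (fun x : R => expR (A + B * `|x| - c * x ^+ 2))).
Proof.
move=> c0.
pose s := Num.sqrt c^-1.
have s2 : s ^+ 2 = c^-1 by rewrite sqr_sqrtr// invr_ge0 ltW.
have s0 : s != 0 by rewrite sqrtr_eq0 -ltNge invr_gt0.
have I := integrableZl measurableT
  (expR (A + B ^+ 2 / (2 * c)) / normal_peak s) (integrable_normal_pdf 0 s).
apply: (le_integrable measurableT _ _ I).
  apply/measurable_EFinP; apply: continuous_measurable_fun.
  exact: continuous_gauss_dom.
move=> x _; rewrite -EFinM !abse_EFin lee_fin [leLHS]ger0_norm ?expR_ge0//.
rewrite [leRHS]ger0_norm; last first.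
  by rewrite mulr_ge0 ?normal_pdf_ge0// divr_ge0 ?expR_ge0 ?normal_peak_ge0.
rewrite normal_pdfE//=.
rewrite [leRHS]mulrA divfK ?gt_eqF ?normal_peak_gt0//.
rewrite /normal_fun -expRD ler_expR (le_trans (gauss_dom_le _ _ _ c0))//.
rewrite lerD2l subr0 s2 mulNr lerN2 -mulr_natr invfM invrK.
by rewrite le_eqVlt; apply/orP; left; apply/eqP; ring.
Qed.

Lemma integrable_le_gauss (R : realType) (f : R -> R) (A B c : R) : 0 < c ->
  continuous f -> (forall x, `|f x| <= expR (A + B * `|x| - c * x ^+ 2)) ->
  lebesgue_measure.-integrable setT (EFin \o f).
Proof.
move=> c0 cf fle.
apply: (le_integrable measurableT _ _ (integrable_gauss_dom A B c0)).
  by apply/measurable_EFinP; exact: continuous_measurable_fun.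
by move=> x _; rewrite !lee_fin (ger0_norm (expR_ge0 _)).
Qed.

Lemma gauss_dominated_cvg (R : realType) (F : nat -> R -> R) (f : R -> R)
    (A B c : R) : 0 < c ->
  (forall n, continuous (F n)) -> continuous f ->
  (forall x, F n x @[n --> \oo] --> f x) ->
  (forall n x, `|F n x| <= expR (A + B * `|x| - c * x ^+ 2)) ->
  \int[lebesgue_measure]_x F n x @[n --> \oo] --> \int[lebesgue_measure]_x f x.
Proof.
move=> c0 cF cf Ff Fle.
apply: (Rintegral_dominated_cvg _ _ _ _ (integrable_gauss_dom A B c0)) => //.
- by move=> n; exact: continuous_measurable_fun.
- exact: continuous_measurable_fun.
- by apply: aeW => x _.
Qed.

(** Differentiation under the integral sign, with a common Gaussian bound for the
    integrand and its derivative. *)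
Lemma is_derive_gauss_Rintegral (R : realType) (F dF : R -> R -> R)
    (u v a A B c : R) : 0 < c -> u < a < v ->
  (forall p x : R, u < p < v -> is_derive p 1 (F ^~ x) (dF p x)) ->
  (forall p, u < p < v -> continuous (F p)) ->
  (forall p x, u < p < v -> `|F p x| <= expR (A + B * `|x| - c * x ^+ 2)) ->
  (forall p x, u < p < v -> `|dF p x| <= expR (A + B * `|x| - c * x ^+ 2)) ->
  is_derive a 1 (fun p => \int[lebesgue_measure]_x F p x)
    (\int[lebesgue_measure]_x dF a x).
Proof.
move=> c0 auv dFE cF Fle dFle.
have E p x : u < p < v -> partial1of2 F p x = dF p x.
  move=> puv; have H := dFE p x puv; rewrite partial1of2E.
  exact: (@derive_val _ _ _ _ _ _ _ H).
have Ia : [set` `]u, v[] a by rewrite /= in_itv.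
have iF p : [set` `]u, v[] p ->
    lebesgue_measure.-integrable setT (EFin \o F p).
  rewrite /= in_itv/= => puv; apply: (integrable_le_gauss c0 (cF _ puv)).
  by move=> x; exact: Fle.
have dF1 p x : [set` `]u, v[] p -> setT x -> derivable (F ^~ x) p 1.
  by rewrite /= in_itv/= => puv _; have [] := dFE p x puv.
have G0 (y : R) : 0 <= expR (A + B * `|y| - c * y ^+ 2) by exact: expR_ge0.
have ub p y : [set` `]u, v[] p -> setT y ->
    `|partial1of2 F p y| <= expR (A + B * `|y| - c * y ^+ 2).
  by rewrite /= in_itv/= => puv _; rewrite E//; exact: dFle.
have iG := integrable_gauss_dom A B c0.
have D := derivable_under_integral measurableT Ia iF dF1 G0 iG ub.
have V := differentiation_under_integral measurableT Ia iF dF1 G0 iG ub.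
apply: DeriveDef; first exact: D.
rewrite -derive1E V; apply: eq_Rintegral => y _; exact: E.
Qed.

Lemma ge0_integral_affine (R : realType) (h : R -> R) (a b : R) : 0 < a ->
  continuous h -> (forall x, 0 <= h x) ->
  (\int[lebesgue_measure]_x (h (b + a * x) * a)%:E =
   \int[lebesgue_measure]_x (h x)%:E)%E.
Proof.
move=> a0 ch h0.
pose F (x : R) : R := x * a + b.
have dF (x : R) : is_derive x 1 F a by differentiate; ring.
have dFE : F^`()%classic = cst a.
  by apply/funext => x; rewrite derive1E; have ? := dF x; exact: derive_val.
rewrite (@increasing_ge0_integration_by_substitutionT _ F h)//.
- apply: eq_integral => x _; rewrite dFE.
  have -> : ((h \o F) * cst a) x = h (F x) * a by [].
  by rewrite /F addrC (mulrC x).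
- by move=> x y xy; rewrite /F ltrD2r ltr_pM2r.
- by rewrite dFE => x; exact: cvg_cst.
- by rewrite dFE; exact: is_cvg_cst.
- by rewrite dFE; exact: is_cvg_cst.
- apply: (@cvg_comp _ _ _ (fun x : R => x * a) (fun y => y + b)).
    exact: (gt0_cvgMlNy a0 cvg_id).
  exact: cvg_addrr_Ny.
- apply: (@cvg_comp _ _ _ (fun x : R => x * a) (fun y => y + b)).
    exact: (gt0_cvgMly a0 cvg_id).
  exact: cvg_addrr.
Qed.

Lemma Rintegral_affine (R : realType) (h : R -> R) (a b : R) : 0 < a ->
  continuous h -> (forall x, 0 <= h x) ->
  \int[lebesgue_measure]_x (h (b + a * x) * a) = \int[lebesgue_measure]_x h x.
Proof. by move=> *; rewrite /Rintegral ge0_integral_affine. Qed.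

(** * The heat semigroup *)

(** The Gaussian average of f at z with variance v, written as the expectation of
    f (z + sqrt v Y) for a standard normal Y. This form is continuous up to v = 0,
    where it returns f z; the kernel form [heatE] needs v > 0. *)
Definition heat {R : realType} (f : R -> R) (v z : R) : R :=
  \int[lebesgue_measure]_y (f (z + Num.sqrt v * y) * normal_pdf 0 1 y).

(** The factor v^(-1/2) is written as exp (- ln v / 2), so that the kernel is a
    single exponential, easy to differentiate in v and to bound. *)
Definition heat_kernel {R : realType} (v z x : R) : R :=
  normal_peak 1 * expR (- (x - z) ^+ 2 / (2 * v) - ln v / 2).

Lemma std_normal_pdfE (R : realType) (y : R) :
  normal_pdf 0 1 y = normal_peak 1 * expR (- (y ^+ 2 / 2)).
Proof.
by rewrite normal_pdfE ?oner_eq0//= /normal_fun subr0 expr1n mulNr.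
Qed.

Lemma std_normal_peak_gt0 (R : realType) : 0 < normal_peak (1 : R).
Proof. by rewrite normal_peak_gt0// oner_eq0. Qed.

Lemma continuous_affine_comp (R : realType) (f : R -> R) (a b : R) :
  continuous f -> continuous (fun y => f (b + a * y)).
Proof.
move=> cf y.
have h : b + a * x @[x --> y] --> b + a * y by take_limit.
exact: (cvg_comp _ _ h (cf _)).
Qed.

Lemma heat_integrand_continuous (R : realType) (f : R -> R) (v z : R) :
  continuous f ->
  continuous (fun y => f (z + Num.sqrt v * y) * normal_pdf 0 1 y).
Proof.
move=> cf y; apply: cvgM; first exact: continuous_affine_comp.
by apply: continuous_normal_pdf; rewrite oner_eq0.
Qed.

(** The normal density contributes - y^2 / 2 to the exponent; the condition
    c v <= 1 / 4 leaves - y^2 / 4 of it, enough to absorb the growth of f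
    with constants uniform in v and z. *)
Lemma heat_integrand_le (R : realType) (f : R -> R) (A c S Z v z : R) :
  0 <= A -> 0 <= c -> (forall x, `|f x| <= expR (A * `|x| + c * x ^+ 2)) ->
  0 <= v -> Num.sqrt v <= S -> c * v <= 1 / 4 -> `|z| <= Z ->
  forall y, `|f (z + Num.sqrt v * y) * normal_pdf 0 1 y| <=
    expR ((A * Z + c * Z ^+ 2 + ln (normal_peak 1))
          + (A * S + 2 * c * Z * S) * `|y| - 1 / 4 * y ^+ 2).
Proof.
move=> A0 c0 fle v0 vS cv zZ y.
rewrite normrM (ger0_norm (normal_pdf_ge0 _ _ _)) std_normal_pdfE.
rewrite -[X in X * expR (- _)]lnK ?posrE ?std_normal_peak_gt0// -expRD.
apply: (@le_trans _ _ (expR (A * `|z + Num.sqrt v * y|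
  + c * (z + Num.sqrt v * y) ^+ 2)
  * expR (ln (normal_peak 1) - y ^+ 2 / 2))).
  by rewrite ler_wpM2r ?expR_ge0.
rewrite -expRD ler_expR.
have Z0 : 0 <= Z by exact: le_trans zZ.
have y0 : 0 <= `|y| by [].
have sv0 : 0 <= Num.sqrt v by exact: sqrtr_ge0.
have svE : Num.sqrt v ^+ 2 = v by exact: sqr_sqrtr.
have S0 : 0 <= S by exact: le_trans vS.
have svy : Num.sqrt v * `|y| <= S * `|y| by rewrite ler_wpM2r.
have H1 : `|z + Num.sqrt v * y| <= Z + S * `|y|.
  by rewrite (le_trans (ler_normD _ _))// lerD// normrM ger0_norm.
have H2 : (z + Num.sqrt v * y) ^+ 2 <= Z ^+ 2 + 2 * Z * S * `|y| + v * y ^+ 2.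
  rewrite sqrrD lerD ?exprMn ?svE// lerD//.
    by rewrite -real_normK ?num_real// lerXn2r ?nnegrE.
  rewrite -mulr_natl (le_trans (ler_norm _))// !normrM (ger0_norm sv0).
  rewrite -!mulrA normr_nat ler_wpM2l// ler_pM// mulr_ge0//.
have H3 : c * v * y ^+ 2 <= 1 / 4 * y ^+ 2 by rewrite ler_wpM2r ?sqr_ge0.
have H4 := ler_wpM2l A0 H1.
have H5 := ler_wpM2l c0 H2.
lra.
Qed.

Lemma heat_integrable (R : realType) (f : R -> R) (A c v z : R) :
  0 <= A -> 0 <= c -> continuous f ->
  (forall x, `|f x| <= expR (A * `|x| + c * x ^+ 2)) ->
  0 <= v -> c * v <= 1 / 4 ->
  lebesgue_measure.-integrable setT
    (EFin \o (fun y => f (z + Num.sqrt v * y) * normal_pdf 0 1 y)).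
Proof.
move=> A0 c0 cf fle v0 cv.
have H := heat_integrand_le A0 c0 fle v0 (lexx _) cv (lexx `|z|).
have q0 : 0 < 1 / 4 :> R by lra.
apply: (@integrable_le_gauss _ _ _ _ _ q0 _ H).
exact: heat_integrand_continuous.
Qed.

(** The data, the variance and the point may all vary: this one statement gives
    continuity of the heat integral in (t, xi) up to the terminal time and the
    continuity of G in g. *)
Lemma heat_cvg (R : realType) (fn : nat -> R -> R) (f : R -> R)
    (vn zn : nat -> R) (v z A c S Z : R) :
  0 <= A -> 0 <= c -> (forall n, continuous (fn n)) -> continuous f ->
  (forall n x, `|fn n x| <= expR (A * `|x| + c * x ^+ 2)) ->
  (forall n, 0 <= vn n) -> (forall n, Num.sqrt (vn n) <= S) ->
  (forall n, c * vn n <= 1 / 4) -> (forall n, `|zn n| <= Z) ->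
  (forall y, fn n (zn n + Num.sqrt (vn n) * y) @[n --> \oo] -->
    f (z + Num.sqrt v * y)) ->
  heat (fn n) (vn n) (zn n) @[n --> \oo] --> heat f v z.
Proof.
move=> A0 c0 cfn cf fle v0 vS cv zZ ff.
have q0 : 0 < 1 / 4 :> R by lra.
apply: (gauss_dominated_cvg q0 _ _ _
  (fun n => heat_integrand_le A0 c0 (fle n) (v0 n) (vS n) (cv n) (zZ n))).
- by move=> n; exact: heat_integrand_continuous.
- exact: heat_integrand_continuous.
- by move=> y; apply: cvgM => //; exact: cvg_cst.
Qed.

Lemma sqrt_expR_ln (R : realType) (v : R) : 0 < v ->
  Num.sqrt v = expR (ln v / 2).
Proof.
move=> v0; apply/eqP; rewrite -(@eqrXn2 _ 2)// ?sqrtr_ge0 ?expR_ge0//.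
rewrite sqr_sqrtr ?ltW// -expRM_natl -[X in X == _](lnK v0).
by apply/eqP; congr expR; field.
Qed.

Lemma heat_kernel_continuous (R : realType) (v z : R) :
  continuous (heat_kernel v z).
Proof. by move=> x; rewrite /heat_kernel; take_limit. Qed.

Lemma heat_kernel_ge0 (R : realType) (v z x : R) : 0 <= heat_kernel v z x.
Proof. by rewrite mulr_ge0 ?expR_ge0// ltW// std_normal_peak_gt0. Qed.

Lemma heatE (R : realType) (f : R -> R) (v z : R) : 0 < v ->
  continuous f -> (forall x, 0 <= f x) ->
  heat f v z = \int[lebesgue_measure]_x (f x * heat_kernel v z x).
Proof.
move=> v0 cf f0; have sv0 : 0 < Num.sqrt v by rewrite sqrtr_gt0.
rewrite -(@Rintegral_affine _ (fun x => f x * heat_kernel v z x) _ z sv0).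
- apply: eq_Rintegral => y _; rewrite -mulrA; congr (_ * _).
  transitivity (normal_peak 1 *
      expR (- (Num.sqrt v * y) ^+ 2 / (2 * v) - ln v / 2) * expR (ln v / 2)).
    rewrite std_normal_pdfE -mulrA -expRD; congr (_ * expR _).
    rewrite exprMn sqr_sqrtr ?ltW//; field.
    by rewrite gt_eqF.
  by rewrite -sqrt_expR_ln// /heat_kernel (addrC z) addrK.
- by move=> x; apply: cvgM; [exact: cf|exact: heat_kernel_continuous].
- by move=> x; rewrite mulr_ge0// heat_kernel_ge0.
Qed.

(** Domination of f times the kernel and a weight q, locally uniformly in (v, z).
    The weights q are the polynomial factors produced by differentiating the kernel. *)
Lemma heat_kernel_dom (R : realType) (f : R -> R) (A c v1 v2 Z k q v z x : R) :
  0 <= A -> (forall x, `|f x| <= expR (A * `|x| + c * x ^+ 2)) ->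
  0 < v1 -> v1 < v < v2 -> `|z| <= Z -> `|q| <= expR (k + `|x|) ->
  `|f x * (q * heat_kernel v z x)| <=
  expR ((k + ln (normal_peak 1) - ln v1 / 2)
        + (1 + A + Z / v2) * `|x| - (1 / (2 * v2) - c) * x ^+ 2).
Proof.
move=> A0 fle v10 /andP[v1v vv2] zZ qk.
have v0 : 0 < v by exact: lt_trans v1v.
have v20 : 0 < v2 by exact: lt_trans vv2.
rewrite !normrM (ger0_norm (expR_ge0 _)) (gtr0_norm (std_normal_peak_gt0 _)).
rewrite -[X in _ * (_ * (X * _))]lnK ?posrE ?std_normal_peak_gt0//.
apply: (@le_trans _ _ (expR (A * `|x| + c * x ^+ 2) * (expR (k + `|x|)
  * (expR (ln (normal_peak 1)) * expR (- (x - z) ^+ 2 / (2 * v) - ln v / 2))))).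
  by rewrite ler_pM ?ler_pM ?mulr_ge0 ?expR_ge0.
rewrite -!expRD ler_expR.
have lv : ln v1 <= ln v by rewrite ler_ln ?posrE// ltW.
have H : x ^+ 2 - 2 * Z * `|x| <= (x - z) ^+ 2.
  have H1 : x * z <= `|x| * Z.
    by rewrite (le_trans (ler_norm _))// normrM ler_wpM2l.
  have := sqr_ge0 z; nra.
have H2 : (x - z) ^+ 2 / (2 * v2) <= (x - z) ^+ 2 / (2 * v).
  rewrite ler_wpM2l ?sqr_ge0// lef_pV2 ?posrE ?mulr_gt0//.
  by rewrite ler_pM2l// ltW.
have H3 : (x ^+ 2 - 2 * Z * `|x|) / (2 * v2) <= (x - z) ^+ 2 / (2 * v2).
  by rewrite ler_wpM2r// invr_ge0 mulr_ge0// ltW.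
have E : (x ^+ 2 - 2 * Z * `|x|) / (2 * v2)
    = 1 / (2 * v2) * x ^+ 2 - Z / v2 * `|x| by field; rewrite gt_eqF.
rewrite mulNr; lra.
Qed.

(** The weights are, in order, those of the kernel itself, of its first and second
    derivatives in z and of its derivative in v. A polynomial in x is below a
    constant times exp |x|. *)
Lemma heat_weight_bounds (R : realType) (v1 v Z z x : R) :
  0 < v1 -> v1 < v -> `|z| <= Z ->
  let k := Z + ln (2 / v1 ^+ 2 + 1 / v1 + 1) in
  [/\ `|1 : R| <= expR (k + `|x|), `|(x - z) / v| <= expR (k + `|x|),
      `|(x - z) ^+ 2 / v ^+ 2 - 1 / v| <= expR (k + `|x|) &
      `|(x - z) ^+ 2 / (2 * v ^+ 2) - 1 / (2 * v)| <= expR (k + `|x|)].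
Proof.
move=> v10 v1v zZ k.
have v0 : 0 < v by exact: lt_trans v1v.
have Z0 : 0 <= Z by exact: le_trans zZ.
set w := `|x| + Z; have w0 : 0 <= w by rewrite addr_ge0.
have iv : v^-1 <= v1^-1 by rewrite lef_pV2 ?posrE// ltW.
have iv0 : 0 < v^-1 by rewrite invr_gt0.
set i := v1^-1 in iv *.
have i0 : 0 < i by rewrite invr_gt0.
have b0 : 0 < 2 / v1 ^+ 2 + 1 / v1 + 1.
  by rewrite !addr_gt0// ?divr_gt0// exprn_gt0.
have kE : expR (k + `|x|) = (2 * i ^+ 2 + i + 1) * expR w.
  rewrite /k -addrA addrC -addrA expRD lnK ?posrE// /w /i exprVn div1r.
  by [].
have e1 : 1 <= expR w by rewrite -expR0 ler_expR.
have ew : w <= expR w by have := expR_ge1Dx w; lra.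
have ew2 : w ^+ 2 <= 2 * expR w.
  have := @expR_ge1Dxn _ w 1 w0; rewrite (_ : 2`! = 2%N)//; lra.
have xz : `|x - z| <= w by rewrite (le_trans (ler_normB _ _))// lerD2l.
have xz2 : (x - z) ^+ 2 <= w ^+ 2.
  by rewrite -real_normK ?num_real// lerXn2r ?nnegrE.
have x0 : 0 <= (x - z) ^+ 2 by exact: sqr_ge0.
have iv2 : v ^- 2 <= i ^+ 2.
  by rewrite -exprVn lerXn2r ?nnegrE ?(ltW i0)// ltW.
have iv20 : 0 <= v ^- 2 by rewrite invr_ge0 exprn_ge0// ltW.
have P : (x - z) ^+ 2 / v ^+ 2 <= 2 * i ^+ 2 * expR w.
  have := ler_wpM2r (sqr_ge0 i) ew2; have := ler_pM x0 iv20 xz2 iv2; lra.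
have P0 : 0 <= (x - z) ^+ 2 / v ^+ 2 by rewrite mulr_ge0.
have Q : 1 / v <= i * expR w by rewrite div1r; nra.
have Q0 : 0 < 1 / v by rewrite div1r.
have i2e : 0 <= 2 * i ^+ 2 * expR w.
  by apply: mulr_ge0; [apply: mulr_ge0 => //; exact: sqr_ge0|exact: expR_ge0].
have ie : 0 <= i * expR w by rewrite mulr_ge0 ?expR_ge0// ltW.
have {}kE : expR (k + `|x|) = 2 * i ^+ 2 * expR w + i * expR w + expR w.
  by rewrite kE; ring.
rewrite kE; split.
- by rewrite normr1; lra.
- rewrite normrM (gtr0_norm iv0).
  have : `|x - z| / v <= w * i by rewrite ler_pM// ltW.
  have : w * i <= i * expR w by rewrite mulrC ler_wpM2l// ltW.
  lra.
- by rewrite ler_norml; lra.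
- have -> : (x - z) ^+ 2 / (2 * v ^+ 2) - 1 / (2 * v) =
      ((x - z) ^+ 2 / v ^+ 2 - 1 / v) / 2 by field; rewrite gt_eqF.
  by rewrite ler_norml; lra.
Qed.

(** The first two space derivatives, by differentiation under the integral sign.
    The bound 2 c v < 1 makes f integrable against the kernel, with room to enlarge
    v to a slightly larger v2. *)
Lemma heat_derivatives (R : realType) (f : R -> R) (A c v z : R) :
  0 <= A -> continuous f ->
  (forall x, `|f x| <= expR (A * `|x| + c * x ^+ 2)) ->
  0 < v -> 2 * (c * v) < 1 ->
  let I0 v z := \int[lebesgue_measure]_x (f x * (1 * heat_kernel v z x)) in
  let I1 v z :=
    \int[lebesgue_measure]_x (f x * ((x - z) / v * heat_kernel v z x)) in
  let I2 v z := \int[lebesgue_measure]_x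
    (f x * (((x - z) ^+ 2 / v ^+ 2 - 1 / v) * heat_kernel v z x)) in
  is_derive z 1 (I0 v) (I1 v z) /\ is_derive z 1 (I1 v) (I2 v z).
Proof.
move=> A0 cf fle v0 cv I0 I1 I2.
have [v2 vv2 cv2] : exists2 v2, v < v2 & 0 < 1 / (2 * v2) - c.
  have [c0|c0] := leP c 0.
    exists (v + 1); first by lra.
    by rewrite subr_gt0 (le_lt_trans c0)// divr_gt0// mulr_gt0//; lra.
  (* The midpoint of v and of the critical variance 1 / (2 c). *)
  exists ((v + 1 / (2 * c)) / 2).
    rewrite ltr_pdivlMr//; suff : v < 1 / (2 * c) by lra.
    by rewrite ltr_pdivlMr ?mulr_gt0//; lra.
  have c20 : 0 < 2 * c by lra.
  rewrite subr_gt0 ltr_pdivlMr ?mulr_gt0 ?addr_gt0 ?divr_gt0//.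
  have -> : c * (2 * ((v + 1 / (2 * c)) / 2)) = c * v + 1 / 2.
    by field; rewrite gt_eqF.
  lra.
pose v1 := v / 2.
have v10 : 0 < v1 by rewrite divr_gt0.
have vv : v1 < v < v2 by rewrite vv2 andbT /v1; lra.
pose Z := `|z| + 1.
have zZ (p : R) : z - 1 < p < z + 1 -> `|p| <= Z.
  move=> /andP[h1 h2]; rewrite -[p](subrK z) (le_trans (ler_normD _ _))//.
  rewrite addrC lerD2l ler_norml; lra.
have zz : z - 1 < z < z + 1 by lra.
have v_neq0 p : v1 < p < v2 -> p != 0.
  by move=> /andP[h _]; rewrite gt_eqF// (lt_trans v10).
have p0 p : v1 < p < v2 -> 0 < p by move=> /andP[h _]; exact: lt_trans h.
have dkz (p x : R) : is_derive p 1 (fun p => heat_kernel v p x)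
    ((x - p) / v * heat_kernel v p x).
  by rewrite /heat_kernel; differentiate; field; rewrite gt_eqF.
have ck p q : continuous (heat_kernel p q) by exact: heat_kernel_continuous.
have v1p p : v1 < p < v2 -> v1 < p by case/andP.
have B p q x (vp : v1 < p < v2) (zp : `|q| <= Z) :=
  heat_weight_bounds x v10 (v1p p vp) zp.
split.
- apply: (@is_derive_gauss_Rintegral _
    (fun z x => f x * (1 * heat_kernel v z x))
    (fun z x => f x * ((x - z) / v * heat_kernel v z x))
    (z - 1) (z + 1) z _ _ _ cv2 zz).
  + by move=> p x _; have ? := dkz p x; differentiate; ring.
  + by move=> p _ x; apply: cvgM; [exact: cf|apply: cvgM; [exact: cvg_cst|exact: ck]].
  + move=> p x /zZ pZ; have [B0 _ _ _] := B v p x vv pZ.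
    exact: (heat_kernel_dom A0 fle v10 vv pZ B0).
  + move=> p x /zZ pZ; have [_ B0 _ _] := B v p x vv pZ.
    exact: (heat_kernel_dom A0 fle v10 vv pZ B0).
- apply: (@is_derive_gauss_Rintegral _
    (fun z x => f x * ((x - z) / v * heat_kernel v z x))
    (fun z x => f x * (((x - z) ^+ 2 / v ^+ 2 - 1 / v) * heat_kernel v z x))
    (z - 1) (z + 1) z _ _ _ cv2 zz).
  + move=> p x _; have ? := dkz p x; differentiate; field.
    by rewrite gt_eqF.
  + move=> p _ x; apply: cvgM; [exact: cf|apply: cvgM; [|exact: ck]].
    by take_limit.
  + move=> p x /zZ pZ; have [_ B0 _ _] := B v p x vv pZ.
    exact: (heat_kernel_dom A0 fle v10 vv pZ B0).
  + move=> p x /zZ pZ; have [_ _ B0 _] := B v p x vv pZ.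
    exact: (heat_kernel_dom A0 fle v10 vv pZ B0).
Qed.

(** Derivative of the heat integral along a differentiable curve (v, w). Working
    along a curve replaces joint differentiability in (v, z): the curve is
    (sigma^2 (T - t), chi(t, xi)) at fixed xi. *)
Lemma heat_path_derivative (R : realType) (f v w dv dw : R -> R)
    (A c v1 v2 Z X u1 u2 a : R) :
  0 <= A -> continuous f ->
  (forall x, `|f x| <= expR (A * `|x| + c * x ^+ 2)) ->
  0 < v1 -> 2 * (c * v2) < 1 -> 0 < X -> u1 < a < u2 ->
  (forall p : R, u1 < p < u2 ->
    [/\ is_derive p 1 v (dv p), is_derive p 1 w (dw p), v1 < v p < v2 &
        [/\ `|w p| <= Z, `|dv p| <= X & `|dw p| <= X]]) ->
  is_derive a 1
    (fun p => \int[lebesgue_measure]_x (f x * (1 * heat_kernel (v p) (w p) x)))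
    (\int[lebesgue_measure]_x (f x *
      ((((x - w a) ^+ 2 / (2 * v a ^+ 2) - 1 / (2 * v a)) * dv a
        + (x - w a) / v a * dw a) * heat_kernel (v a) (w a) x))).
Proof.
move=> A0 cf fle v10 cv X0 au H.
have v20 : 0 < v2.
  by have [_ _ /andP[h1 h2] _] := H a au; exact: lt_trans (lt_trans h1 h2).
have cv2 : 0 < 1 / (2 * v2) - c.
  by rewrite subr_gt0 ltr_pdivlMr ?mulr_gt0//; lra.
have ck p q : continuous (heat_kernel p q) by exact: heat_kernel_continuous.
have k2X k x : expR (k + `|x|) * (2 * X) = expR (k + ln (2 * X) + `|x|).
  by rewrite -[X in _ * X = _]lnK ?posrE ?mulr_gt0// -expRD; congr expR; ring.
pose K := Z + ln (2 / v1 ^+ 2 + 1 / v1 + 1).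
apply: (@is_derive_gauss_Rintegral _
    (fun p x => f x * (1 * heat_kernel (v p) (w p) x))
    (fun p x => f x *
      ((((x - w p) ^+ 2 / (2 * v p ^+ 2) - 1 / (2 * v p)) * dv p
        + (x - w p) / v p * dw p) * heat_kernel (v p) (w p) x))
    u1 u2 a (Num.max K (K + ln (2 * X)) + ln (normal_peak 1) - ln v1 / 2)
    _ _ cv2 au).
- move=> p x pu; have [? ? /andP[h1 _] _] := H p pu.
  have vp : 0 < v p by exact: lt_trans h1.
  rewrite /heat_kernel; differentiate => //.
    by rewrite mulf_neq0// gt_eqF.
  by field; rewrite gt_eqF.
- move=> p _ x; apply: cvgM; [exact: cf|apply: cvgM; [exact: cvg_cst|exact: ck]].
- move=> p x pu; have [_ _ vp [wZ _ _]] := H p pu.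
  have [|B0 _ _ _] := @heat_weight_bounds _ v1 (v p) Z (w p) x v10 _ wZ.
    by case/andP: vp.
  apply: (heat_kernel_dom A0 fle v10 vp wZ); apply: (le_trans B0).
  by rewrite ler_expR lerD2r le_max lexx.
- move=> p x pu; have [_ _ vp [wZ dvX dwX]] := H p pu.
  have [|_ B1 _ B2] := @heat_weight_bounds _ v1 (v p) Z (w p) x v10 _ wZ.
    by case/andP: vp.
  apply: (heat_kernel_dom A0 fle v10 vp wZ).
  apply: (@le_trans _ _ (expR (K + `|x|) * (2 * X))); last first.
    by rewrite k2X ler_expR lerD2r le_max lexx orbT.
  have h1 := ler_pM (normr_ge0 _) (normr_ge0 _) B2 dvX.
  have h2 := ler_pM (normr_ge0 _) (normr_ge0 _) B1 dwX.
  by rewrite (le_trans (ler_normD _ _))// !(normrM _ (dv p), normrM _ (dw p)); lra.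
Qed.

(** Completes the square in y in the exponent of the average of exp (x^2 / (4 s))
    under the normal law of mean z and variance w^2 < 2 s. *)
Lemma heat_square_completion (R : realType) (s w z y : R) :
  s != 0 -> 2 * s - w ^+ 2 != 0 ->
  (z + w * y) ^+ 2 / (4 * s) - y ^+ 2 / 2 =
  z ^+ 2 / (2 * (2 * s - w ^+ 2)) +
  - (y - z * w / (2 * s - w ^+ 2)) ^+ 2 / (2 * (2 * s / (2 * s - w ^+ 2))).
Proof. by move=> s0 d0; field; rewrite s0 d0. Qed.

Lemma normal_peak_scale (R : realType) (b : R) : 0 < b ->
  b * normal_peak b = normal_peak 1.
Proof.
move=> b0; rewrite /normal_peak expr1n mul1r -mulrnAr sqrtrM ?sqr_ge0//.
by rewrite sqrtr_sqr gtr0_norm// invfM mulrA mulfV ?mul1r// gt_eqF.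
Qed.

Lemma normal_pdf_scale (R : realType) (b x : R) : 0 < b ->
  normal_pdf 0 b (b * x) * b = normal_pdf 0 1 x.
Proof.
move=> b0; rewrite (normal_pdfE _ (lt0r_neq0 b0))/= std_normal_pdfE.
rewrite mulrAC (mulrC _ b) normal_peak_scale//; congr (_ * expR _).
by rewrite subr0; field; rewrite gt_eqF.
Qed.

(** Data below C exp (x^2 / (4 s)) are averaged exactly: the Gaussian integral of
    the bound is C b exp (z^2 / (2 (2 s - v))) with b^2 = 2 s / (2 s - v) <= 2. *)
Lemma heat_growth (R : realType) (f : R -> R) (C s A c v z : R) :
  0 <= A -> 0 <= c -> continuous f ->
  (forall x, `|f x| <= expR (A * `|x| + c * x ^+ 2)) -> c * v <= 1 / 4 ->
  0 < s -> 0 <= v <= s -> 0 <= C ->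
  (forall x, f x <= C * expR (x ^+ 2 / (4 * s))) ->
  heat f v z <= 2 * C * expR (z ^+ 2 / (2 * (2 * s - v))).
Proof.
move=> A0 c0 cf fle cv s0 /andP[v0 vs] C0 fC.
have d0 : 0 < 2 * s - v by lra.
pose b := Num.sqrt (2 * s / (2 * s - v)).
have b2 : b ^+ 2 = 2 * s / (2 * s - v).
  by rewrite sqr_sqrtr// divr_ge0 ?ltW// mulr_gt0.
have b0 : 0 < b by rewrite sqrtr_gt0 divr_gt0// mulr_gt0.
have b_le2 : b <= 2.
  rewrite -(@ler_pXn2r _ 2) ?nnegrE ?(ltW b0)// b2 ler_pdivrMr//; lra.
pose m := z * Num.sqrt v / (2 * s - v).
set E := expR _.
have CE0 : 0 <= C * E * b.
  apply: mulr_ge0; last exact: ltW.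
  by apply: mulr_ge0 => //; exact: expR_ge0.
rewrite (@le_trans _ _ (C * E * b))//; last first.
  rewrite -[2 * C]mulrC -!mulrA ler_wpM2l// mulrC ler_wpM2r// ?expR_ge0//.
have -> : C * E * b =
    \int[lebesgue_measure]_y (C * E * b * normal_pdf m b y).
  rewrite RintegralZl//; last exact: integrable_normal_pdf.
  by rewrite /Rintegral integral_normal_pdf mulr1.
apply: le_Rintegral => //.
- exact: (heat_integrable _ A0 c0 cf fle v0 cv).
- have := integrableZl measurableT (C * E * b) (integrable_normal_pdf m b).
  by [].
move=> y _.
have peakb := normal_peak_scale b0.
rewrite (normal_pdfE _ (lt0r_neq0 b0))/= std_normal_pdfE.
rewrite [leRHS](_ : _ = normal_peak 1 * (C * (E * normal_fun m b y))); last first.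
  by rewrite -peakb; ring.
rewrite [leLHS]mulrCA ler_wpM2l ?(ltW (std_normal_peak_gt0 _))//.
rewrite (le_trans (ler_wpM2r (expR_ge0 _) (fC _)))// -mulrA ler_wpM2l//.
rewrite /E /normal_fun -!expRD ler_expR -(mulr_natl (b ^+ 2)) b2.
have := @heat_square_completion _ s (Num.sqrt v) z y.
by rewrite sqr_sqrtr// => -> //; rewrite gt_eqF.
Qed.

(** The derivative in v is half the second derivative in z: the kernel weight in v
    is half the second weight in z. Along a curve this gives the chain rule with
    the heat equation built in. *)
Lemma heat_solution (R : realType) (f v w dv dw : R -> R)
    (A c v1 v2 Z X u1 u2 a : R) :
  0 <= A -> continuous f -> (forall x, 0 <= f x) ->
  (forall x, `|f x| <= expR (A * `|x| + c * x ^+ 2)) ->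
  0 < v1 -> 2 * (c * v2) < 1 -> 0 < X -> u1 < a < u2 ->
  (forall p : R, u1 < p < u2 ->
    [/\ is_derive p 1 v (dv p), is_derive p 1 w (dw p), v1 < v p < v2 &
        [/\ `|w p| <= Z, `|dv p| <= X & `|dw p| <= X]]) ->
  exists (hz : R -> R) (hzz : R),
  [/\ forall z : R, is_derive z 1 (heat f (v a)) (hz z),
      is_derive (w a) 1 hz hzz &
      is_derive a 1 (fun p => heat f (v p) (w p))
        (hzz / 2 * dv a + hz (w a) * dw a)].
Proof.
move=> A0 cf f0 fle v10 cv X0 au H.
have D := heat_path_derivative A0 cf fle v10 cv X0 au H.
have [_ _ va_v [waZ _ _]] := H a au.
have /andP[v1a v2a] := va_v.
have va : 0 < v a by exact: lt_trans v1a.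
have v20 : 0 < v2 by exact: lt_trans v2a.
have cva : 2 * (c * v a) < 1.
  have [c0|c0] := leP c 0; first by nra.
  by apply: lt_trans cv; rewrite !ltr_pM2l.
have cv2 : 0 < 1 / (2 * v2) - c.
  by rewrite subr_gt0 ltr_pdivlMr ?mulr_gt0//; lra.
have heatEI p z : 0 < v p -> heat f (v p) z =
    \int[lebesgue_measure]_x (f x * (1 * heat_kernel (v p) z x)).
  by move=> vp; rewrite heatE//; apply: eq_Rintegral => x _; rewrite mul1r.
pose I1 v z :=
  \int[lebesgue_measure]_x (f x * ((x - z) / v * heat_kernel v z x)).
pose I2 v z := \int[lebesgue_measure]_x
  (f x * (((x - z) ^+ 2 / v ^+ 2 - 1 / v) * heat_kernel v z x)).
exists (I1 (v a)), (I2 (v a) (w a)); split.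
- move=> z; have [d _] := heat_derivatives z A0 cf fle va cva.
  have -> : heat f (v a) = fun z =>
      \int[lebesgue_measure]_x (f x * (1 * heat_kernel (v a) z x)).
    by apply/funext => y; exact: heatEI.
  exact: d.
- by have [_ d] := heat_derivatives (w a) A0 cf fle va cva; exact: d.
have DE : is_derive a 1 (fun p => heat f (v p) (w p))
    (\int[lebesgue_measure]_x (f x *
      ((((x - w a) ^+ 2 / (2 * v a ^+ 2) - 1 / (2 * v a)) * dv a
        + (x - w a) / v a * dw a) * heat_kernel (v a) (w a) x))).
  apply: near_eq_is_derive D.
  have : a \in `]u1, u2[ by rewrite in_itv.
  move/near_in_itvoo; apply: filterS => p.
  rewrite in_itv/= => /H[_ _ /andP[h _] _].
  by rewrite heatEI// (lt_trans v10).
apply: (is_derive_eq DE).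
have ck p q : continuous (heat_kernel p q) by exact: heat_kernel_continuous.
have [_ B1 B2 _] := heat_weight_bounds (w a) v10 v1a waZ.
have i1 : lebesgue_measure.-integrable setT (EFin \o
    (fun x => f x * ((x - w a) / v a * heat_kernel (v a) (w a) x))).
  have := fun x => let: And4 _ B1 _ _ := heat_weight_bounds x v10 v1a waZ in
    heat_kernel_dom A0 fle v10 va_v waZ B1.
  move/(integrable_le_gauss cv2); apply => x.
  by apply: cvgM; [exact: cf|apply: cvgM; [take_limit|exact: ck]].
have i2 : lebesgue_measure.-integrable setT (EFin \o
    (fun x => f x * (((x - w a) ^+ 2 / v a ^+ 2 - 1 / v a)
      * heat_kernel (v a) (w a) x))).
  have := fun x => let: And4 _ _ B2 _ := heat_weight_bounds x v10 v1a waZ in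
    heat_kernel_dom A0 fle v10 va_v waZ B2.
  move/(integrable_le_gauss cv2); apply => x.
  by apply: cvgM; [exact: cf|apply: cvgM; [take_limit|exact: ck]].
transitivity (dv a / 2 * I2 (v a) (w a) + dw a * I1 (v a) (w a)); last by ring.
rewrite /I1 /I2 -RintegralZl// -RintegralZl// -RintegralD//.
- apply: eq_Rintegral => x _; field; rewrite gt_eqF//.
- exact: integrableZl i2.
- exact: integrableZl i1.
Qed.

(** * The change of variables chi and the heat equation *)

(** The computation behind the comparison. Here H is a solution and B a strict
    supersolution of the backward heat equation, both composed with chi, and E =
    exp (gamma (M - a P^2 / 2)). At a point where Phi = s (E - H) - e B has
    Phi_xi = 0 and Phi_xixi <= 0, the second-order terms in xi can be divided by
    (1 - a P_xi)^2 and turned into second derivatives in z; the equations then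
    cancel up to the strict supersolution, which makes Phi_t positive. *)
Lemma hodograph_comparison_local (R : realType)
    (sigma gamma T e s t x : R) (P M H B : R -> R -> R) (p hz bz : R -> R)
    (pp Pt hzz bzz bt : R) :
  let a t := gamma * sigma ^+ 2 * (T - t) in
  let chi t y := y - a t * P t y in
  let chit := gamma * sigma ^+ 2 * P t x - a t * Pt in
  let Phi t y := s * (expR (gamma * (M t y - a t / 2 * P t y ^+ 2))
    - H t (chi t y)) - e * B t (chi t y) in
  0 < sigma -> 0 < e ->
  (forall y : R, is_derive y 1 (P t) (p y)) -> is_derive x 1 p pp ->
  is_derive t 1 (P ^~ x) Pt ->
  (forall y : R, is_derive y 1 (M t) (P t y)) ->
  is_derive t 1 (M ^~ x) (- (sigma ^+ 2 * p x / (2 * (1 - a t * p x)))) ->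
  0 < 1 - a t * p x ->
  (forall z : R, is_derive z 1 (H t) (hz z)) -> is_derive (chi t x) 1 hz hzz ->
  is_derive t 1 (fun r => H r (chi r x))
    (- (sigma ^+ 2 / 2) * hzz + hz (chi t x) * chit) ->
  (forall z : R, is_derive z 1 (B t) (bz z)) -> is_derive (chi t x) 1 bz bzz ->
  is_derive t 1 (fun r => B r (chi r x)) (bt + bz (chi t x) * chit) ->
  bt + sigma ^+ 2 / 2 * bzz < 0 ->
  exists (px : R -> R) (pxx pt : R),
    [/\ forall y : R, is_derive y 1 (Phi t) (px y), is_derive x 1 px pxx,
        is_derive t 1 (Phi ^~ x) pt & px x = 0 -> pxx <= 0 -> 0 < pt].
Proof.
move=> a chi chit Phi s0 e0 dP dp dPt dM dMt chi'0 dH dhz dHt dB dbz dBt Bneg.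
pose E y := expR (gamma * (M t y - a t / 2 * P t y ^+ 2)).
have dchi (y : R) : is_derive y 1 (chi t) (1 - a t * p y).
  by rewrite /chi; have ? := dP y; differentiate; ring.
have dHc (y : R) : is_derive y 1 (fun y => H t (chi t y))
    (hz (chi t y) * (1 - a t * p y)).
  exact: (is_derive_compE (dH _) (dchi _)).
have dBc (y : R) : is_derive y 1 (fun y => B t (chi t y))
    (bz (chi t y) * (1 - a t * p y)).
  exact: (is_derive_compE (dB _) (dchi _)).
have dE (y : R) : is_derive y 1 E
    (E y * (gamma * (P t y * (1 - a t * p y)))).
  by rewrite /E; have ? := dP y; have ? := dM y; differentiate; field.
pose px y := s * (E y * (gamma * (P t y * (1 - a t * p y)))
    - hz (chi t y) * (1 - a t * p y)) - e * (bz (chi t y) * (1 - a t * p y)).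
pose P0 := P t x; pose p0 := p x; pose E0 := E x; pose A := a t.
pose hz0 := hz (chi t x); pose bz0 := bz (chi t x); pose c := 1 - A * p0.
pose pxx := s * (E0 * gamma ^+ 2 * P0 ^+ 2 * c ^+ 2
  + E0 * gamma * (p0 * c - A * P0 * pp) - (hzz * c ^+ 2 - hz0 * A * pp))
  - e * (bzz * c ^+ 2 - bz0 * A * pp).
pose pt := s * (E0 * (gamma * (- (sigma ^+ 2 * p0 / (2 * c))
    + gamma * sigma ^+ 2 / 2 * P0 ^+ 2 - A * P0 * Pt))
  - (- (sigma ^+ 2 / 2) * hzz + hz0 * chit)) - e * (bt + bz0 * chit).
exists px, pxx, pt; split.
- move=> y; rewrite /Phi /px -/(E y).
  have ? := dE y; have ? := dHc y; have ? := dBc y.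
  by rewrite -/E; differentiate; ring.
- rewrite /px; have ? := dE x; have ? := dP x.
  have dhc : is_derive x 1 (fun y => hz (chi t y)) (hzz * (1 - a t * p x)).
    exact: (is_derive_compE dhz (dchi _)).
  have dbc : is_derive x 1 (fun y => bz (chi t y)) (bzz * (1 - a t * p x)).
    exact: (is_derive_compE dbz (dchi _)).
  by differentiate; rewrite /pxx /c /E0 /P0 /p0 /A /hz0 /bz0; ring.
- have da : is_derive t 1 a (- (gamma * sigma ^+ 2)).
    by rewrite /a; differentiate; ring.
  rewrite /Phi; differentiate.
  by rewrite /pt /c /E0 /E /P0 /p0 /A /hz0 /bz0; field; rewrite gt_eqF.
rewrite /px -/E0 -/hz0 -/bz0 -/P0 -/p0 -/A -/c => px0 pxx0.
have c0 : 0 < c by [].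
(* Phi_xi = 0, divided by c = 1 - a P_xi. *)
have h1 : s * hz0 + e * bz0 = s * gamma * E0 * P0.
  apply: (mulIf (lt0r_neq0 c0)); rewrite -[RHS]subr0 -px0; ring.
(* Phi_xixi <= 0, divided by c^2; the terms with P_xixi cancel by Phi_xi = 0. *)
have h2 : 0 <= s * hzz + e * bzz
    - s * E0 * (gamma ^+ 2 * P0 ^+ 2 + gamma * p0 / c).
  rewrite -(@pmulr_lge0 _ (c ^+ 2)) ?exprn_gt0// -oppr_le0.
  apply: le_trans pxx0; rewrite le_eqVlt; apply/orP; left; apply/eqP.
  have -> : pxx = - (s * hzz + e * bzz
      - s * E0 * (gamma ^+ 2 * P0 ^+ 2 + gamma * p0 / c)) * c ^+ 2
      + A * pp * (s * hz0 + e * bz0 - s * gamma * E0 * P0).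
    by rewrite /pxx; field; rewrite gt_eqF.
  by rewrite h1 subrr mulr0 addr0 mulNr.
(* Likewise the transport terms along chi cancel by Phi_xi = 0. *)
have -> : pt = s * E0 * gamma * (- (sigma ^+ 2 * p0 / (2 * c))
    - gamma * sigma ^+ 2 / 2 * P0 ^+ 2) + sigma ^+ 2 / 2 * (s * hzz) - e * bt.
  rewrite /pt.
  rewrite [RHS](_ : _ = pt - (s * gamma * E0 * P0 - (s * hz0 + e * bz0)) * chit).
    by rewrite h1 subrr mul0r subr0.
  by rewrite /pt /chit -/P0 -/A; field; rewrite gt_eqF.
have h3 : 0 <= sigma ^+ 2 / 2 * (s * hzz + e * bzz
    - s * E0 * (gamma ^+ 2 * P0 ^+ 2 + gamma * p0 / c)).
  by rewrite mulr_ge0// divr_ge0// sqr_ge0.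
have h4 : 0 < e * - (bt + sigma ^+ 2 / 2 * bzz) by rewrite mulr_gt0// oppr_gt0.
rewrite -subr_gt0 in h4 *; rewrite subr0 in h4 *.
apply: (lt_le_trans h4); rewrite -subr_ge0; apply: (le_trans h3).
rewrite le_eqVlt; apply/orP; left; apply/eqP; field.
by rewrite gt_eqF.
Qed.

(** The exponent z^2 / (2 sigma^2 (t + T / 2)) beats z^2 / (2 sigma^2 (t + T)),
    the growth of the compared functions. The Gaussian part alone is not a
    supersolution (its defect is 1 / (2 (t + T / 2)) <= 1 / T), which the factor
    exp (2 (T - t) / T) corrects. *)
Definition heat_barrier {R : realType} (T sigma t z : R) : R :=
  expR (z ^+ 2 / (2 * sigma ^+ 2 * (t + T / 2)) + 2 / T * (T - t)).

(** The time derivative is taken along a curve, as in [heat_solution]. *)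
Lemma heat_barrier_supersolution (R : realType) (T sigma t : R)
    (w : R -> R) (dw : R) :
  0 < T -> 0 < sigma -> 0 <= t -> is_derive t 1 w dw ->
  exists (bz : R -> R) (bzz bt : R),
  [/\ forall z : R, is_derive z 1 (heat_barrier T sigma t) (bz z),
      is_derive (w t) 1 bz bzz,
      is_derive t 1 (fun r => heat_barrier T sigma r (w r)) (bt + bz (w t) * dw) &
      bt + sigma ^+ 2 / 2 * bzz < 0].
Proof.
move=> T0 s0 t0 dwt; pose h := t + T / 2.
have h0 : 0 < h by rewrite ltr_wpDl// divr_gt0.
have h_neq0 : h != 0 by rewrite gt_eqF.
have s_neq0 : sigma != 0 by rewrite gt_eqF.
have T_neq0 : T != 0 by rewrite gt_eqF.
pose B z := heat_barrier T sigma t z; pose z := w t.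
have dB (y : R) : is_derive y 1 (heat_barrier T sigma t)
    (B y * (y / (sigma ^+ 2 * h))).
  rewrite /B /heat_barrier -/h; differentiate.
  by field; rewrite h_neq0 s_neq0.
exists (fun y => B y * (y / (sigma ^+ 2 * h))),
  (B z * (z ^+ 2 / (sigma ^+ 4 * h ^+ 2) + 1 / (sigma ^+ 2 * h))),
  (B z * (- (z ^+ 2 / (2 * sigma ^+ 2 * h ^+ 2)) - 2 / T)); split => //.
- have ? : is_derive z 1 B (B z * (z / (sigma ^+ 2 * h))) by exact: dB.
  rewrite -/z; differentiate.
  by field; rewrite h_neq0 s_neq0.
- rewrite /B /heat_barrier; differentiate.
    by rewrite -/h !mulf_neq0// expf_neq0.
  by rewrite -/h -/z; field; rewrite h_neq0 s_neq0 T_neq0.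
rewrite [ltLHS](_ : _ = B z * (1 / (2 * h) - 2 / T)); last first.
  by field; rewrite s_neq0 T_neq0 gt_eqF.
rewrite pmulr_rlt0 ?expR_gt0// subr_lt0 ltr_pdivrMr ?mulr_gt0//.
rewrite mulrAC ltr_pdivlMr// mul1r /h; nra.
Qed.

Lemma lipschitz_derive_bounds (R : realType) (P : R -> R) (l d x : R) :
  (forall x y, x <= y -> 0 <= P y - P x <= l * (y - x)) ->
  is_derive x 1 P d -> 0 <= d <= l.
Proof.
move=> Pl dP; pose h n : R := n.+1%:R^-1.
have h0 n : 0 < h n by rewrite invr_gt0.
have hc : h n @[n --> \oo] --> 0 by exact: cvg_harmonic.
have qc := @diff_quot_cvg _ P x d h dP (fun n => lt0r_neq0 (h0 n)) hc.
have b n : 0 <= (P (x + h n) - P x) / h n <= l.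
  have := Pl x (x + h n); rewrite lerDl (ltW (h0 n)) => /(_ isT).
  rewrite addrAC subrr add0r => /andP[b1 b2].
  by rewrite divr_ge0 ?(ltW (h0 n))//= ler_pdivrMr.
apply/andP; split.
- by apply: (cvgr_to_ge qc); apply: nearW => n; case/andP: (b n).
- by apply: (cvgr_to_le qc); apply: nearW => n; case/andP: (b n).
Qed.

(** At fixed time the map y |-> N y - a P^2 / 2, seen as a function of chi, has
    derivative P, which in turn has slope at most l / (1 - a l) in chi. The bound
    is the corresponding second-order expansion; it is obtained in the variable y,
    where the derivative of the difference of the two sides has the sign of - y. *)
Lemma legendre_growth (R : realType) (N P p : R -> R) (a l x : R) :
  0 <= a -> 0 < l -> a * l < 1 ->
  (forall y : R, is_derive y 1 N (P y)) ->
  (forall y : R, is_derive y 1 P (p y)) ->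
  (forall x y, x <= y -> 0 <= P y - P x <= l * (y - x)) ->
  let chi y := y - a * P y in
  (N x - a / 2 * P x ^+ 2 <= N 0 - a / 2 * P 0 ^+ 2 + P 0 * (chi x - chi 0)
    + l / (2 * (1 - a * l)) * (chi x - chi 0) ^+ 2 : Prop).
Proof.
move=> a0 l0 al dN dP Pl chi.
have c0 : 0 < 1 - a * l by rewrite subr_gt0.
pose Z y := N y - a / 2 * P y ^+ 2 - P 0 * (chi y - chi 0)
  - l / (2 * (1 - a * l)) * (chi y - chi 0) ^+ 2.
pose dZ y := (1 - a * p y) * (P y - P 0 - l / (1 - a * l) * (chi y - chi 0)).
have dZE (y : R) : is_derive y 1 Z (dZ y).
  rewrite /Z /dZ /chi; have ? := dP y; have ? := dN y; differentiate.
  by field; rewrite gt_eqF.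
have p1 y : 0 <= 1 - a * p y.
  have /andP[p0 pl] := lipschitz_derive_bounds Pl (dP y).
  have := ler_wpM2l a0 pl; lra.
have key y : (P y - P 0 - l / (1 - a * l) * (chi y - chi 0)) * (1 - a * l)
    = P y - P 0 - l * y by rewrite /chi; field; rewrite gt_eqF.
have Z0 : Z 0 = N 0 - a / 2 * P 0 ^+ 2 by rewrite /Z subrr; ring.
suff : Z x <= Z 0 by rewrite Z0 /Z; lra.
rewrite -lerN2.
apply: (@ge0_min_at_0 _ (fun y => - Z y) (fun y => - dZ y)) => y y0.
  rewrite oppr_ge0 /dZ mulr_ge0_le0// -(@pmulr_lle0 _ (1 - a * l))// key.
  by have /andP[_] := Pl 0 y y0; lra.
rewrite oppr_le0 /dZ mulr_ge0// -(@pmulr_lge0 _ (1 - a * l))// key.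
by have /andP[_] := Pl y 0 y0; lra.
Qed.

(** The positive quadratic term d y^2 is the gap between the growth rate of the
    barrier and that of the compared functions. *)
Lemma quadratic_gap (R : realType) (C d e : R) : 0 <= C -> 0 < d ->
  exists2 r, 0 < r & forall y, r <= y -> C + C * y - d * y ^+ 2 <= e.
Proof.
move=> C0 d0; exists (1 + (2 * C + `|e|) / d).
  by rewrite ltr_pwDl// divr_ge0 ?addr_ge0 ?mulr_ge0// ltW.
move=> y ry.
have y1 : 1 <= y.
  by rewrite (le_trans _ ry)// lerDl divr_ge0 ?addr_ge0 ?mulr_ge0// ltW.
have dy : 2 * C + `|e| <= d * y.
  by rewrite (mulrC d) -ler_pdivrMr// (le_trans _ ry)// lerDr.
have y0 : 0 <= y by lra.
have h : (2 * C + `|e|) * y <= d * y * y by rewrite ler_wpM2r.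
have h2 : `|e| <= `|e| * y by rewrite ler_peMr.
have h3 : C <= C * y by rewrite ler_peMr.
have : - e <= `|e| by rewrite -normrN ler_norm.
by rewrite expr2; lra.
Qed.

(** What the comparison uses of a solution P: its potential M, its derivatives
    p = P_xi, pp = P_xixi and Pt = P_t, and the time derivative of M. The equation
    for P itself enters only through the last field, whose derivative in xi it is. *)
Record hodograph {R : realType} (T sigma gamma l : R)
    (P M p pp Pt : R -> R -> R) : Prop := Hodograph {
  hodograph_P : strip_continuous 0 T P ;
  hodograph_M : strip_continuous 0 T M ;
  hodograph_Pt : strip_continuous 0 T Pt ;
  hodograph_slope : forall t, 0 <= t <= T ->
    forall x y, x <= y -> 0 <= P t y - P t x <= l * (y - x) ;
  hodograph_dP : forall t, 0 <= t <= T ->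
    forall y : R, is_derive y 1 (P t) (p t y) ;
  hodograph_dp : forall t, 0 <= t <= T ->
    forall y : R, is_derive y 1 (p t) (pp t y) ;
  hodograph_dtP : forall t : R, 0 < t < T ->
    forall y, is_derive t 1 (P ^~ y) (Pt t y) ;
  hodograph_dM : forall t, 0 <= t <= T ->
    forall y : R, is_derive y 1 (M t) (P t y) ;
  hodograph_dtM : forall t : R, 0 < t < T -> forall y,
    is_derive t 1 (M ^~ y) (- (sigma ^+ 2 * p t y /
      (2 * (1 - gamma * sigma ^+ 2 * (T - t) * p t y)))) }.

(** Its differential in xi is P times that of chi, so that P is its gradient in the
    variable chi. At (0, 0) it is Gamma when M is the potential of P. *)
Definition hodograph_value {R : realType} (T sigma gamma : R)
    (P M : R -> R -> R) (t x : R) : R :=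
  M t x - gamma * sigma ^+ 2 * (T - t) / 2 * P t x ^+ 2.

(** Since a l < 1 / 2, the derivative 1 - a P_xi of chi lies above 1 / 2. *)
Lemma hodograph_slope_lt (R : realType) (T sigma gamma l t : R) :
  0 < T -> 0 < sigma -> 0 < gamma -> 0 < l -> 2 * T * sigma ^+ 2 * gamma * l < 1 ->
  0 <= t <= T ->
  0 <= gamma * sigma ^+ 2 * (T - t) <= gamma * sigma ^+ 2 * T /\
  2 * (gamma * sigma ^+ 2 * (T - t) * l) < 1.
Proof.
move=> T0 s0 g0 l0 Tl /andP[t0 tT].
have k0 : 0 < gamma * sigma ^+ 2 by rewrite mulr_gt0// exprn_gt0.
have a1 : gamma * sigma ^+ 2 * (T - t) <= gamma * sigma ^+ 2 * T.
  by rewrite ler_pM2l//; lra.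
have a0 : 0 <= gamma * sigma ^+ 2 * (T - t).
  by rewrite mulr_ge0 ?(ltW k0)//; lra.
split; first by rewrite a0.
have := ler_wpM2r (ltW l0) a1; lra.
Qed.

(** Being increasing with slope at least 1 / 2, chi is proper, uniformly in
    time: large |xi| means large |chi|, where the barrier dominates. *)
Lemma hodograph_chi_lower (R : realType) (T sigma gamma l : R)
    (P M p pp Pt : R -> R -> R) :
  0 < T -> 0 < sigma -> 0 < gamma -> 0 < l -> 2 * T * sigma ^+ 2 * gamma * l < 1 ->
  hodograph T sigma gamma l P M p pp Pt ->
  exists2 C, 0 <= C & forall t x, 0 <= t <= T ->
    `|x| <= 2 * `|chi T sigma gamma P t x| + C.
Proof.
move=> T0 s0 g0 l0 Tl H.
have [C C0 HC] := strip_continuous_bounded 0 (hodograph_P H).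
pose k := gamma * sigma ^+ 2 * T.
have k0 : 0 <= k by rewrite !mulr_ge0 ?sqr_ge0// ltW.
exists (2 * (k * C)); first by rewrite mulr_ge0// mulr_ge0.
move=> t x tT.
have [/andP[a0 ak] al] := hodograph_slope_lt T0 s0 g0 l0 Tl tT.
rewrite /chi; set a := gamma * sigma ^+ 2 * (T - t) in a0 ak al *.
have PC : `|P t 0| <= C by apply: HC => //; rewrite normr0.
have Plx : `|P t x - P t 0| <= l * `|x|.
  have [x0|x0] := leP 0 x.
    have /andP[h1 h2] := hodograph_slope H tT x0.
    by rewrite !ger0_norm// -[X in l * X]subr0.
  have /andP[h1 h2] := hodograph_slope H tT (ltW x0).
  by rewrite distrC (ger0_norm h1) (ltr0_norm x0); lra.
have Px : `|P t x| <= C + l * `|x|.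
  by rewrite -[P t x](subrK (P t 0)) (le_trans (ler_normD _ _))//; lra.
have h1 := ler_wpM2l a0 Px.
have h2 : `|x| <= `|x - a * P t x| + a * `|P t x|.
  rewrite -[X in X * `|P t x|](ger0_norm a0) -normrM.
  by rewrite -{1}[x](subrK (a * P t x)) ler_normD.
have h3 := ler_wpM2r C0 ak.
have h4 := ler_wpM2r (normr_ge0 x) (ltW al).
rewrite -/k in h3; lra.
Qed.

(** In the variable z = chi, gamma V grows at most like gamma l z^2 / (2 (1 - a l))
    up to linear terms, and gamma l sigma^2 (t + T) <= 1 - a l because
    2 T sigma^2 gamma l < 1. *)
Lemma hodograph_value_growth (R : realType) (T sigma gamma l : R)
    (P M p pp Pt : R -> R -> R) :
  0 < T -> 0 < sigma -> 0 < gamma -> 0 < l -> 2 * T * sigma ^+ 2 * gamma * l < 1 ->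
  hodograph T sigma gamma l P M p pp Pt ->
  exists2 C, 0 <= C & forall t x, 0 <= t <= T ->
    gamma * hodograph_value T sigma gamma P M t x <=
    C + C * `|chi T sigma gamma P t x|
      + chi T sigma gamma P t x ^+ 2 / (2 * sigma ^+ 2 * (t + T)).
Proof.
move=> T0 s0 g0 l0 Tl H.
have [C1 C10 HC1] := strip_continuous_bounded 0 (hodograph_M H).
have [C2 C20 HC2] := strip_continuous_bounded 0 (hodograph_P H).
pose k := gamma * sigma ^+ 2 * T.
have k0 : 0 <= k by rewrite !mulr_ge0 ?sqr_ge0// ltW.
pose C3 := k * C2; have C30 : 0 <= C3 by rewrite mulr_ge0.
pose D0 := 1 / (2 * sigma ^+ 2 * T).
have sT0 : 0 < 2 * sigma ^+ 2 * T by rewrite !mulr_gt0// exprn_gt0.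
have D00 : 0 <= D0 by rewrite divr_ge0// ltW.
have gC1 : 0 <= gamma * C1 by rewrite mulr_ge0// ltW.
have gC2 : 0 <= gamma * C2 by rewrite mulr_ge0// ltW.
have gC23 : 0 <= gamma * C2 * C3 by rewrite mulr_ge0.
have DC3 : 0 <= D0 * C3 by rewrite mulr_ge0.
have DC32 : 0 <= D0 * C3 ^+ 2 by rewrite mulr_ge0// sqr_ge0.
exists (gamma * C1 + gamma * C2 * C3 + D0 * C3 ^+ 2 + gamma * C2 + 2 * (D0 * C3)).
  lra.
move=> t x tT.
have /andP[t0 tT1] := tT.
have [/andP[a0 ak] al] := hodograph_slope_lt T0 s0 g0 l0 Tl tT.
have al1 : gamma * sigma ^+ 2 * (T - t) * l < 1.
  have : 0 <= gamma * sigma ^+ 2 * (T - t) * l by rewrite mulr_ge0// ltW.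
  lra.
have := @legendre_growth _ (M t) (P t) (p t) _ l x a0 l0 al1
  (hodograph_dM H tT) (hodograph_dP H tT) (hodograph_slope H tT).
rewrite /= -/(hodograph_value T sigma gamma P M t x).
rewrite -/(hodograph_value T sigma gamma P M t 0).
rewrite -/(chi T sigma gamma P t x) -/(chi T sigma gamma P t 0).
set a := gamma * sigma ^+ 2 * (T - t) in a0 ak al al1 *.
set c := chi _ _ _ _ _ x; set c0 := chi _ _ _ _ _ 0.
move=> G; have {G} := ler_wpM2l (ltW g0) G.
set V := hodograph_value _ _ _ _ _ _ x; set V0 := hodograph_value _ _ _ _ _ _ 0.
move=> G.
pose D := 1 / (2 * sigma ^+ 2 * (t + T)).
have tTT0 : 0 < t + T by lra.
have d0 : 0 < 2 * sigma ^+ 2 * (t + T) by rewrite !mulr_gt0// exprn_gt0.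
have D_ge0 : 0 <= D by rewrite divr_ge0// ltW.
have DD0 : D <= D0.
  rewrite /D /D0 !div1r lef_pV2 ?posrE// ler_pM2l ?mulr_gt0 ?exprn_gt0//.
  by rewrite lerDr.
(* The quadratic rate of the value is below 1 / (2 sigma^2 (t + T)). *)
have lD : gamma * (l / (2 * (1 - a * l))) <= D.
  have cc : 0 < 2 * (1 - a * l) by lra.
  rewrite mulrA ler_pdivrMr// /D div1r ler_pdivlMl//.
  suff : gamma * l * (sigma ^+ 2 * (t + T)) <= 1 - a * l by lra.
  rewrite /a; lra.
have P0 : `|P t 0| <= C2 by apply: HC2 => //; rewrite normr0.
have c0C3 : `|c0| <= C3.
  rewrite /c0 /chi sub0r normrN normrM (ger0_norm a0).
  by rewrite ler_pM.
have V0C : V0 <= C1.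
  have M0 : `|M t 0| <= C1 by apply: HC1 => //; rewrite normr0.
  rewrite /V0 /hodograph_value -/a (le_trans _ (le_trans (ler_norm _) M0))//.
  by rewrite gerDl oppr_le0 mulr_ge0 ?sqr_ge0// divr_ge0.
have h1 : P t 0 * (c - c0) <= C2 * (`|c| + C3).
  rewrite (le_trans (ler_norm _))// normrM ler_pM//.
  by rewrite (le_trans (ler_normB _ _))// lerD2l.
have h2 : (c - c0) ^+ 2 <= c ^+ 2 + 2 * `|c| * C3 + C3 ^+ 2.
  have : - (c * c0) <= `|c| * C3.
    by rewrite (le_trans (ler_norm _))// normrN normrM ler_wpM2l.
  have : c0 ^+ 2 <= C3 ^+ 2 by rewrite -real_normK ?num_real// lerXn2r ?nnegrE.
  have -> : (c - c0) ^+ 2 = c ^+ 2 + 2 * - (c * c0) + c0 ^+ 2 by ring.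
  set u := c ^+ 2; set v := c0 ^+ 2; set w := C3 ^+ 2; clearbody u v w.
  by move=> *; lra.
have h3 := ler_wpM2l (ltW g0) h1.
have h4 := ler_wpM2l (ltW g0) V0C.
have h5 := ler_wpM2r (sqr_ge0 (c - c0)) lD.
have h6 := ler_wpM2l D_ge0 h2.
have h7 := ler_wpM2r (sqr_ge0 C3) DD0.
have h8 : D * (`|c| * C3) <= D0 * (`|c| * C3) by rewrite ler_wpM2r// mulr_ge0.
have -> : c ^+ 2 / (2 * sigma ^+ 2 * (t + T)) = D * c ^+ 2.
  by rewrite /D div1r mulrC.
have h9 : 0 <= (gamma * C1 + gamma * C2 * C3 + D0 * C3 ^+ 2) * `|c|.
  by rewrite mulr_ge0//; lra.
have /= h10 := mulr_ge0 DC3 (normr_ge0 c).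
have /= h11 := mulr_ge0 gC2 (normr_ge0 c).
nra.
Qed.

(** The weight f is below a multiple of exp (x^2 / (4 sigma^2 T)), whose heat
    flow is explicit: s = sigma^2 T and v = sigma^2 (T - t) give 2 s - v =
    sigma^2 (t + T). *)
Lemma heat_growth_strip (R : realType) (T sigma gamma l A : R) (f : R -> R) :
  0 < T -> 0 < sigma -> 0 < gamma -> 0 < l -> 2 * T * sigma ^+ 2 * gamma * l < 1 ->
  0 <= A -> continuous f ->
  (forall x, `|f x| <= expR (A * `|x| + gamma * l / 2 * x ^+ 2)) ->
  exists2 C, 0 <= C & forall t z, 0 <= t <= T ->
    heat f (sigma ^+ 2 * (T - t)) z <=
    expR (C + z ^+ 2 / (2 * sigma ^+ 2 * (t + T))).
Proof.
move=> T0 s0 g0 l0 Tl A0 cf fle.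
have s20 : 0 < sigma ^+ 2 by rewrite exprn_gt0.
pose S := sigma ^+ 2 * T; have S0 : 0 < S by rewrite mulr_gt0.
pose c := gamma * l / 2.
have c0 : 0 <= c by rewrite divr_ge0// mulr_ge0// ltW.
have cS : 4 * (c * S) < 1 by rewrite /c /S; lra.
pose d := 1 / (4 * S) - c.
have d0 : 0 < d by rewrite subr_gt0 ltr_pdivlMr ?mulr_gt0//; lra.
pose C1 := A ^+ 2 / (2 * d).
have C10 : 0 <= C1 by rewrite divr_ge0 ?sqr_ge0// mulr_ge0// ltW.
have fC x : f x <= expR C1 * expR (x ^+ 2 / (4 * S)).
  rewrite (le_trans (ler_norm _))// (le_trans (fle x))// -expRD ler_expR.
  have := gauss_dom_le 0 A x d0; have := mulr_ge0 (ltW d0) (sqr_ge0 x).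
  have -> : x ^+ 2 / (4 * S) = (d + c) * x ^+ 2 by rewrite /d; field; rewrite gt_eqF.
  rewrite -/c /C1; lra.
exists (C1 + ln 2).
  by rewrite addr_ge0// ln_ge0// ler1n.
move=> t z /andP[t0 tT].
have v0 : 0 <= sigma ^+ 2 * (T - t) by rewrite mulr_ge0 ?(ltW s20)//; lra.
have vS : sigma ^+ 2 * (T - t) <= S by rewrite ler_pM2l//; lra.
have cv : c * (sigma ^+ 2 * (T - t)) <= 1 / 4.
  by have := ler_wpM2l c0 vS; lra.
have vS' : 0 <= sigma ^+ 2 * (T - t) <= S by rewrite v0.
apply: (le_trans (heat_growth z A0 c0 cf fle cv S0 vS' (expR_ge0 C1) fC)).
rewrite -[X in X * _ * _]lnK ?posrE// -!expRD ler_expR lerD//.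
  by rewrite addrC.
rewrite (_ : 2 * (2 * S - _) = 2 * sigma ^+ 2 * (t + T))//.
by rewrite /S; ring.
Qed.

(** For 0 <= t <= T the two quadratic rates differ by at least
    1 / (12 sigma^2 T). *)
Lemma heat_barrier_dominates (R : realType) (T sigma C e : R) :
  0 < T -> 0 < sigma -> 0 <= C -> 0 < e ->
  exists2 r, 0 < r & forall t z, 0 <= t <= T -> r <= `|z| ->
    expR (C + C * `|z| + z ^+ 2 / (2 * sigma ^+ 2 * (t + T))) <=
    e * heat_barrier T sigma t z.
Proof.
move=> T0 s0 C0 e0; have s20 : 0 < sigma ^+ 2 by rewrite exprn_gt0.
pose d := 1 / (12 * sigma ^+ 2 * T).
have d0 : 0 < d by rewrite divr_gt0// !mulr_gt0.
have [r r0 Hr] := quadratic_gap (ln e) C0 d0.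
exists r => // t z /andP[t0 tT] rz.
rewrite /heat_barrier -[X in _ <= X * _]lnK ?posrE// -expRD ler_expR.
have := Hr _ rz; rewrite real_normK ?num_real//.
have : 0 <= 2 / T * (T - t) by rewrite mulr_ge0 ?divr_ge0 ?(ltW T0)//; lra.
have tT0 : 0 < t + T by lra.
have tT20 : 0 < t + T / 2 by lra.
have : d * z ^+ 2 <= z ^+ 2 / (2 * sigma ^+ 2 * (t + T / 2))
    - z ^+ 2 / (2 * sigma ^+ 2 * (t + T)).
  have -> : z ^+ 2 / (2 * sigma ^+ 2 * (t + T / 2))
    - z ^+ 2 / (2 * sigma ^+ 2 * (t + T)) =
    T / (4 * sigma ^+ 2 * ((t + T / 2) * (t + T))) * z ^+ 2.
    by field; rewrite !gt_eqF//; lra.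
  rewrite ler_wpM2r ?sqr_ge0// /d ler_pdivlMr ?mulr_gt0//.
  rewrite div1r ler_pdivrMl ?mulr_gt0//.
  have h : (t + T / 2) * (t + T) <= (T + T / 2) * (T + T).
    by rewrite ler_pM//; lra.
  have := ler_wpM2l (ltW s20) h; lra.
lra.
Qed.

(** Continuity includes the terminal time, where the variance vanishes. *)
Lemma strip_continuous_heat_chi (R : realType) (T sigma gamma l A : R)
    (f : R -> R) (P : R -> R -> R) :
  0 < T -> 0 < sigma -> 0 < gamma -> 0 < l -> 2 * T * sigma ^+ 2 * gamma * l < 1 ->
  0 <= A -> continuous f ->
  (forall x, `|f x| <= expR (A * `|x| + gamma * l / 2 * x ^+ 2)) ->
  strip_continuous 0 T P ->
  strip_continuous 0 T
    (fun t x => heat f (sigma ^+ 2 * (T - t)) (chi T sigma gamma P t x)).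
Proof.
move=> T0 s0 g0 l0 Tl A0 cf fle cP tn xn t x tnT tT tnt xnx.
have Pn := cP tn xn t x tnT tT tnt xnx.
have s20 : 0 < sigma ^+ 2 by rewrite exprn_gt0.
have gl0 : 0 <= gamma * l / 2 by rewrite divr_ge0// mulr_ge0// ltW.
have v0 n : 0 <= sigma ^+ 2 * (T - tn n).
  by rewrite mulr_ge0 ?(ltW s20)//; have := tnT n; lra.
have vT n : sigma ^+ 2 * (T - tn n) <= sigma ^+ 2 * T.
  by rewrite ler_pM2l//; have := tnT n; lra.
have zc : chi T sigma gamma P (tn n) (xn n) @[n --> \oo] -->
    chi T sigma gamma P t x by rewrite /chi; take_limit.
have [Z [_ HZ]] : bounded_fun (fun n => chi T sigma gamma P (tn n) (xn n)).
  apply: cvg_seq_bounded; apply/cvg_ex; eexists; exact: zc.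
have vc : sigma ^+ 2 * (T - tn n) @[n --> \oo] --> sigma ^+ 2 * (T - t) by take_limit.
apply: (@heat_cvg _ (fun=> f) f _ _ _ _ A (gamma * l / 2)
  (Num.sqrt (sigma ^+ 2 * T)) (Num.max Z 0 + 1)) => //.
- by move=> n; rewrite ler_wsqrtr.
- by move=> n; have := ler_wpM2l gl0 (vT n); nra.
- by move=> n; apply: (HZ (Num.max Z 0 + 1)) => //; rewrite ltr_pwDr// le_max lexx.
move=> y.
apply: (@cvg_comp _ _ _ (fun n => chi T sigma gamma P (tn n) (xn n)
  + Num.sqrt (sigma ^+ 2 * (T - tn n)) * y) f _ _ _ _ (cf _)).
apply: cvgD => //; apply: cvgM; last exact: cvg_cst.
exact: (cvg_comp _ _ vc (@sqrt_continuous _ _)).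
Qed.

Lemma strip_continuous_barrier_chi (R : realType) (T sigma gamma : R)
    (P : R -> R -> R) : 0 < T -> 0 < sigma -> strip_continuous 0 T P ->
  strip_continuous 0 T
    (fun t x => heat_barrier T sigma t (chi T sigma gamma P t x)).
Proof.
move=> T0 s0 cP tn xn t x tnT tT tnt xnx.
have Pn := cP tn xn t x tnT tT tnt xnx.
have zc : chi T sigma gamma P (tn n) (xn n) @[n --> \oo] -->
    chi T sigma gamma P t x by rewrite /chi; take_limit.
have s20 : 0 < sigma ^+ 2 by rewrite exprn_gt0.
have ic : (2 * sigma ^+ 2 * (tn n + T / 2))^-1 @[n --> \oo] -->
    (2 * sigma ^+ 2 * (t + T / 2))^-1.
  apply: cvgV; last by take_limit.
  by rewrite gt_eqF// !mulr_gt0//; lra.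
by rewrite /heat_barrier; take_limit.
Qed.

Lemma strip_continuous_value (R : realType) (T sigma gamma : R)
    (P M : R -> R -> R) : strip_continuous 0 T P -> strip_continuous 0 T M ->
  strip_continuous 0 T
    (fun t x => expR (gamma * hodograph_value T sigma gamma P M t x)).
Proof.
move=> cP cM tn xn t x tnT tT tnt xnx.
have Pn := cP tn xn t x tnT tT tnt xnx.
have Mn := cM tn xn t x tnT tT tnt xnx.
by rewrite /hodograph_value; take_limit.
Qed.

(** The curve is r |-> (sigma^2 (T - r), chi(r, x)), restricted to times away from
    T so that the variance stays positive. *)
Lemma hodograph_heat_path (R : realType) (T sigma gamma l A : R) (f : R -> R)
    (P M p pp Pt : R -> R -> R) (t x : R) :
  0 < T -> 0 < sigma -> 0 < gamma -> 0 < l -> 2 * T * sigma ^+ 2 * gamma * l < 1 ->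
  0 <= A -> continuous f -> (forall x, 0 <= f x) ->
  (forall x, `|f x| <= expR (A * `|x| + gamma * l / 2 * x ^+ 2)) ->
  hodograph T sigma gamma l P M p pp Pt -> 0 < t < T ->
  exists (hz : R -> R) (hzz : R),
  [/\ forall z : R, is_derive z 1 (heat f (sigma ^+ 2 * (T - t))) (hz z),
      is_derive (chi T sigma gamma P t x) 1 hz hzz &
      is_derive t 1
        (fun r => heat f (sigma ^+ 2 * (T - r)) (chi T sigma gamma P r x))
        (- (sigma ^+ 2 / 2) * hzz + hz (chi T sigma gamma P t x) *
          (gamma * sigma ^+ 2 * P t x - gamma * sigma ^+ 2 * (T - t) * Pt t x))].
Proof.
move=> T0 s0 g0 l0 Tl A0 cf f0 fle H tT; have /andP[t0 tT1] := tT.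
have s20 : 0 < sigma ^+ 2 by rewrite exprn_gt0.
have [C1 C10 HC1] := strip_continuous_bounded `|x| (hodograph_P H).
have [C2 C20 HC2] := strip_continuous_bounded `|x| (hodograph_Pt H).
pose k := gamma * sigma ^+ 2; have k0 : 0 < k by rewrite mulr_gt0.
pose dw r := k * P r x - k * (T - r) * Pt r x.
have kC1 : 0 <= k * C1 by rewrite mulr_ge0// ltW.
have kTC1 : 0 <= k * T * C1 by rewrite !mulr_ge0// ltW.
have kTC2 : 0 <= k * T * C2 by rewrite !mulr_ge0// ltW.
have v10 : 0 < sigma ^+ 2 * ((T - t) / 4) by rewrite mulr_gt0//; lra.
have cv : 2 * (gamma * l / 2 * (sigma ^+ 2 * T)) < 1 by nra.
have X0 : 0 < sigma ^+ 2 + k * C1 + k * T * C2 by lra.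
have tu : 0 < t < (T + t) / 2 by lra.
have [r|hz [hzz [h1 h2 h3]]] := @heat_solution _ f
  (fun r => sigma ^+ 2 * (T - r)) (fun r => chi T sigma gamma P r x)
  (fun=> - sigma ^+ 2) dw A (gamma * l / 2) _ _
  (`|x| + k * T * C1) (sigma ^+ 2 + k * C1 + k * T * C2) _ _ _
  A0 cf f0 fle v10 cv X0 tu.
  move=> /andP[r0 rT]; have rT' : 0 < r < T by lra.
  have rT'' : 0 <= r <= T by lra.
  have dP := hodograph_dtP H rT' x.
  have bP := HC1 r x rT'' (lexx _).
  have bPt := HC2 r x rT'' (lexx _).
  have kr : `|k * (T - r)| <= k * T.
    have kTr : 0 <= k * (T - r) by rewrite mulr_ge0 ?(ltW k0)// subr_ge0; lra.
    by rewrite ger0_norm// ler_pM2l// lerBlDr lerDl; case/andP: rT''.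
  have kP : `|k * P r x| <= k * C1 by rewrite normrM (gtr0_norm k0) ler_pM2l.
  split.
  - by differentiate; ring.
  - by rewrite /chi /dw /k; differentiate; ring.
  - by rewrite !ltr_pM2l//; lra.
  split.
  - by rewrite /chi (le_trans (ler_normB _ _))// lerD2l normrM ler_pM.
  - by rewrite normrN (gtr0_norm s20); lra.
  - rewrite /dw (le_trans (ler_normB _ _))//.
    have : `|k * (T - r) * Pt r x| <= k * T * C2 by rewrite normrM ler_pM.
    lra.
exists hz, hzz; split => //.
by apply: (is_derive_eq h3); rewrite /dw -/k; field.
Qed.

(** Taking s = 1 and s = - 1 gives both inequalities. For every e > 0 the function
    s (E - H) - e B is nonpositive at time T and for large |xi|, so by the maximum
    principle everywhere; then e tends to 0. *)
Lemma hodograph_comparison (R : realType) (T sigma gamma l A s : R) (f : R -> R)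
    (P M p pp Pt : R -> R -> R) (t x : R) :
  0 < T -> 0 < sigma -> 0 < gamma -> 0 < l -> 2 * T * sigma ^+ 2 * gamma * l < 1 ->
  0 <= A -> continuous f -> (forall x, 0 <= f x) ->
  (forall x, `|f x| <= expR (A * `|x| + gamma * l / 2 * x ^+ 2)) ->
  hodograph T sigma gamma l P M p pp Pt ->
  (forall x, f x = expR (gamma * M T x)) ->
  s = 1 \/ s = -1 -> 0 < t < T ->
  s * (expR (gamma * hodograph_value T sigma gamma P M t x)
    - heat f (sigma ^+ 2 * (T - t)) (chi T sigma gamma P t x)) <= 0.
Proof.
move=> T0 s0 g0 l0 Tl A0 cf f0 fle H fT s1 tT.
have tT' : 0 <= t <= T by lra.
pose D t x := expR (gamma * hodograph_value T sigma gamma P M t x)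
    - heat f (sigma ^+ 2 * (T - t)) (chi T sigma gamma P t x).
pose B t x := heat_barrier T sigma t (chi T sigma gamma P t x).
have B0 r y : 0 < B r y by exact: expR_gt0.
suff main e : 0 < e -> s * D t x - e * B t x <= 0.
  rewrite leNgt; apply/negP => sD0.
  have e0 : 0 < s * D t x / (2 * B t x) by rewrite divr_gt0// mulr_gt0.
  have := main _ e0; rewrite (_ : s * D t x / (2 * B t x) * B t x = s * D t x / 2).
    rewrite -/(D t x) in sD0; lra.
  by field; rewrite gt_eqF.
move=> e0.
have [C1 C10 HC1] := hodograph_value_growth T0 s0 g0 l0 Tl H.
have [C2 C20 HC2] := heat_growth_strip T0 s0 g0 l0 Tl A0 cf fle.
have [C3 C30 HC3] := hodograph_chi_lower T0 s0 g0 l0 Tl H.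
have C0 : 0 <= C1 + C2 by lra.
have [r r0 Hr] := heat_barrier_dominates T0 s0 C0 e0.
have cD : strip_continuous 0 T D.
  move=> tn xn t' x' tnT t'T tnt xnx.
  have h1 := strip_continuous_value (sigma := sigma) (gamma := gamma)
    (hodograph_P H) (hodograph_M H) tnT t'T tnt xnx.
  have h2 := strip_continuous_heat_chi T0 s0 g0 l0 Tl A0 cf fle
    (hodograph_P H) tnT t'T tnt xnx.
  exact: cvgB.
have cB := strip_continuous_barrier_chi (gamma := gamma) T0 s0 (hodograph_P H).
have hf v z : 0 <= heat f v z.
  by apply: Rintegral_ge0 => y _; rewrite mulr_ge0// normal_pdf_ge0.
(* Beyond rr the barrier dominates, by the lower bound on |chi|; adding |x| keeps
   the point x inside. *)
pose rr := 2 * r + C3 + `|x|.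
have rr0 : 0 < rr by rewrite /rr; have := normr_ge0 x; lra.
apply: (@strict_maximum_principle _ t T rr (fun t x => s * D t x - e * B t x)) => //.
- by case/andP: tT'.
- move=> tn xn t' x' tnT t'T tnt xnx.
  have tnT0 n : 0 <= tn n <= T by have := tnT n; lra.
  have t'T0 : 0 <= t' <= T by lra.
  have h1 := cD tn xn t' x' tnT0 t'T0 tnt xnx.
  have h2 := cB tn xn t' x' tnT0 t'T0 tnt xnx.
  by apply: cvgB; apply: cvgM => //; exact: cvg_cst.
- move=> y; have -> : D T y = 0.
    rewrite /D /hodograph_value /chi subrr !(mulr0, mul0r) !subr0.
    rewrite /heat sqrtr0.
    under eq_Rintegral do rewrite mul0r addr0.
    rewrite RintegralZl//; last exact: integrable_normal_pdf.
    by rewrite /Rintegral integral_normal_pdf mulr1 fT subrr.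
  by rewrite mulr0 sub0r oppr_le0; exact: mulr_ge0 (ltW e0) (ltW (B0 _ _)).
- move=> t' y t'T yrr; have t'T0 : 0 <= t' <= T by lra.
  set z := chi T sigma gamma P t' y.
  have rz : r <= `|z|.
    have := HC3 t' y t'T0; rewrite yrr -/z /rr; have := normr_ge0 x; lra.
  have := Hr t' z t'T0 rz; rewrite -/z -/(B t' y) => hB.
  have zz : 0 <= z ^+ 2 / (2 * sigma ^+ 2 * (t' + T)).
    have t'TT : 0 < t' + T by lra.
    by rewrite divr_ge0 ?sqr_ge0// ltW// !mulr_gt0// exprn_gt0.
  have C1z := mulr_ge0 C10 (normr_ge0 z); have C2z := mulr_ge0 C20 (normr_ge0 z).
  have h1 : expR (gamma * hodograph_value T sigma gamma P M t' y) <= e * B t' y.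
    by apply: le_trans hB; rewrite ler_expR; have := HC1 t' y t'T0; rewrite -/z; lra.
  have h2 : heat f (sigma ^+ 2 * (T - t')) z <= e * B t' y.
    apply: (le_trans (HC2 t' z t'T0)); apply: le_trans hB.
    by rewrite ler_expR; lra.
  have h3 := expR_ge0 (gamma * hodograph_value T sigma gamma P M t' y).
  have h4 := hf (sigma ^+ 2 * (T - t')) z.
  rewrite subr_le0 /D -/z; case: s1 => ->.
    by rewrite mul1r (le_trans _ h1)// gerBl.
  by rewrite mulN1r opprB (le_trans _ h2)// gerBl.
- move=> t' y t'T; have t'T0 : 0 < t' < T by lra.
  have t'T1 : 0 <= t' <= T by lra.
  have [hz [hzz [hz1 hz2 hz3]]] :=
    hodograph_heat_path y T0 s0 g0 l0 Tl A0 cf f0 fle H t'T0.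
  have dP := hodograph_dP H t'T1.
  have dtP := hodograph_dtP H t'T0 y.
  have dchi : is_derive t' 1 (fun r => chi T sigma gamma P r y)
      (gamma * sigma ^+ 2 * P t' y - gamma * sigma ^+ 2 * (T - t') * Pt t' y).
    by rewrite /chi; differentiate; ring.
  have t'0 : 0 <= t' by lra.
  have [bz [bzz [bt [b1 b2 b3 b4]]]] :=
    heat_barrier_supersolution T0 s0 t'0 dchi.
  have p_lt : 0 < 1 - gamma * sigma ^+ 2 * (T - t') * p t' y.
    have [/andP[a0 _] al] := hodograph_slope_lt T0 s0 g0 l0 Tl t'T1.
    have /andP[_ pl] := lipschitz_derive_bounds (hodograph_slope H t'T1) (dP y).
    have := ler_wpM2l a0 pl; lra.
  exact: (@hodograph_comparison_local _ sigma gamma T e s t' y P M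
    (fun t z => heat f (sigma ^+ 2 * (T - t)) z) (heat_barrier T sigma)
    (p t') hz bz _ _ _ _ _ s0 e0 dP (hodograph_dp H t'T1 y) dtP
    (hodograph_dM H t'T1) (hodograph_dtM H t'T0 y) p_lt hz1 hz2 hz3 b1 b2 b3 b4).
- by rewrite lexx; case/andP: tT'.
- by rewrite /rr; lra.
Qed.

(** The Hopf-Cole representation. The comparison holds at positive times, where
    time derivatives are two-sided; time 0 follows by continuity. *)
Theorem hodograph_heat (R : realType) (T sigma gamma l A : R) (f : R -> R)
    (P M p pp Pt : R -> R -> R) (x : R) :
  0 < T -> 0 < sigma -> 0 < gamma -> 0 < l -> 2 * T * sigma ^+ 2 * gamma * l < 1 ->
  0 <= A -> continuous f -> (forall x, 0 <= f x) ->
  (forall x, `|f x| <= expR (A * `|x| + gamma * l / 2 * x ^+ 2)) ->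
  hodograph T sigma gamma l P M p pp Pt ->
  (forall x, f x = expR (gamma * M T x)) ->
  expR (gamma * hodograph_value T sigma gamma P M 0 x) =
  heat f (sigma ^+ 2 * T) (chi T sigma gamma P 0 x).
Proof.
move=> T0 s0 g0 l0 Tl A0 cf f0 fle H fT.
(* Shifted by two so that every time is below T. *)
pose tn n : R := T * n.+2%:R^-1.
have tn0 n : 0 < tn n by rewrite mulr_gt0// invr_gt0.
have tnT n : tn n < T by rewrite /tn ltr_pdivrMr// ltr_pMr// ltr1n.
have tn1 n : 0 <= tn n <= T by rewrite !ltW.
have tc : tn n @[n --> \oo] --> 0.
  rewrite -[X in _ --> X](mulr0 T); apply: cvgM; first exact: cvg_cst.
  by have := @cvg_harmonic R; rewrite -(cvg_shiftS (@harmonic R)).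
have xc : x @[_ --> \oo] --> x by exact: cvg_cst.
have T00 : 0 <= (0 : R) <= T by rewrite lexx ltW.
have h1 := strip_continuous_value (sigma := sigma) (gamma := gamma)
  (hodograph_P H) (hodograph_M H) tn1 T00 tc xc.
have h2 := strip_continuous_heat_chi T0 s0 g0 l0 Tl A0 cf fle
  (hodograph_P H) tn1 T00 tc xc.
rewrite /= subr0 in h2.
suff E n : heat f (sigma ^+ 2 * (T - tn n)) (chi T sigma gamma P (tn n) x) =
    expR (gamma * hodograph_value T sigma gamma P M (tn n) x).
  rewrite (funext E) in h2.
  exact: (cvg_unique (@Rhausdorff R) h1 h2).
have tnT' : 0 < tn n < T by rewrite tn0 tnT.
have := hodograph_comparison x T0 s0 g0 l0 Tl A0 cf f0 fle H fT
  (or_introl erefl) tnT'.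
have := hodograph_comparison x T0 s0 g0 l0 Tl A0 cf f0 fle H fT
  (or_intror erefl) tnT'.
rewrite mul1r mulN1r oppr_le0 => a b.
by apply/eqP; rewrite eq_sym -subr_eq0 eq_le a b.
Qed.

(** * The potential of a solution of the nonlinear equation *)

(** Projection onto [0, T]. Composing with it extends functions of time on
    [0, T] to continuous functions on the line, to which integration over intervals
    and the fundamental theorem apply without boundary conditions. *)
Definition clamp {R : realType} (T s : R) : R := Num.max 0 (Num.min s T).

Lemma clamp_itv (R : realType) (T s : R) : 0 <= T -> 0 <= clamp T s <= T.
Proof. by move=> T0; rewrite /clamp le_max lexx/= ge_max T0 ge_min lexx orbT. Qed.

Lemma clamp_id (R : realType) (T s : R) : 0 <= s <= T -> clamp T s = s.
Proof. by move=> /andP[s0 sT]; rewrite /clamp min_l// max_r. Qed.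

Lemma clamp_continuous (R : realType) (T : R) : continuous (clamp T).
Proof.
move=> s; apply: (@continuous_max _ _ (cst 0) (fun s => Num.min s T)).
  exact: cvg_cst.
by apply: (@continuous_min _ _ id (cst T)); [exact: cvg_id|exact: cvg_cst].
Qed.

Lemma strip_continuous_clamp (R : realType) (T x : R) (F : R -> R -> R) :
  0 <= T -> strip_continuous 0 T F -> continuous (fun s => F (clamp T s) x).
Proof.
move=> T0 cF s; apply/(@cvg_nbhsP _ R^o) => u us.
apply: cF; [by move=> n; exact: clamp_itv|exact: clamp_itv| |exact: cvg_cst].
by apply: continuous_cvg => //; exact: clamp_continuous.
Qed.

Lemma is_derive_clamp (R : realType) (T t x d : R) (F : R -> R -> R) :
  0 < t < T -> is_derive t 1 (F ^~ x) d ->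
  is_derive t 1 (fun s => F (clamp T s) x) d.
Proof.
move=> tT dF; apply: near_eq_is_derive dF.
have : t \in `]0, T[ by rewrite in_itv.
move/near_in_itvoo; apply: filterS => s.
rewrite in_itv/= => /andP[s0 sT].
by rewrite clamp_id// !ltW.
Qed.

Lemma derive_bounds_slope (R : realType) (f df : R -> R) (C x y : R) :
  (forall z : R, is_derive z 1 f (df z)) -> (forall z, 0 <= df z <= C) ->
  x <= y -> 0 <= f y - f x <= C * (y - x).
Proof.
move=> dfE dfC xy; apply/andP; split.
  rewrite subr_ge0.
  by apply: (@derivable_nondecreasing _ f df) => // z _; case/andP: (dfC z).
suff : C * x - f x <= C * y - f y by lra.
have dg (z : R) : is_derive z 1 (fun z => C * z - f z) (C - df z).
  by have ? := dfE z; differentiate; ring.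
apply: (@derivable_nondecreasing _ (fun z => C * z - f z)
  (fun z => C - df z)) => // z _.
by rewrite subr_ge0; case/andP: (dfC z).
Qed.

(** At interior times the limit within [0, T] is the ordinary one. *)
Lemma dt_is_derive (R : realType) (T t x : R) (P : R -> R -> R) : 0 < t < T ->
  cvg (dt_quotient P t x s @[s --> within `[0, T] t^']) ->
  is_derive t 1 (P ^~ x) (dt T P t x).
Proof.
move=> tT cq.
have H : h^-1 *: (P (h + t) x - P t x) @[h --> 0^'] --> dt T P t x.
  apply/cvgr_dnbhsP => u [u0 uc].
  have us : u n + t @[n --> \oo] --> within `[0, T] t^'.
    have ut : u n + t @[n --> \oo] --> t.
      rewrite -[X in _ --> X]add0r; apply: cvgD => //; exact: cvg_cst.
    move=> U; rewrite /within/= => H.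
    have K : \forall s \near t, `[0, T]%classic s.
      have : t \in `]0, T[ by rewrite in_itv.
      move/near_in_itvoo; apply: filterS => s /=.
      by rewrite !in_itv/= => /andP[s0 sT]; rewrite !ltW.
    have [N1 _ HN1] := ut _ H; have [N2 _ HN2] := ut _ K.
    exists (maxn N1 N2) => // n; rewrite /= geq_max => /andP[n1 n2].
    apply: (HN1 n n1) (HN2 n n2).
    by rewrite -subr_eq0 addrK.
  have := cvg_comp _ _ us cq.
  apply: cvg_trans; apply: near_eq_cvg; apply: nearW => n /=.
  by rewrite /dt_quotient addrK mulrC.
have H' : h^-1 *: (P (h *: 1 + t) x - P t x) @[h --> 0^'] --> dt T P t x.
  by under eq_fun do rewrite scaler1.
apply: DeriveDef.
  by apply/cvg_ex; exists (dt T P t x).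
by apply/cvg_lim.
Qed.

Lemma is_P_slope (R : realType) (T sigma gamma l t : R) (phi : R -> R)
    (P : R -> R -> R) : is_P T sigma gamma l phi P -> 0 <= t <= T ->
  forall x y, x <= y -> 0 <= P t y - P t x <= l * (y - x).
Proof.
move=> [_ + _ _] => /(_ t) H /H[lip homo] x y xy.
have h0 : 0 <= P t y - P t x by rewrite subr_ge0 homo.
rewrite h0/= -(ger0_norm h0) -[X in l * X]ger0_norm ?subr_ge0//.
exact: (lip (y, x)).
Qed.

(** Minus the time derivative of the potential. *)
Definition hodograph_speed {R : realType} (T sigma gamma : R) (P : R -> R -> R)
    (t x : R) : R :=
  sigma ^+ 2 * derive1 (P t) x /
    (2 * (1 - gamma * sigma ^+ 2 * (T - t) * derive1 (P t) x)).

(** The equation for P says that the xi-derivative of the speed is - P_t, and the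
    slopes of P being at most l, with 1 - a P_xi >= 1 / 2, bounds the speed. *)
Lemma is_P_derivatives (R : realType) (T sigma gamma l : R) (phi : R -> R)
    (P : R -> R -> R) :
  0 < T -> 0 < sigma -> 0 < gamma -> 0 < l -> 2 * T * sigma ^+ 2 * gamma * l < 1 ->
  is_P T sigma gamma l phi P ->
  [/\ strip_continuous 0 T P, strip_continuous 0 T (dt T P),
      strip_continuous 0 T (hodograph_speed T sigma gamma P) &
      forall t, 0 <= t <= T ->
      [/\ forall y : R, is_derive y 1 (P t) (derive1 (P t) y),
          forall y : R, is_derive y 1 (derive1 (P t)) (derive1n 2 (P t) y),
          forall y : R, is_derive y 1 (hodograph_speed T sigma gamma P t)
            (- dt T P t y),
          forall y, 0 < 1 - gamma * sigma ^+ 2 * (T - t) * derive1 (P t) y &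
          forall y, 0 <= hodograph_speed T sigma gamma P t y <= sigma ^+ 2 * l]].
Proof.
move=> T0 s0 g0 l0 Tl HP; have [[dC [cP cPt cp cpp]] _ pde _] := HP.
have sP := within_strip_continuous cP.
have sp := @within_strip_continuous _ _ _ (fun t => derive1 (P t)) cp.
have dP t : 0 <= t <= T -> forall y : R, is_derive y 1 (P t) (derive1 (P t) y).
  move=> tT y; rewrite derive1E; apply: derivableP.
  by have [] := dC t y tT.
have p_bd t : 0 <= t <= T -> forall y, 0 <= derive1 (P t) y <= l.
  by move=> tT y; exact: lipschitz_derive_bounds (is_P_slope HP tT) (dP t tT y).
have c_bd t : 0 <= t <= T -> forall y,
    1 / 2 < 1 - gamma * sigma ^+ 2 * (T - t) * derive1 (P t) y.
  move=> tT y; have [/andP[a0 _] al] := hodograph_slope_lt T0 s0 g0 l0 Tl tT.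
  have /andP[_ pl] := p_bd t tT y.
  have := ler_wpM2l a0 pl; lra.
split.
- exact: sP.
- exact: (@within_strip_continuous _ _ _ (dt T P) cPt).
- move=> tn xn t x tnT tT tnt xnx.
  have pn := sp tn xn t x tnT tT tnt xnx; rewrite /= in pn.
  have c0 := c_bd t tT x.
  have ic : (2 * (1 - gamma * sigma ^+ 2 * (T - tn n)
        * derive1 (P (tn n)) (xn n)))^-1 @[n --> \oo] -->
      (2 * (1 - gamma * sigma ^+ 2 * (T - t) * derive1 (P t) x))^-1.
    apply: cvgV; last by take_limit.
    by rewrite gt_eqF//; lra.
  by rewrite /hodograph_speed; take_limit.
- move=> t tT.
have dp (y : R) : is_derive y 1 (derive1 (P t)) (derive1n 2 (P t) y).
  rewrite [derive1n 2 _ _]derive1E; apply: derivableP.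
  by have [] := dC t y tT.
split.
- exact: dP.
- exact: dp.
- move=> y; have ? := dp y; have c0 := c_bd t tT y.
  have c2 : 0 < 1 - gamma * sigma ^+ 2 * (T - t) * derive1 (P t) y by lra.
  rewrite /hodograph_speed; differentiate.
    by rewrite mulf_neq0// gt_eqF.
  have := pde t y tT; set D := dt _ _ _ _ => /eqP; rewrite addr_eq0 => /eqP ->.
  by rewrite opprK; field; rewrite gt_eqF.
- by move=> y; have := c_bd t tT y; lra.
- move=> y; have c0 := c_bd t tT y; have /andP[h0 h1] := p_bd t tT y.
  rewrite /hodograph_speed; set c := 1 - _ in c0 *.
  have c20 : 0 < 2 * c by lra.
  have s20 : 0 <= sigma ^+ 2 by exact: sqr_ge0.
  apply/andP; split.
    by rewrite divr_ge0 ?(ltW c20)//; exact: mulr_ge0.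
  rewrite ler_pdivrMr// -[leRHS]mulrA; apply: ler_wpM2l => //.
  by apply: (le_trans h1); rewrite ler_peMr ?(ltW l0)//; lra.
Qed.

(** The potential is M(t, x) = antiderivative g x + integral over [t, T] of the
    speed at x. Differentiating under the integral replaces the speed by - P_t,
    whose integral is P(t, x) - P(T, x), and P(T, x) = g x; so M_xi = P.
    At (0, 0) the potential is the first integral in the definition of Gamma. *)
Lemma is_P_hodograph (R : realType) (T sigma gamma l : R) (g : R -> R)
    (P : R -> R -> R) :
  0 < T -> 0 < sigma -> 0 < gamma -> 0 < l -> 2 * T * sigma ^+ 2 * gamma * l < 1 ->
  continuous g -> is_P T sigma gamma l (antiderivative g) P ->
  exists M, [/\ hodograph T sigma gamma l P M (fun t => derive1 (P t))
      (fun t => derive1n 2 (P t)) (dt T P),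
    forall x, M T x = antiderivative g x &
    Gam T sigma gamma P 0 0 = hodograph_value T sigma gamma P M 0 0].
Proof.
move=> T0 s0 g0 l0 Tl cg HP.
have [sP sPt sq H] := is_P_derivatives T0 s0 g0 l0 Tl HP.
pose q := hodograph_speed T sigma gamma P.
(* The speed, extended to all times. *)
pose qc x s := q (clamp T s) x.
have T0' := ltW T0.
have cqc x : continuous (qc x) by exact: strip_continuous_clamp.
pose A x := antiderivative (qc x).
have dA x (s : R) : is_derive s 1 (A x) (qc x s).
  exact: is_derive_antiderivative.
have AI x a b : a <= b ->
    \int[lebesgue_measure]_(s in `[a, b]) qc x s = A x b - A x a.
  move=> ab; apply: Rintegral_FTC2 => //.
  exact/continuous_subspaceT/(is_derive_continuous (dA x)).
pose M t x := antiderivative g x + (A x T - A x t).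
have cl s : 0 <= clamp T s <= T by exact: clamp_itv.
have dM t : 0 <= t <= T -> forall x : R, is_derive x 1 (M t) (P t x).
  move=> tT x; have /andP[t0 tT1] := tT.
  have [C C0 HC] := strip_continuous_bounded (`|x| + 1) sPt.
  have xx : [set` `]x - 1, x + 1[] x by rewrite /= in_itv/=; lra.
  have yx y : [set` `]x - 1, x + 1[] y -> `|y| <= `|x| + 1.
    rewrite /= in_itv/= => yx; rewrite -[y](subrK x) (le_trans (ler_normD _ _))//.
    by rewrite addrC lerD2l ler_norml; lra.
  have C0' (s : R) : 0 <= cst C s by [].
  have mI : measurable (`[t, T] : set R) by exact: measurable_itv.
  have iq y : [set` `]x - 1, x + 1[] y -> lebesgue_measure.-integrable `[t, T]
      (EFin \o qc y).
    by move=> _; exact: continuous_integrable_itv.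
  have dq (y s : R) : is_derive y 1 (fun y => qc y s) (- dt T P (clamp T s) y).
    by have [_ _ d _ _] := H _ (cl s); exact: d.
  have dq1 y s : [set` `]x - 1, x + 1[] y -> `[t, T]%classic s ->
      derivable (fun y => qc y s) y 1.
    by move=> _ _; have [] := dq y s.
  have dqE y s : partial1of2 qc y s = - dt T P (clamp T s) y.
    by rewrite partial1of2E; have ? := dq y s; exact: derive_val.
  have ub y s : [set` `]x - 1, x + 1[] y -> `[t, T]%classic s ->
      `|partial1of2 qc y s| <= cst C s.
    by move=> /yx yx1 _; rewrite dqE normrN; exact: HC.
  have iC : lebesgue_measure.-integrable `[t, T] (EFin \o cst C).
    by apply: continuous_integrable_itv => z; exact: cvg_cst.
  have D := @derivable_under_integral _ _ _ lebesgue_measure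
    qc `[t, T] mI _ _ _ xx iq dq1 _ C0' iC ub.
  have V := @differentiation_under_integral _ _ _ lebesgue_measure
    qc `[t, T] mI _ _ _ xx iq dq1 _ C0' iC ub.
  have cPt := @strip_continuous_clamp _ T x _ T0' sPt.
  have cP := @strip_continuous_clamp _ T x _ T0' sP.
  have I2 : \int[lebesgue_measure]_(s in `[t, T]) (- dt T P (clamp T s) x) =
      - P (clamp T T) x - (- P (clamp T t) x).
    apply: (@Rintegral_FTC2 _ (fun s => - P (clamp T s) x)
      (fun s => - dt T P (clamp T s) x)) => //.
    - by move=> s; apply: cvgN; exact: cPt.
    - by apply: continuous_subspaceT => s; apply: cvgN; exact: cP.
    - move=> s /andP[ts sT]; have sT' : 0 < s < T by rewrite (le_lt_trans t0 ts).
      have [[dC _] _ _ _] := HP.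
      have sT'' : 0 <= s <= T by rewrite !ltW// (le_lt_trans t0 ts).
      have [d1 _ _] := dC s x sT''.
      have := is_derive_clamp sT' (dt_is_derive sT' d1).
      by rewrite (clamp_id sT'') => ?; differentiate.
  have dI : is_derive x 1 (fun y => A y T - A y t) (P t x - P T x).
    have -> : (fun y => A y T - A y t) =
        (fun y => \int[lebesgue_measure]_(s in `[t, T]) qc y s).
      by apply/funext => y; rewrite AI.
    apply: DeriveDef; first exact: D.
    rewrite -derive1E V; apply: etrans (etrans I2 _).
      by apply: eq_Rintegral => s _; exact: dqE.
    by rewrite !clamp_id ?lexx ?T0'//; ring.
  have dg := is_derive_antiderivative x cg.
  have PT : P T x = g x.
    have [_ _ _ ->] := HP; rewrite derive1E; exact: derive_val.
  by rewrite /M; differentiate; rewrite PT; ring.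
have AL x a b : `|A x b - A x a| <= sigma ^+ 2 * l * `|b - a|.
  have bd s : 0 <= qc x s <= sigma ^+ 2 * l.
    by have [_ _ _ _ b'] := H _ (cl s); exact: b'.
  have [ab|ab] := leP a b.
    have /andP[h1 h2] := derive_bounds_slope (dA x) bd ab.
    by rewrite !ger0_norm// subr_ge0.
  have /andP[h1 h2] := derive_bounds_slope (dA x) bd (ltW ab).
  by rewrite distrC (distrC b) !ger0_norm// subr_ge0 ltW.
exists M; split.
- split.
  + exact: sP.
  + move=> tn xn t x tnT tT tnt xnx.
    have M1 : M t (xn n) @[n --> \oo] --> M t x.
      by apply: continuous_cvg => //; exact: (is_derive_continuous (dM t tT)).
    (* The speed is bounded, so M is Lipschitz in time uniformly in space. *)
    have M2 : A (xn n) t - A (xn n) (tn n) @[n --> \oo] --> 0.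
      apply: norm_cvg0.
      have b0 : sigma ^+ 2 * l * `|t - tn n| @[n --> \oo] --> 0.
        rewrite (_ : 0 = sigma ^+ 2 * l * `|t - t|); first by take_limit.
        by rewrite subrr normr0 mulr0.
      apply: (@squeeze_cvgr _ _ _ _ (cst 0) _ _ _ _ _ b0).
        by apply: nearW => n /=; rewrite normr_ge0 AL.
      exact: cvg_cst.
    have -> : (fun n => M (tn n) (xn n)) =
        (fun n => M t (xn n) + (A (xn n) t - A (xn n) (tn n))).
      by apply/funext => n; rewrite /M; ring.
    by rewrite -[M t x]addr0; apply: cvgD.
  + exact: sPt.
  + by move=> t tT; exact: is_P_slope HP tT.
  + by move=> t tT; have [] := H t tT.
  + by move=> t tT; have [] := H t tT.
  + move=> t tT y; apply: dt_is_derive => //.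
    by have [[dC _] _ _ _] := HP; have [] := dC t y; rewrite ?ltW//; case/andP: tT.
  + exact: dM.
  + move=> t tT y; have ? := dA y t.
    have tT' : 0 <= t <= T by case/andP: tT => *; rewrite !ltW.
    rewrite /M; differentiate.
    by rewrite /qc clamp_id// /q /hodograph_speed; ring.
- by move=> x; rewrite /M subrr addr0.
rewrite /Gam /hodograph_value /M subr0 antiderivative0 add0r.
rewrite /oriented_integral T0' lexx set_itv1 Rintegral_set1 addr0.
apply: (congr1 (fun y => y - gamma * sigma ^+ 2 * T / 2 * P 0 0 ^+ 2)).
rewrite -(AI 0 0 T T0'); apply: eq_Rintegral => s.
by rewrite inE/= in_itv/= => sT; rewrite /qc clamp_id.
Qed.

(** * The terminal weight *)

(** Second-order expansion at 0 of a function whose second derivative lies between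
    0 and l. *)
Lemma antiderivative_bounds (R : realType) (l : R) (g : R -> R) (x : R) :
  X_l l g -> g 0 * x <= antiderivative g x <= g 0 * x + l / 2 * x ^+ 2.
Proof.
move=> gX; have Hg := X_l_bounds gX; have cg := X_l_continuous gX.
pose A := antiderivative g.
have dA (y : R) : is_derive y 1 A (g y) by exact: is_derive_antiderivative.
have A0 : A 0 = 0 by exact: antiderivative0.
have h1 : A 0 - g 0 * 0 <= A x - g 0 * x.
  apply: (@ge0_min_at_0 _ (fun y => A y - g 0 * y) (fun y => g y - g 0)).
  - by move=> y; have ? := dA y; differentiate; ring.
  - by move=> y y0; case/andP: (Hg _ _ y0).
  - by move=> y y0; case/andP: (Hg _ _ y0); lra.
have h2 : g 0 * 0 + l / 2 * 0 ^+ 2 - A 0 <= g 0 * x + l / 2 * x ^+ 2 - A x.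
  apply: (@ge0_min_at_0 _ (fun y => g 0 * y + l / 2 * y ^+ 2 - A y)
    (fun y => g 0 + l * y - g y)).
  - by move=> y; have ? := dA y; differentiate; field.
  - by move=> y y0; case/andP: (Hg _ _ y0); lra.
  - by move=> y y0; case/andP: (Hg _ _ y0); lra.
rewrite A0 !(mulr0, expr0n)/= ?mulr0 in h1 h2.
rewrite -/A; lra.
Qed.

Definition terminal_weight {R : realType} (gamma : R) (g : R -> R) (x : R) : R :=
  expR (gamma * antiderivative g x).

Lemma terminal_weight_continuous (R : realType) (gamma : R) (g : R -> R) :
  continuous g -> continuous (terminal_weight gamma g).
Proof.
move=> cg; apply: (@is_derive_continuous _ _
  (fun x => terminal_weight gamma g x * (gamma * g x))) => x.
have ? := is_derive_antiderivative x cg.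
by rewrite /terminal_weight; differentiate; ring.
Qed.

Lemma terminal_weight_bound (R : realType) (gamma l K : R) (g : R -> R) (x : R) :
  0 < gamma -> X_l l g -> `|g 0| <= K ->
  `|terminal_weight gamma g x| <=
    expR (gamma * K * `|x| + gamma * l / 2 * x ^+ 2).
Proof.
move=> g0 gX gK; rewrite ger0_norm ?expR_ge0// ler_expR.
have /andP[_ h] := antiderivative_bounds x gX.
have h1 : g 0 * x <= K * `|x|.
  by rewrite (le_trans (ler_norm _))// normrM ler_wpM2r.
have h2 := ler_wpM2l (ltW g0) h; have h3 := ler_wpM2l (ltW g0) h1.
lra.
Qed.

(** A continuous function positive at one point is bounded below by a positive
    constant on a whole interval. *)
Lemma Rintegral_gt0 (R : realType) (h : R -> R) (x0 : R) :
  continuous h -> (forall x, 0 <= h x) -> 0 < h x0 ->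
  lebesgue_measure.-integrable setT (EFin \o h) ->
  0 < \int[lebesgue_measure]_x h x.
Proof.
move=> ch h0 hx0 ih.
have h2 : 0 < h x0 / 2 by rewrite divr_gt0.
have h21 : h x0 / 2 < h x0 by lra.
have [e e0 He] : exists2 e, 0 < e & forall y, x0 <= y <= x0 + e -> h x0 / 2 <= h y.
  have := cvgr_gt _ (ch x0) _ h21.
  move=> [/= e e0 He]; exists (e / 2); first by rewrite divr_gt0.
  move=> y /andP[y1 y2]; apply/ltW/He => /=.
  by rewrite distrC ger0_norm ?subr_ge0//; lra.
have mI : measurable (`[x0, x0 + e] : set R) by exact: measurable_itv.
have ic : lebesgue_measure.-integrable `[x0, x0 + e]
    (EFin \o cst (h x0 / 2)).
  by apply: continuous_integrable_itv => y; exact: cvg_cst.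
apply: (@lt_le_trans _ _
    (\int[lebesgue_measure]_(x in `[x0, x0 + e]) cst (h x0 / 2) x)).
  rewrite Rintegral_cst// /= lebesgue_measure_itv/= lte_fin ltrDl e0.
  by rewrite -EFinD/= addrC addKr mulr_gt0.
rewrite Rintegral_mkcond; apply: le_Rintegral => //.
  have := (@integrable_mkcond _ _ _ lebesgue_measure `[x0, x0 + e]
    (EFin \o cst (h x0 / 2)) mI).1 ic.
  by rewrite restrict_EFin.
move=> y _; rewrite patchE; case: ifPn => // /set_mem; rewrite /= in_itv/=.
exact: He.
Qed.

(** * Expectations of functions of Brownian motion *)

(** By uniqueness of densities the Radon-Nikodym derivative of the normal law is
    its density almost everywhere. *)
Lemma ge0_integral_normal_prob (R : realType) (m s : R) (f : _ -> \bar R) :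
  measurable_fun setT f -> (forall x, (0 <= f x)%E) ->
  (\int[normal_prob m s]_x f x =
   \int[lebesgue_measure]_x (f x * (normal_pdf m s x)%:E))%E.
Proof.
move=> mf f0; have dom := @normal_prob_dominates R m s.
rewrite -(Radon_Nikodym_SigmaFinite.change_of_variables dom)//.
have mp : measurable_fun [set: R] (fun x => (normal_pdf m s x)%:E).
  by apply/measurable_EFinP; exact: measurable_normal_pdf.
have iRN := Radon_Nikodym_SigmaFinite.f_integrable dom.
apply: ae_eq_integral => //.
- by apply: emeasurable_funM => //; exact: measurable_int iRN.
- exact: emeasurable_funM.
apply: ae_eqe_mul2l; apply: integral_ae_eq => //= A _ mA.
by rewrite -(Radon_Nikodym_SigmaFinite.f_integral dom).
Qed.

(** Only the law of the single increment B T - B 0 matters. *)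
Lemma brownian_integral (R : realType) (d : measure_display)
    (Omega : measurableType d) (Pr : probability Omega R)
    (B : R -> {RV Pr >-> R}) (T : R) (h : R -> R) :
  0 < T -> brownian_motion B -> continuous h -> (forall x, 0 <= h x) ->
  (\int[Pr]_w (h (B T w))%:E =
   \int[lebesgue_measure]_x (h x * normal_pdf 0 (Num.sqrt T) x)%:E)%E.
Proof.
move=> T0 [B0 _ Bincr _] ch h0.
have mh : measurable_fun [set: R] h by exact: continuous_measurable_fun.
have mX : measurable_fun [set: Omega] (fun w => B T w - B 0 w).
  by apply: measurable_funB.
(* The same map, seen in the Borel space on which [normal_prob] is defined. *)
pose X (w : Omega) : R := B T w - B 0 w.
have mX' : @measurable_fun _ _ Omega (measurableTypeR R)
  [set: Omega] X by exact: mX.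
transitivity (\int[Pr]_w (h (X w))%:E)%E.
  apply: ge0_ae_eq_integral => //.
  - by apply/measurable_EFinP; exact: measurableT_comp.
  - by apply/measurable_EFinP; exact: (measurableT_comp mh mX).
  - by move=> w _; rewrite lee_fin.
  - by move=> w _; rewrite lee_fin.
  - by apply: filterS B0 => w /= w0 _; rewrite /X/= w0 subr0.
have mEh : @measurable_fun _ _ (measurableTypeR R) _
    setT (EFin \o h) by apply/measurable_EFinP; exact: mh.
have h0E : {in [set: R], forall y, (0 <= (EFin \o h) y)%E}.
  by move=> y _; rewrite lee_fin.
have := ge0_integral_pushforward mX' Pr measurableT mEh h0E.
rewrite preimage_setT => <-.
transitivity (\int[normal_prob 0 (Num.sqrt T)]_x (EFin \o h) x)%E.
  apply: eq_measure_integral => A mA _.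
  by have := Bincr 0 T A (lexx _) T0 mA; rewrite subr0.
by rewrite ge0_integral_normal_prob.
Qed.

(** * The function G as a heat integral *)

Lemma G_integrand_continuous (R : realType) (T sigma gamma z : R) (g : R -> R) :
  continuous g -> continuous (G_integrand T sigma gamma g z).
Proof.
move=> cg; pose w := fun y => z + y.
apply: (@is_derive_continuous _ _ (fun y => G_integrand T sigma gamma g z y *
  (gamma * g (z + y) - 2 * y / (2 * sigma ^+ 2 * T)))) => y.
have d1 := is_derive_antiderivative (z + y) cg.
have d2 : is_derive y 1 (fun y => z + y) 1 by differentiate; ring.
have d3 := is_derive_compE d1 d2.
by rewrite /G_integrand; differentiate; ring.
Qed.

(** The potential antiderivative g contributes at most gamma l y^2 / 2 to the
    exponent, less than y^2 / (2 sigma^2 T). *)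
Lemma G_integrand_integrable (R : realType) (T sigma gamma l z : R) (g : R -> R) :
  0 < T -> 0 < sigma -> 0 < gamma -> 0 < l -> 2 * T * sigma ^+ 2 * gamma * l < 1 ->
  X_l l g ->
  lebesgue_measure.-integrable setT (EFin \o G_integrand T sigma gamma g z).
Proof.
move=> T0 s0 g0 l0 Tl gX.
have cg := X_l_continuous gX.
pose s := sigma ^+ 2 * T; have sE : 2 * sigma ^+ 2 * T = 2 * s by rewrite /s mulrA.
have s_gt0 : 0 < s by rewrite mulr_gt0// exprn_gt0.
pose c := gamma * l / 2.
have c0 : 0 <= c by rewrite divr_ge0// mulr_ge0// ltW.
have cs : 0 < 1 / (2 * s) - c.
  by rewrite subr_gt0 ltr_pdivlMr ?mulr_gt0// /c /s; lra.
pose A := gamma * `|g 0|; have A0 : 0 <= A by rewrite mulr_ge0// ltW.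
apply: (@integrable_le_gauss _ _ (z ^+ 2 / (2 * s) + A * `|z| + c * z ^+ 2)
  (A + 2 * c * `|z|) _ cs); first exact: G_integrand_continuous.
move=> y; rewrite ger0_norm ?expR_ge0// ler_expR sE.
have := terminal_weight_bound (z + y) g0 gX (lexx _).
rewrite ger0_norm ?expR_ge0// ler_expR -/A -/c => h.
have h1 := ler_wpM2l A0 (ler_normD z y).
have h2 : (z + y) ^+ 2 <= z ^+ 2 + 2 * (`|z| * `|y|) + y ^+ 2.
  have : z * y <= `|z| * `|y| by rewrite -normrM ler_norm.
  by rewrite sqrrD; lra.
have h3 := ler_wpM2l c0 h2.
have -> : y ^+ 2 / (2 * s) = 1 / (2 * s) * y ^+ 2 by rewrite div1r mulrC.
lra.
Qed.

Lemma weight_heat_integrable (R : realType) (T sigma gamma l z : R) (g : R -> R) :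
  0 < T -> 0 < sigma -> 0 < gamma -> 0 < l -> 2 * T * sigma ^+ 2 * gamma * l < 1 ->
  X_l l g ->
  lebesgue_measure.-integrable setT (EFin \o (fun y =>
    terminal_weight gamma g (z + Num.sqrt (sigma ^+ 2 * T) * y)
    * normal_pdf 0 1 y)).
Proof.
move=> T0 s0 g0 l0 Tl gX; have cg := X_l_continuous gX.
have A0 : 0 <= gamma * `|g 0| by rewrite mulr_ge0// ltW.
have c0 : 0 <= gamma * l / 2 by rewrite divr_ge0// mulr_ge0// ltW.
apply: (heat_integrable _ A0 c0).
- exact: terminal_weight_continuous.
- by move=> x; exact: terminal_weight_bound gX _.
- by rewrite mulr_ge0 ?sqr_ge0// ltW.
- lra.
Qed.

(** Substitution y = sqrt(s) u in the definition of G, which turns the Gaussian of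
    variance s = sigma^2 T into the standard one. *)
Lemma G_heat (R : realType) (T sigma gamma l z : R) (g : R -> R) :
  0 < T -> 0 < sigma -> 0 < gamma -> 0 < l -> 2 * T * sigma ^+ 2 * gamma * l < 1 ->
  X_l l g ->
  G T sigma gamma g z = expR (z ^+ 2 / (2 * sigma ^+ 2 * T)) *
    heat (terminal_weight gamma g) (sigma ^+ 2 * T) z.
Proof.
move=> T0 s0 g0 l0 Tl gX; have cg := X_l_continuous gX.
have iH := weight_heat_integrable z T0 s0 g0 l0 Tl gX.
set s := sigma ^+ 2 * T in iH *.
have sE : 2 * sigma ^+ 2 * T = 2 * s by rewrite /s mulrA.
have s_gt0 : 0 < s by rewrite mulr_gt0// exprn_gt0.
have a0 : 0 < Num.sqrt s by rewrite sqrtr_gt0.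
rewrite /G -(@Rintegral_affine _ _ _ 0 a0); last first.
- by move=> y; exact: expR_ge0.
- exact: G_integrand_continuous.
have Npos : 0 < normal_peak (1 : R) by exact: std_normal_peak_gt0.
have NE : Num.sqrt (2 * pi * sigma ^+ 2 * T) = Num.sqrt s / normal_peak 1.
  rewrite /normal_peak invrK expr1n mul1r -(mulr_natl pi) -sqrtrM ?(ltW s_gt0)//.
  by congr Num.sqrt; rewrite /s; ring.
pose k := expR (z ^+ 2 / (2 * s)) * (Num.sqrt s / normal_peak 1).
have E y : G_integrand T sigma gamma g z (0 + Num.sqrt s * y) * Num.sqrt s =
    k * (terminal_weight gamma g (z + Num.sqrt s * y) * normal_pdf 0 1 y).
  rewrite /G_integrand /terminal_weight add0r sE exprMn sqr_sqrtr ?(ltW s_gt0)//.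
  rewrite std_normal_pdfE.
  have -> : s * y ^+ 2 / (2 * s) = y ^+ 2 / 2 by field; rewrite gt_eqF.
  rewrite !expRD /k; field.
  by rewrite gt_eqF.
under eq_Rintegral do rewrite E.
rewrite RintegralZl// NE sE -/s /k /heat.
by field; rewrite !gt_eqF.
Qed.

(** The law of B T has standard deviation sqrt T; scaling it by sigma gives the
    Gaussian of variance sigma^2 T in the heat integral. *)
Lemma G_brownian (R : realType) (T sigma gamma l z : R) (g : R -> R)
    (d : measure_display) (Omega : measurableType d) (Pr : probability Omega R)
    (B : R -> {RV Pr >-> R}) :
  0 < T -> 0 < sigma -> 0 < gamma -> 0 < l -> 2 * T * sigma ^+ 2 * gamma * l < 1 ->
  X_l l g -> brownian_motion B ->
  (G T sigma gamma g z)%:E =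
  ('E_Pr[fun w => expR (z ^+ 2 / (2 * sigma ^+ 2 * T)
     + gamma * antiderivative g (z + sigma * B T w))])%E.
Proof.
move=> T0 s0 g0 l0 Tl gX HB; have cg := X_l_continuous gX.
pose h x := expR (z ^+ 2 / (2 * sigma ^+ 2 * T))
  * terminal_weight gamma g (z + sigma * x).
have ch : continuous h.
  move=> x; apply: cvgM; first exact: cvg_cst.
  by apply: continuous_affine_comp; exact: terminal_weight_continuous.
have h0 x : 0 <= h x by rewrite mulr_ge0 ?expR_ge0.
have sT0 : 0 < Num.sqrt T by rewrite sqrtr_gt0.
have sT : Num.sqrt T != 0 by rewrite gt_eqF.
rewrite unlock.
transitivity (\int[Pr]_w (h (B T w))%:E)%E; last first.
  by apply: eq_integral => w _; rewrite /h /terminal_weight -expRD.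
rewrite (brownian_integral T0 HB ch h0).
have iH := weight_heat_integrable z T0 s0 g0 l0 Tl gX.
have chp : continuous (fun x => h x * normal_pdf 0 (Num.sqrt T) x).
  by move=> x; apply: cvgM; [exact: ch|exact: continuous_normal_pdf].
have hp0 x : 0 <= h x * normal_pdf 0 (Num.sqrt T) x.
  by rewrite mulr_ge0// normal_pdf_ge0.
have E x : h (0 + Num.sqrt T * x) * normal_pdf 0 (Num.sqrt T) (0 + Num.sqrt T * x)
    * Num.sqrt T = expR (z ^+ 2 / (2 * sigma ^+ 2 * T)) *
    (terminal_weight gamma g (z + Num.sqrt (sigma ^+ 2 * T) * x)
      * normal_pdf 0 1 x).
  rewrite add0r /h sqrtrM ?sqr_ge0// sqrtr_sqr gtr0_norm// -!mulrA.
  by rewrite normal_pdf_scale.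
rewrite -(@ge0_integral_affine _ (fun x => h x * normal_pdf 0 (Num.sqrt T) x)
  _ 0 sT0)//.
under eq_integral do rewrite E.
rewrite (G_heat z T0 s0 g0 l0 Tl gX) /heat -RintegralZl//.
by rewrite /Rintegral fineK// integrable_fin_num//; exact: integrableZl iH.
Qed.

(** * Convexity and bounds of G *)

(** Expanding (x - z)^2 in the kernel cancels exp (z^2 / (2 s)) and leaves z only
    in the factor exp (x z / s): G is a Laplace transform of a positive function,
    hence convex. *)
Lemma G_laplace (R : realType) (T sigma gamma l z : R) (g : R -> R) :
  0 < T -> 0 < sigma -> 0 < gamma -> 0 < l -> 2 * T * sigma ^+ 2 * gamma * l < 1 ->
  X_l l g ->
  let s := sigma ^+ 2 * T in
  let L x := terminal_weight gamma g x *
    (normal_peak 1 * expR (x * z / s - (x ^+ 2 / (2 * s) + ln s / 2))) in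
  lebesgue_measure.-integrable setT (EFin \o L) /\
  G T sigma gamma g z = \int[lebesgue_measure]_x L x.
Proof.
move=> T0 s0 g0 l0 Tl gX s L; have cg := X_l_continuous gX.
have s_gt0 : 0 < s by rewrite mulr_gt0// exprn_gt0.
have A0 : 0 <= gamma * `|g 0| by rewrite mulr_ge0// ltW.
have fle x := terminal_weight_bound x g0 gX (lexx _).
have cs : 0 < 1 / (2 * (2 * s)) - gamma * l / 2.
  by rewrite subr_gt0 ltr_pdivlMr ?mulr_gt0// /s; lra.
have LE x : L x = expR (z ^+ 2 / (2 * s)) *
    (terminal_weight gamma g x * (1 * heat_kernel s z x)).
  rewrite /L /heat_kernel.
  have -> : expR (x * z / s - (x ^+ 2 / (2 * s) + ln s / 2)) =
      expR (z ^+ 2 / (2 * s)) * expR (- (x - z) ^+ 2 / (2 * s) - ln s / 2).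
    by rewrite -expRD; congr expR; field; rewrite gt_eqF.
  ring.
have iK : lebesgue_measure.-integrable setT (EFin \o
    (fun x => terminal_weight gamma g x * (1 * heat_kernel s z x))).
  have v10 : 0 < s / 2 by rewrite divr_gt0.
  have vv : s / 2 < s < 2 * s by lra.
  have v1v : s / 2 < s by lra.
  have := fun x => let: And4 B0 _ _ _ := heat_weight_bounds x v10 v1v (lexx `|z|) in
    heat_kernel_dom A0 fle v10 vv (lexx `|z|) B0.
  move/(integrable_le_gauss cs); apply => x.
  apply: cvgM; first exact: terminal_weight_continuous.
  by apply: cvgM; [exact: cvg_cst|exact: heat_kernel_continuous].
rewrite (funext LE); split; first exact: integrableZl iK.
rewrite (G_heat z T0 s0 g0 l0 Tl gX) RintegralZl// -mulrA -/s.
congr (_ * _); rewrite heatE//.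
- by apply: eq_Rintegral => x _; rewrite mul1r.
- exact: terminal_weight_continuous.
- by move=> x; exact: expR_ge0.
Qed.

(** The strict tangent inequality 1 + u < exp u at the barycentre. *)
Lemma expR_strictly_convex (R : realType) (th u v : R) : 0 < th < 1 -> u != v ->
  expR ((1 - th) * u + th * v) < (1 - th) * expR u + th * expR v.
Proof.
move=> /andP[th0 th1] uv; set m := _ + th * v.
have um : u - m != 0.
  rewrite /m (_ : _ - _ = th * (u - v)); last by ring.
  by apply: mulf_neq0; rewrite ?subr_eq0// gt_eqF.
have h1 := expR_gt1Dx um; have h2 := expR_ge1Dx (v - m).
have th1' : 0 < 1 - th by lra.
have h3 : (1 - th) * (1 + (u - m)) < (1 - th) * expR (u - m) by rewrite ltr_pM2l.
have h4 := ler_wpM2l (ltW th0) h2.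
have h5 : 1 < (1 - th) * expR (u - m) + th * expR (v - m).
  by apply: (le_lt_trans _ (ltr_leD h3 h4)); rewrite /m le_eqVlt;
    apply/orP; left; apply/eqP; ring.
have := h5; rewrite -(@ltr_pM2r _ (expR m)) ?expR_gt0// mul1r mulrDl -!mulrA.
by rewrite -!expRD !subrK.
Qed.

(** The integrand of the Laplace transform is convex in z for every x, and
    strictly so at x = 1. *)
Lemma G_strictly_convex (R : realType) (T sigma gamma l th u v : R) (g : R -> R) :
  0 < T -> 0 < sigma -> 0 < gamma -> 0 < l -> 2 * T * sigma ^+ 2 * gamma * l < 1 ->
  X_l l g -> 0 < th < 1 -> u != v ->
  G T sigma gamma g ((1 - th) * u + th * v) <
  (1 - th) * G T sigma gamma g u + th * G T sigma gamma g v.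
Proof.
move=> T0 s0 g0 l0 Tl gX th01 uv; have cg := X_l_continuous gX.
pose s := sigma ^+ 2 * T.
have s_gt0 : 0 < s by rewrite mulr_gt0// exprn_gt0.
pose L z x := terminal_weight gamma g x *
  (normal_peak 1 * expR (x * z / s - (x ^+ 2 / (2 * s) + ln s / 2))).
have LP z : lebesgue_measure.-integrable setT (EFin \o L z) /\
    G T sigma gamma g z = \int[lebesgue_measure]_x L z x.
  exact: (G_laplace z T0 s0 g0 l0 Tl gX).
pose m := (1 - th) * u + th * v.
have [iu Gu] := LP u; have [iv Gv] := LP v; have [im Gm] := LP m.
have i1 := integrableZl measurableT (1 - th) iu.
have i2 := integrableZl measurableT th iv.
have i3 := integrableD measurableT i1 i2.
rewrite -/m Gu Gv Gm -RintegralZl// -RintegralZl// -RintegralD//.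
rewrite -subr_gt0 -RintegralB//.
pose w x := terminal_weight gamma g x *
  (normal_peak 1 * expR (- (x ^+ 2 / (2 * s) + ln s / 2))).
have w0 x : 0 < w x by rewrite !mulr_gt0 ?expR_gt0// std_normal_peak_gt0.
have E x : (1 - th) * L u x + th * L v x - L m x = w x *
    ((1 - th) * expR (x * u / s) + th * expR (x * v / s)
     - expR ((1 - th) * (x * u / s) + th * (x * v / s))).
  rewrite /L /w.
  have -> : x * m / s =
      (1 - th) * (x * u / s) + th * (x * v / s) by rewrite /m; field; rewrite gt_eqF.
  by rewrite !expRD; ring.
apply: (@Rintegral_gt0 _ _ 1).
- have cw z : continuous (L z).
    move=> x; apply: cvgM; first exact: terminal_weight_continuous.
    by take_limit.
  move=> x; apply: cvgB; last exact: cw.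
  by apply: cvgD; apply: cvgM; [exact: cvg_cst|exact: cw|exact: cvg_cst|exact: cw].
- move=> x; rewrite E mulr_ge0 ?(ltW (w0 _))// subr_ge0.
  have [xe|xe] := eqVneq (x * u / s) (x * v / s).
    by rewrite xe -!mulrDl subrK !mul1r.
  exact/ltW/expR_strictly_convex.
- rewrite E pmulr_rgt0// subr_gt0; apply: expR_strictly_convex => //.
  by rewrite !mul1r; apply: contra uv => /eqP /(mulIf (invr_neq0 (lt0r_neq0 s_gt0))) ->.
- by have := integrableB measurableT i3 im.
Qed.

(** The convex function antiderivative g lies above its tangent g 0 x at 0, and
    the Gaussian integral of exp (gamma g(0) x) is explicit. *)
Lemma G_lower (R : realType) (T sigma gamma l z : R) (g : R -> R) :
  0 < T -> 0 < sigma -> 0 < gamma -> 0 < l -> 2 * T * sigma ^+ 2 * gamma * l < 1 ->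
  X_l l g ->
  expR ((z + sigma ^+ 2 * T * gamma * g 0) ^+ 2 / (2 * (sigma ^+ 2 * T))) <=
  G T sigma gamma g z.
Proof.
move=> T0 s0 g0 l0 Tl gX; rewrite (G_heat z T0 s0 g0 l0 Tl gX).
have iH := weight_heat_integrable z T0 s0 g0 l0 Tl gX.
set s := sigma ^+ 2 * T in iH *.
have s_gt0 : 0 < s by rewrite mulr_gt0// exprn_gt0.
have -> : 2 * sigma ^+ 2 * T = 2 * s by rewrite /s mulrA.
(* The tangent weight tilts the standard normal law to the mean b. *)
set b := gamma * g 0 * Num.sqrt s.
have b2 : b ^+ 2 = (gamma * g 0) ^+ 2 * s by rewrite exprMn sqr_sqrtr// ltW.
pose k := expR (gamma * g 0 * z + b ^+ 2 / 2).
have -> : expR ((z + s * gamma * g 0) ^+ 2 / (2 * s)) =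
    expR (z ^+ 2 / (2 * s)) * k.
  by rewrite /k -expRD b2; congr expR; field; rewrite gt_eqF.
rewrite ler_pM2l ?expR_gt0//.
have -> : k = \int[lebesgue_measure]_y (k * normal_pdf b 1 y).
  rewrite RintegralZl//; last exact: integrable_normal_pdf.
  by rewrite /Rintegral integral_normal_pdf mulr1.
apply: le_Rintegral => //.
  by have := integrableZl measurableT k (integrable_normal_pdf b 1).
move=> y _; rewrite !normal_pdfE ?oner_eq0//= mulrCA [leRHS]mulrCA.
rewrite ler_pM2l ?std_normal_peak_gt0// /k /normal_fun -!expRD ler_expR.
have /andP[h _] := antiderivative_bounds (z + Num.sqrt s * y) gX.
have := ler_wpM2l (ltW g0) h.
rewrite subr0 expr1n !mulNr -(mulr_natl 1) mulr1 /b; nra.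
Qed.

(** The integrand dominates every weight exp (gamma antiderivative g) with
    |g 0| = a. Replacing gamma l / 2 by the larger 1 / (4 sigma^2 T) makes the
    bound independent of l. *)
Definition G_bound {R : realType} (a gamma sigma T : R) : R :=
  heat (fun x => expR (gamma * a * `|x| + 1 / (4 * (sigma ^+ 2 * T)) * x ^+ 2))
    (sigma ^+ 2 * T) 0.

Lemma G_upper (R : realType) (T sigma gamma l : R) (g : R -> R) :
  0 < T -> 0 < sigma -> 0 < gamma -> 0 < l -> 2 * T * sigma ^+ 2 * gamma * l < 1 ->
  X_l l g -> G T sigma gamma g 0 <= G_bound `|g 0| gamma sigma T.
Proof.
move=> T0 s0 g0 l0 Tl gX; rewrite (G_heat 0 T0 s0 g0 l0 Tl gX) /G_bound.
have iH := weight_heat_integrable 0 T0 s0 g0 l0 Tl gX.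
set s := sigma ^+ 2 * T in iH *.
have s_gt0 : 0 < s by rewrite mulr_gt0// exprn_gt0.
rewrite expr0n/= mul0r expR0 mul1r.
have A0 : 0 <= gamma * `|g 0| by rewrite mulr_ge0// ltW.
have c0 : 0 <= 1 / (4 * s) by rewrite divr_ge0// mulr_ge0// ltW.
have iU := @heat_integrable _ (fun x =>
  expR (gamma * `|g 0| * `|x| + 1 / (4 * s) * x ^+ 2)) _ _ s 0 A0 c0 _ _ (ltW s_gt0) _.
apply: le_Rintegral => //.
  apply: iU.
  - by move=> x; take_limit.
  - by move=> x; rewrite ger0_norm ?expR_ge0.
  - by rewrite le_eqVlt; apply/orP; left; apply/eqP; field; rewrite gt_eqF.
move=> y _; rewrite ler_wpM2r ?normal_pdf_ge0//.
have := terminal_weight_bound (0 + Num.sqrt s * y) g0 gX (lexx _).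
rewrite ger0_norm ?expR_ge0// => h; apply: (le_trans h).
rewrite ler_expR lerD2l ler_wpM2r ?sqr_ge0//.
by rewrite ler_pdivlMr ?mulr_gt0// /s; lra.
Qed.

(** * Continuity of G in the data *)

Lemma X_l_growth (R : realType) (l : R) (g : R -> R) (x : R) :
  X_l l g -> `|g x| <= `|g 0| + l * `|x|.
Proof.
move=> /X_l_bounds Hg; rewrite -{1}[g x](subrK (g 0)) addrC.
rewrite (le_trans (ler_normD _ _))// lerD2l.
have [x0|x0] := leP 0 x.
  by have /andP[h1 h2] := Hg _ _ x0; rewrite !ger0_norm//; lra.
have /andP[h1 h2] := Hg _ _ (ltW x0).
by rewrite distrC (ltr0_norm x0) ger0_norm//; lra.
Qed.

Lemma antiderivative_lipschitz (R : realType) (l r x y : R) (g : R -> R) :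
  0 <= l -> X_l l g -> `|x| <= r -> `|y| <= r ->
  `|antiderivative g y - antiderivative g x| <= (`|g 0| + l * r) * `|y - x|.
Proof.
move=> l0 gX; have cg := X_l_continuous gX; set C := `|g 0| + l * r.
wlog xy : x y / x <= y.
  move=> W xr yr; have [xy|yx] := leP x y; first exact: W.
  by rewrite distrC (distrC y); apply: W => //; exact: ltW.
move=> xr yr; rewrite (ger0_norm (_ : 0 <= y - x)) ?subr_ge0//.
have gC z : x < z < y -> `|g z| <= C.
  move=> /andP[xz zy]; apply: (le_trans (X_l_growth z gX)); rewrite lerD2l.
  apply: ler_wpM2l => //; move: xr yr; rewrite !ler_norml.
  by move=> /andP[? ?] /andP[? ?]; apply/andP; split; lra.
have dA (z : R) : is_derive z 1 (antiderivative g) (g z).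
  exact: is_derive_antiderivative.
have h1 : C * x - antiderivative g x <= C * y - antiderivative g y.
  apply: (@derivable_nondecreasing _ (fun z => C * z - antiderivative g z)
    (fun z => C - g z)) => //.
    by move=> z _; have ? := dA z; differentiate; ring.
  by move=> z /gC; rewrite ler_norml subr_ge0 => /andP[].
have h2 : C * x + antiderivative g x <= C * y + antiderivative g y.
  apply: (@derivable_nondecreasing _ (fun z => C * z + antiderivative g z)
    (fun z => C + g z)) => //.
    by move=> z _; have ? := dA z; differentiate; ring.
  by move=> z /gC; rewrite ler_norml => /andP[? _]; lra.
by rewrite ler_norml; lra.
Qed.

(** Locally bounded convergence: |g_n| <= K + l |y|. *)
Lemma antiderivative_cvg (R : realType) (l K x : R) (gn : nat -> R -> R)
    (g : R -> R) :
  0 <= l -> (forall n, X_l l (gn n)) -> X_l l g -> (forall n, `|gn n 0| <= K) ->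
  (forall y, gn n y @[n --> \oo] --> g y) ->
  antiderivative (gn n) x @[n --> \oo] --> antiderivative g x.
Proof.
move=> l0 gnX gX gnK gng.
have main a b : `|a| <= `|x| -> `|b| <= `|x| ->
    \int[lebesgue_measure]_(y in `[a, b]) gn n y @[n --> \oo] -->
    \int[lebesgue_measure]_(y in `[a, b]) g y.
  move=> ax bx.
  apply: (@Rintegral_dominated_cvg _ _ gn g (cst (K + l * `|x|))).
  - exact: measurable_itv.
  - move=> n; apply: measurable_funTS; apply: continuous_measurable_fun.
    exact: X_l_continuous (gnX n).
  - apply: measurable_funTS; apply: continuous_measurable_fun.
    exact: X_l_continuous gX.
  - by apply: aeW => y _.
  - by apply: continuous_integrable_itv => y; exact: cvg_cst.
  move=> n y; rewrite /= in_itv/= => /andP[ay yb].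
  apply: (le_trans (X_l_growth y (gnX n))); apply: lerD => //.
  apply: ler_wpM2l => //; move: ax bx; rewrite !ler_norml.
  by move=> /andP[? ?] /andP[? ?]; apply/andP; split; lra.
rewrite /antiderivative /oriented_integral; case: ifPn => x0.
  by apply: main; rewrite ?normr0.
by apply: cvgN; apply: main; rewrite ?normr0.
Qed.

(** The antiderivatives are Lipschitz on bounded sets uniformly in n, so they may
    be evaluated along convergent points; the Gaussian bound of the weights depends
    on g_n 0 and l only. *)
Lemma G_cvg (R : realType) (T sigma gamma l K z : R) (gn : nat -> R -> R)
    (g : R -> R) (zn : nat -> R) :
  0 < T -> 0 < sigma -> 0 < gamma -> 0 < l -> 2 * T * sigma ^+ 2 * gamma * l < 1 ->
  (forall n, X_l l (gn n)) -> X_l l g -> (forall n, `|gn n 0| <= K) ->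
  (forall y, gn n y @[n --> \oo] --> g y) -> zn n @[n --> \oo] --> z ->
  G T sigma gamma (gn n) (zn n) @[n --> \oo] --> G T sigma gamma g z.
Proof.
move=> T0 s0 g0 l0 Tl gnX gX gnK gng znz.
rewrite (funext (fun n => G_heat (zn n) T0 s0 g0 l0 Tl (gnX n))).
rewrite (G_heat z T0 s0 g0 l0 Tl gX); set s := sigma ^+ 2 * T.
have K0 : 0 <= K by exact: le_trans (gnK 0%N).
have s_ge0 : 0 <= s by rewrite mulr_ge0 ?sqr_ge0// ltW.
have A0 : 0 <= gamma * K by rewrite mulr_ge0// ltW.
have c0 : 0 <= gamma * l / 2 by rewrite divr_ge0// mulr_ge0// ltW.
have [Z [_ HZ]] : bounded_fun zn.
  by apply: cvg_seq_bounded; apply/cvg_ex; exists z.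
have ZZ n : `|zn n| <= Num.max Z 0 + 1.
  by apply: (HZ (Num.max Z 0 + 1)) => //; rewrite ltr_pwDr// le_max lexx.
apply: cvgM; first by take_limit.
apply: (@heat_cvg _ (fun n => terminal_weight gamma (gn n))
  (terminal_weight gamma g) (fun=> s) zn s z (gamma * K) (gamma * l / 2)
  (Num.sqrt s) (Num.max Z 0 + 1)) => //.
- by move=> n; apply: terminal_weight_continuous; exact: X_l_continuous (gnX n).
- by apply: terminal_weight_continuous; exact: X_l_continuous gX.
- by move=> n x; exact: terminal_weight_bound (gnX n) (gnK n).
- by move=> n; rewrite /s; lra.
move=> y; pose x := z + Num.sqrt s * y; pose xn n := zn n + Num.sqrt s * y.
have xnx : xn n @[n --> \oo] --> x by rewrite /xn; take_limit.
(* A common bound for the evaluation points, on which the Lipschitz constants of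
   the antiderivatives are uniform in n. *)
pose r := Num.max Z 0 + 1 + `|z| + `|Num.sqrt s * y|.
have r0 : 0 <= Num.max Z 0 + 1 by rewrite addr_ge0// le_max lexx orbT.
have xr : `|x| <= r.
  by rewrite (le_trans (ler_normD _ _))// /r lerD2r lerDr.
have xnr n : `|xn n| <= r.
  rewrite (le_trans (ler_normD _ _))// /r lerD2r (le_trans (ZZ n))//.
  by rewrite lerDl.
have hA : antiderivative (gn n) (xn n) - antiderivative (gn n) x
    @[n --> \oo] --> 0.
  apply: norm_cvg0.
  have b0 : (K + l * r) * `|xn n - x| @[n --> \oo] --> 0.
    rewrite (_ : 0 = (K + l * r) * `|x - x|); first by take_limit.
    by rewrite subrr normr0 mulr0.
  apply: (@squeeze_cvgr _ _ _ _ (cst 0) _ _ _ _ _ b0); last exact: cvg_cst.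
  apply: nearW => n /=; rewrite normr_ge0/=.
  rewrite (le_trans (antiderivative_lipschitz (ltW l0) (gnX n) xr (xnr n)))//.
  by rewrite ler_wpM2r// lerD2r.
have hB := @antiderivative_cvg _ _ _ x _ _ (ltW l0) gnX gX gnK gng.
rewrite /terminal_weight -/x; apply: cvg_expRE; apply: cvg_mulE.
  exact: cvg_cst.
have -> : (fun n => antiderivative (gn n) (zn n + Num.sqrt s * y)) =
    (fun n => (antiderivative (gn n) (xn n) - antiderivative (gn n) x)
      + antiderivative (gn n) x) by apply/funext => n; rewrite subrK.
by rewrite -[antiderivative g x]add0r; apply: cvgD.
Qed.

Lemma G_continuous (R : realType) (T sigma gamma l : R) (g : R -> R) :
  0 < T -> 0 < sigma -> 0 < gamma -> 0 < l -> 2 * T * sigma ^+ 2 * gamma * l < 1 ->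
  X_l l g -> continuous (G T sigma gamma g).
Proof.
move=> T0 s0 g0 l0 Tl gX z; apply/(@cvg_nbhsP _ R^o) => u uz.
apply: (@G_cvg _ T sigma gamma l `|g 0| z (fun=> g) g u) => //.
by move=> y; exact: cvg_cst.
Qed.

Lemma G_argmin_unique (R : realType) (T sigma gamma l u v : R) (g : R -> R) :
  0 < T -> 0 < sigma -> 0 < gamma -> 0 < l -> 2 * T * sigma ^+ 2 * gamma * l < 1 ->
  X_l l g -> argmin (G T sigma gamma g) u -> argmin (G T sigma gamma g) v -> u = v.
Proof.
move=> T0 s0 g0 l0 Tl gX Hu Hv; apply: contrapT => /eqP uv.
have h : 0 < (1 / 2 : R) < 1 by lra.
pose m := (1 - 1 / 2) * u + 1 / 2 * v.
have hu : G T sigma gamma g u <= G T sigma gamma g m by exact: Hu.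
have hv : G T sigma gamma g v <= G T sigma gamma g m by exact: Hv.
have := G_strictly_convex T0 s0 g0 l0 Tl gX h uv; rewrite -/m.
move: (G _ _ _ _ u) (G _ _ _ _ v) (G _ _ _ _ m) hu hv => a b c; lra.
Qed.

(** Outside a bounded interval the lower bound exceeds G 0, so the minimum over
    that interval is global. *)
Lemma G_argmin_exists (R : realType) (T sigma gamma l : R) (g : R -> R) :
  0 < T -> 0 < sigma -> 0 < gamma -> 0 < l -> 2 * T * sigma ^+ 2 * gamma * l < 1 ->
  X_l l g -> exists z, argmin (G T sigma gamma g) z.
Proof.
move=> T0 s0 g0 l0 Tl gX; pose s := sigma ^+ 2 * T.
have s_gt0 : 0 < s by rewrite mulr_gt0// exprn_gt0.
pose c := s * gamma * g 0; pose G0 := G T sigma gamma g 0.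
(* Chosen so that (z + c)^2 / (2 s) >= G 0 when |z| >= r. *)
pose r := `|c| + 1 + 2 * s * G0.
have G00 : 0 < G0 by apply: lt_le_trans (G_lower 0 T0 s0 g0 l0 Tl gX); exact: expR_gt0.
have sG : 0 < 2 * s * G0 by rewrite mulr_gt0// mulr_gt0.
have r0 : 0 < r by rewrite addr_gt0// ltr_wpDl.
have out z : r <= `|z| -> G0 <= G T sigma gamma g z.
  move=> rz; apply: le_trans (G_lower z T0 s0 g0 l0 Tl gX); rewrite -/s -/c.
  have h1 : 1 + 2 * s * G0 <= `|z + c|.
    have : `|z| <= `|z + c| + `|c|.
      by rewrite -{1}[z](addrK c) (le_trans (ler_normB _ _)).
    rewrite /r in rz; lra.
  have h2 : 2 * s * G0 <= (z + c) ^+ 2.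
    by rewrite -real_normK ?num_real//; nra.
  have h3 : G0 <= (z + c) ^+ 2 / (2 * s) by rewrite ler_pdivlMr ?mulr_gt0//; lra.
  apply: (le_trans h3); apply: le_trans (expR_ge1Dx _); lra.
have rr : - r <= r by lra.
have [|z zr zmin] := @EVT_min _ (G T sigma gamma g) _ _ rr.
  exact/continuous_subspaceT/(G_continuous T0 s0 g0 l0 Tl gX).
exists z => y; have [yr|yr] := leP r `|y|.
  apply: le_trans (out y yr); apply: zmin; rewrite in_itv/=; lra.
by apply: zmin; rewrite in_itv/= -ler_norml ltW.
Qed.

(** * The minimum of G along chi *)

(** Intermediate values: chi has slope at least 1 / 2. *)
Lemma chi_surjective (R : realType) (T sigma gamma l t z : R)
    (P M p pp Pt : R -> R -> R) :
  0 < T -> 0 < sigma -> 0 < gamma -> 0 < l -> 2 * T * sigma ^+ 2 * gamma * l < 1 ->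
  hodograph T sigma gamma l P M p pp Pt -> 0 <= t <= T ->
  exists x, chi T sigma gamma P t x = z.
Proof.
move=> T0 s0 g0 l0 Tl H tT.
have [/andP[a0 _] al] := hodograph_slope_lt T0 s0 g0 l0 Tl tT.
have chiE x : chi T sigma gamma P t x = x - gamma * sigma ^+ 2 * (T - t) * P t x by [].
set a := gamma * sigma ^+ 2 * (T - t) in a0 al chiE.
have step x y : x <= y ->
    chi T sigma gamma P t x + (y - x) / 2 <= chi T sigma gamma P t y.
  move=> xy; have /andP[_ h] := hodograph_slope H tT xy.
  have h1 := ler_wpM2l a0 h; rewrite !chiE.
  have h2 : a * l * (y - x) <= 1 / 2 * (y - x) by apply: ler_wpM2r; lra.
  lra.
have cchi : continuous (chi T sigma gamma P t).
  apply: (@is_derive_continuous _ _ (fun x => 1 - a * p t x)) => x.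
  by have dP := hodograph_dP H tT x; rewrite /chi -/a; differentiate; ring.
pose r := 2 * `|z - chi T sigma gamma P t 0|.
have r0 : 0 <= r by rewrite mulr_ge0.
have up := step 0 r r0; have dn : - r <= 0 by lra.
have {}dn := step _ _ dn.
have rr : - r <= r by lra.
have [|x _ xz] := @IVT _ (chi T sigma gamma P t) _ _ z rr
    (continuous_subspaceT cchi); last by exists x.
have := ler_norm (z - chi T sigma gamma P t 0).
have := ler_norm (- (z - chi T sigma gamma P t 0)); rewrite normrN.
rewrite ge_min le_max /r in up dn *.
move=> h1 h2; apply/andP; split; apply/orP; [left|right]; lra.
Qed.

(** The representations of the value and of G involve the same heat integral,
    taken at the point chi(0, x). *)
Lemma G_along_chi (R : realType) (T sigma gamma l x : R) (g : R -> R)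
    (P M p pp Pt : R -> R -> R) :
  0 < T -> 0 < sigma -> 0 < gamma -> 0 < l -> 2 * T * sigma ^+ 2 * gamma * l < 1 ->
  X_l l g -> hodograph T sigma gamma l P M p pp Pt ->
  (forall x, M T x = antiderivative g x) ->
  G T sigma gamma g (chi T sigma gamma P 0 x) =
  expR (chi T sigma gamma P 0 x ^+ 2 / (2 * sigma ^+ 2 * T) +
    gamma * hodograph_value T sigma gamma P M 0 x).
Proof.
move=> T0 s0 g0 l0 Tl gX H MT.
rewrite (G_heat _ T0 s0 g0 l0 Tl gX) expRD; congr (_ * _).
have A0 : 0 <= gamma * `|g 0| by rewrite mulr_ge0// ltW.
apply/esym/(hodograph_heat _ T0 s0 g0 l0 Tl A0 _ _ _ H).
- by apply: terminal_weight_continuous; exact: X_l_continuous gX.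
- by move=> y; exact: expR_ge0.
- by move=> y; exact: terminal_weight_bound gX _.
- by move=> y; rewrite /terminal_weight MT.
Qed.

(** Along z = chi(0, xi) the logarithm of G has derivative (1 - a P_xi) xi / s,
    because chi / s + gamma P = xi / s when a = gamma s. *)
Lemma is_P_argmin (R : realType) (T sigma gamma l : R) (g : R -> R)
    (P : R -> R -> R) :
  0 < T -> 0 < sigma -> 0 < gamma -> 0 < l -> 2 * T * sigma ^+ 2 * gamma * l < 1 ->
  X_l l g -> is_P T sigma gamma l (antiderivative g) P ->
  argmin (G T sigma gamma g) (chi T sigma gamma P 0 0) /\
  G T sigma gamma g (chi T sigma gamma P 0 0) =
  expR (chi T sigma gamma P 0 0 ^+ 2 / (2 * sigma ^+ 2 * T) +
    gamma * Gam T sigma gamma P 0 0).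
Proof.
move=> T0 s0 g0 l0 Tl gX HP; have cg := X_l_continuous gX.
have [M [H MT ->]] := is_P_hodograph T0 s0 g0 l0 Tl cg HP.
have GE x := G_along_chi x T0 s0 g0 l0 Tl gX H MT.
split=> [z|]; last exact: GE.
have t01 : 0 <= (0 : R) <= T by rewrite lexx ltW.
have [x <-] := chi_surjective z T0 s0 g0 l0 Tl H t01.
rewrite !GE ler_expR.
have [/andP[a0 _] al] := hodograph_slope_lt T0 s0 g0 l0 Tl t01.
have s_gt0 : 0 < sigma ^+ 2 * T by rewrite mulr_gt0// exprn_gt0.
pose p := derive1 (P 0).
(* The derivative of the exponent at y is w y * y. *)
pose w y := (1 - gamma * sigma ^+ 2 * (T - 0) * p y) / (sigma ^+ 2 * T).
have w0 y : 0 <= w y.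
  have /andP[_ pl] := lipschitz_derive_bounds (hodograph_slope H t01)
    (hodograph_dP H t01 y).
  have := ler_wpM2l a0 pl; rewrite -/p => h.
  by apply: divr_ge0; [lra|exact: ltW].
apply: (@ge0_min_at_0 _ (fun y => chi T sigma gamma P 0 y ^+ 2 /
    (2 * sigma ^+ 2 * T) + gamma * hodograph_value T sigma gamma P M 0 y)
    (fun y => w y * y)).
- move=> y; have dP := hodograph_dP H t01 y; have dM := hodograph_dM H t01 y.
  rewrite /chi /hodograph_value; differentiate; rewrite /w /p.
  by field; rewrite !gt_eqF.
- by move=> y y0; rewrite mulr_ge0.
- by move=> y y0; rewrite mulr_ge0_le0.
Qed.

(** * The minimizer of G and its stability *)

Definition G_argmin {R : realType} (T sigma gamma : R) (g : R -> R) : R :=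
  xget 0 (argmin (G T sigma gamma g)).

Lemma G_argminP (R : realType) (T sigma gamma l : R) (g : R -> R) :
  0 < T -> 0 < sigma -> 0 < gamma -> 0 < l -> 2 * T * sigma ^+ 2 * gamma * l < 1 ->
  X_l l g -> argmin (G T sigma gamma g) (G_argmin T sigma gamma g).
Proof.
by move=> T0 s0 g0 l0 Tl gX; exact: xgetPex (G_argmin_exists T0 s0 g0 l0 Tl gX).
Qed.

Lemma G_gt0 (R : realType) (T sigma gamma l z : R) (g : R -> R) :
  0 < T -> 0 < sigma -> 0 < gamma -> 0 < l -> 2 * T * sigma ^+ 2 * gamma * l < 1 ->
  X_l l g -> 0 < G T sigma gamma g z.
Proof.
move=> T0 s0 g0 l0 Tl gX.
exact: lt_le_trans (expR_gt0 _) (G_lower z T0 s0 g0 l0 Tl gX).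
Qed.

Definition G_min_log {R : realType} (T sigma gamma : R) (g : R -> R) : R :=
  ln (G T sigma gamma g (G_argmin T sigma gamma g)) / gamma.

Lemma G_min_logP (R : realType) (T sigma gamma l : R) (g : R -> R) :
  0 < T -> 0 < sigma -> 0 < gamma -> 0 < l -> 2 * T * sigma ^+ 2 * gamma * l < 1 ->
  X_l l g ->
  is_minimum (fun z => ln (G T sigma gamma g z) / gamma) (G_min_log T sigma gamma g).
Proof.
move=> T0 s0 g0 l0 Tl gX; split=> [|z].
  by exists (G_argmin T sigma gamma g); rewrite /G_min_log.
rewrite /G_min_log ler_pM2r; last by rewrite invr_gt0.
have h : G T sigma gamma g (G_argmin T sigma gamma g) <= G T sigma gamma g z.
  exact: G_argminP T0 s0 g0 l0 Tl gX _.
rewrite ler_ln ?posrE; first exact: h.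
- exact: G_gt0 T0 s0 g0 l0 Tl gX.
- exact: G_gt0 T0 s0 g0 l0 Tl gX.
Qed.

(** The bound on |z| obtained from (z + s gamma g 0)^2 / (2 s) <= ln G z
    <= ln G 0, with s = sigma^2 T and [G_bound] above G 0. *)
Definition chi_bound {R : realType} (a gamma sigma T : R) : R :=
  sigma ^+ 2 * T * gamma * `|a| +
  Num.sqrt (2 * (sigma ^+ 2 * T) * ln (G_bound `|a| gamma sigma T)).

Definition Gam_bound {R : realType} (a gamma sigma T : R) : R :=
  ln (G_bound `|a| gamma sigma T) / gamma +
  chi_bound a gamma sigma T ^+ 2 / (2 * sigma ^+ 2 * gamma * T).

(** The lower bound at the minimizer and the upper bound at 0 enclose G z, and
    the former is at least 1. *)
Lemma G_argmin_bounds (R : realType) (T sigma gamma l z : R) (g : R -> R) :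
  0 < T -> 0 < sigma -> 0 < gamma -> 0 < l -> 2 * T * sigma ^+ 2 * gamma * l < 1 ->
  X_l l g -> argmin (G T sigma gamma g) z ->
  `|z| <= chi_bound (g 0) gamma sigma T /\
  0 <= ln (G T sigma gamma g z) <= ln (G_bound `|g 0| gamma sigma T).
Proof.
move=> T0 s0 g0 l0 Tl gX Hz.
have h1 := G_lower z T0 s0 g0 l0 Tl gX.
have h2 : G T sigma gamma g z <= G_bound `|g 0| gamma sigma T.
  exact: le_trans (Hz 0) (G_upper T0 s0 g0 l0 Tl gX).
have Gz := G_gt0 z T0 s0 g0 l0 Tl gX.
have U0 := lt_le_trans Gz h2.
have l1 := h1; rewrite -ler_ln ?posrE ?expR_gt0// expRK in l1.
have l2 := h2; rewrite -ler_ln ?posrE// in l2.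
rewrite /chi_bound; set s := sigma ^+ 2 * T in h1 l1 *.
have s_gt0 : 0 < s by rewrite mulr_gt0// exprn_gt0.
split; last first.
  by rewrite l2 andbT (le_trans _ l1)// divr_ge0 ?sqr_ge0// mulr_ge0// ltW.
have h3 : (z + s * gamma * g 0) ^+ 2 <= 2 * s * ln (G_bound `|g 0| gamma sigma T).
  have := le_trans l1 l2; rewrite ler_pdivrMr ?mulr_gt0//; lra.
have h4 : `|z + s * gamma * g 0| <=
    Num.sqrt (2 * s * ln (G_bound `|g 0| gamma sigma T)).
  by rewrite -sqrtr_sqr ler_sqrt// (le_trans _ h3)// sqr_ge0.
rewrite -{1}[z](addrK (s * gamma * g 0)) (le_trans (ler_normB _ _))//.
by rewrite addrC lerD// normrM ger0_norm// mulr_ge0// ltW.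
Qed.

(** On the ray from z in direction d a strictly convex function that has increased
    at z + d keeps increasing, so the minimizer cannot lie beyond z + d. *)
Lemma G_argmin_near (R : realType) (T sigma gamma l z d r : R) (g : R -> R) :
  0 < T -> 0 < sigma -> 0 < gamma -> 0 < l -> 2 * T * sigma ^+ 2 * gamma * l < 1 ->
  X_l l g -> G T sigma gamma g z < G T sigma gamma g (z + d) ->
  argmin (G T sigma gamma g) (z + r * d) -> r < 1.
Proof.
move=> T0 s0 g0 l0 Tl gX zd Hr; rewrite ltNge; apply/negP => r1.
have hz : G T sigma gamma g (z + r * d) <= G T sigma gamma g z by exact: Hr.
have hd : G T sigma gamma g (z + r * d) <= G T sigma gamma g (z + d) by exact: Hr.
have [re|rn] := eqVneq r 1.
  by have := le_lt_trans hz zd; rewrite re mul1r ltxx.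
have {rn}r1 : 1 < r by rewrite lt_neqAle eq_sym rn.
have r0 := lt_trans ltr01 r1.
have th : 0 < r^-1 < 1 by rewrite invr_gt0 r0 invf_lt1.
have uv : z != z + r * d.
  rewrite -subr_eq0 opprD addNKr oppr_eq0 mulf_eq0 (gt_eqF r0)/=.
  by apply: contraTneq zd => ->; rewrite addr0 ltxx.
have := G_strictly_convex T0 s0 g0 l0 Tl gX th uv.
have -> : (1 - r^-1) * z + r^-1 * (z + r * d) = z + d by field; rewrite gt_eqF.
have := ler_wpM2l (ltW (andP th).1) hz.
move: (G _ _ _ _ (z + r * d)) (G _ _ _ _ z) (G _ _ _ _ (z + d)) zd => a b c.
clear hz hd Hr; lra.
Qed.

Lemma dist_lt_of_sides (R : realFieldType) (e u v : R) :
  0 < e -> (v - u) / e < 1 -> (v - u) / - e < 1 -> `|u - v| < e.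
Proof.
move=> e0; rewrite invrN mulrN -mulNr !ltr_pdivrMr// mul1r => h1 h2.
by rewrite ltr_norml; apply/andP; split; lra.
Qed.

(** At z + d and z - d the limit G exceeds its minimum, and so does G for g_n
    with n large; by convexity the minimizer of the latter stays between. *)
Lemma G_argmin_cvg (R : realType) (T sigma gamma l K : R) (gn : nat -> R -> R)
    (g : R -> R) :
  0 < T -> 0 < sigma -> 0 < gamma -> 0 < l -> 2 * T * sigma ^+ 2 * gamma * l < 1 ->
  (forall n, X_l l (gn n)) -> X_l l g -> (forall n, `|gn n 0| <= K) ->
  (forall y, gn n y @[n --> \oo] --> g y) ->
  G_argmin T sigma gamma (gn n) @[n --> \oo] --> G_argmin T sigma gamma g.
Proof.
move=> T0 s0 g0 l0 Tl gnX gX gnK gng; set z := G_argmin T sigma gamma g.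
have Hz : argmin (G T sigma gamma g) z by exact: G_argminP T0 s0 g0 l0 Tl gX.
(* The ratio of zn - z to d is below 1: zn is not beyond z + d. *)
have side (d : R) : d != 0 -> \forall n \near \oo,
    (G_argmin T sigma gamma (gn n) - z) / d < 1.
  move=> d0.
  have lt_zd : G T sigma gamma g z < G T sigma gamma g (z + d).
    rewrite ltNge; apply: contra d0 => le_dz.
    have Hd : argmin (G T sigma gamma g) (z + d).
      by move=> y; exact: le_trans le_dz (Hz y).
    have := G_argmin_unique T0 s0 g0 l0 Tl gX Hd Hz.
    by move/eqP; rewrite addrC -subr_eq0 addrK.
  have cG y : G T sigma gamma (gn n) y @[n --> \oo] --> G T sigma gamma g y.
    by apply: (G_cvg T0 s0 g0 l0 Tl gnX gX gnK gng); exact: cvg_cst.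
  have cD : G T sigma gamma (gn n) (z + d) - G T sigma gamma (gn n) z
      @[n --> \oo] --> G T sigma gamma g (z + d) - G T sigma gamma g z.
    exact: cvgB (cG (z + d)) (cG z).
  have D0 : 0 < G T sigma gamma g (z + d) - G T sigma gamma g z by rewrite subr_gt0.
  apply: filterS (cvgr_gt _ cD _ D0) => n; rewrite /= subr_gt0 => lt_n.
  apply: (G_argmin_near T0 s0 g0 l0 Tl (gnX n) lt_n).
  rewrite (divfK d0) subrKC; exact: G_argminP T0 s0 g0 l0 Tl (gnX n).
apply/cvgrPdist_lt => e e0.
have en : e != 0 by rewrite gt_eqF.
have eN : - e != 0 by rewrite oppr_eq0.
near=> n; apply: dist_lt_of_sides => //; near: n; exact: side.
Unshelve. all: by end_near. Qed.

Theorem lemma6p2 (R : realType) :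
  exists K : R -> R -> R -> R -> R,
  forall T sigma gamma l alpha : R,
  0 < T -> 0 < sigma -> 0 < gamma ->
  0 < l < 1 / (2 * T * sigma ^+ 2 * gamma) -> 0 < alpha < 1 ->
  (* G_g is well defined and has the stated probabilistic form *)
  (forall g z, X_l l g ->
    lebesgue_measure.-integrable setT (EFin \o G_integrand T sigma gamma g z) /\
    forall (d : measure_display) (Omega : measurableType d)
      (Pr : probability Omega R) (B : R -> {RV Pr >-> R}),
      brownian_motion B ->
      (G T sigma gamma g z)%:E =
      ('E_Pr[fun w => expR (z ^+ 2 / (2 * sigma ^+ 2 * T)
         + gamma * antiderivative g (z + sigma * B T w))])%E) /\
  (* chi0 g and Gam0 g are the extensions of chi(0,0) and Gamma(0,0) *)
  exists chi0 Gam0 : (R -> R) -> R,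
  [/\ forall g P, X_l l g -> C_l_alpha l alpha (antiderivative g) ->
        is_P T sigma gamma l (antiderivative g) P ->
        chi0 g = chi T sigma gamma P 0 0 /\ Gam0 g = Gam T sigma gamma P 0 0,
      forall g, X_l l g ->
        argmin (G T sigma gamma g) = [set chi0 g] /\
        exists m, is_minimum (fun z => ln (G T sigma gamma g z) / gamma) m /\
          Gam0 g = m - chi0 g ^+ 2 / (2 * sigma ^+ 2 * gamma * T),
      forall g, X_l l g ->
        `|chi0 g| <= K (g 0) gamma sigma T /\ `|Gam0 g| <= K (g 0) gamma sigma T &
      forall g : nat -> R -> R, (forall n, X_l l (g n)) ->
        {family compact, g n @[n --> \oo] --> g 0%N} ->
        (chi0 (g n), Gam0 (g n)) @[n --> \oo] --> (chi0 (g 0%N), Gam0 (g 0%N))].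
Proof.
exists (fun a gamma sigma T =>
  Num.max (chi_bound a gamma sigma T) (Gam_bound a gamma sigma T)).
move=> T sigma gamma l alpha T0 s0 g0 /andP[l0 lT] _.
have q0 : 0 < 2 * sigma ^+ 2 * gamma * T by rewrite !mulr_gt0// exprn_gt0.
have Tl : 2 * T * sigma ^+ 2 * gamma * l < 1.
  move: lT; rewrite ltr_pdivlMr; last by rewrite !mulr_gt0// exprn_gt0.
  by rewrite mulrC.
split=> [g z gX|].
  split; first exact: G_integrand_integrable T0 s0 g0 l0 Tl gX.
  by move=> d Omega Pr B; exact: G_brownian T0 s0 g0 l0 Tl gX.
pose chi0 := G_argmin T sigma gamma.
pose Gam0 g := G_min_log T sigma gamma g -
  chi0 g ^+ 2 / (2 * sigma ^+ 2 * gamma * T).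
exists chi0, Gam0; split.
- move=> g P gX _ HP.
  have [Hchi GE] := is_P_argmin T0 s0 g0 l0 Tl gX HP.
  have chiE : chi0 g = chi T sigma gamma P 0 0.
    exact: G_argmin_unique T0 s0 g0 l0 Tl gX (G_argminP T0 s0 g0 l0 Tl gX) Hchi.
  split; first exact: chiE.
  rewrite /Gam0 /G_min_log -/(chi0 g) chiE GE expRK.
  by field; rewrite !gt_eqF.
- move=> g gX; have Hz := G_argminP T0 s0 g0 l0 Tl gX; split.
    apply/seteqP; split=> z /=; last by move=> ->.
    by move=> Hz'; exact: G_argmin_unique T0 s0 g0 l0 Tl gX Hz' Hz.
  exists (G_min_log T sigma gamma g); split; last by [].
  exact: G_min_logP T0 s0 g0 l0 Tl gX.
- move=> g gX.
  have [h1 /andP[h2 h3]] :=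
    G_argmin_bounds T0 s0 g0 l0 Tl gX (G_argminP T0 s0 g0 l0 Tl gX).
  split; rewrite le_max; apply/orP; [by left|right].
  apply: (le_trans (ler_normB _ _)); apply: lerD.
    rewrite /G_min_log ger0_norm; last by rewrite divr_ge0// ltW.
    by rewrite ler_pM2r; [exact: h3|rewrite invr_gt0].
  rewrite ger0_norm; last by rewrite divr_ge0 ?sqr_ge0// ltW.
  rewrite ler_pM2r ?invr_gt0//.
  by rewrite -(real_normK (num_real (chi0 g))) lerXn2r ?nnegrE// (le_trans _ h1).
- move=> g gX /fam_cvgP gcvg.
  have gpt y : g n y @[n --> \oo] --> g 0%N y.
    have := gcvg [set y] (@compact_set1 _ y).
    by rewrite uniform_set1.
  have [K [_ HK]] : bounded_fun (fun n => g n 0).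
    by apply: cvg_seq_bounded; apply/cvg_ex; exists (g 0%N 0).
  have gK n : `|g n 0| <= K + 1 by apply: (HK (K + 1)) => //; rewrite ltrDl.
  have cchi := G_argmin_cvg T0 s0 g0 l0 Tl gX (gX 0%N) gK gpt.
  have cG := G_cvg T0 s0 g0 l0 Tl gX (gX 0%N) gK gpt cchi.
  have cGam : Gam0 (g n) @[n --> \oo] --> Gam0 (g 0%N).
    apply: cvgB; last by rewrite /chi0; take_limit.
    apply: cvgM; last exact: cvg_cst.
    apply: continuous_cvg cG.
    exact/continuous_ln/(G_gt0 _ T0 s0 g0 l0 Tl (gX 0%N)).
  exact: (cvg_pair cchi cGam).
Qed.
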